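(* Let $q_1,q_2:[0,\infty)\to\mathbb{R}$ be real-valued with $q_j\in L^1([0,R])$ for all $R>0$, $j=1,2$. For $j=1,2$ let $H_j=-\frac{d^2}{dx^2}+q_j$ be a self-adjoint Schrödinger operator in $L^2([0,\infty))$ with a Dirichlet boundary condition at $x=0_+$ (and a self-adjoint boundary condition at $\infty$, if $q_j$ is in the limit circle case there), and let $m_j(z)$, $z\in\mathbb{C}\setminus\mathbb{R}$, be the Weyl-Titchmarsh $m$-function associated with $H_j$. Let $a>0$, $0<\varepsilon<\pi/2$, and suppose that $$|m_1(z)-m_2(z)| = O\big(e^{-2\,\mathrm{Im}(z^{1/2})\,a}\big)\quad\text{as } |z|\to\infty$$ along the ray $\arg(z)=\pi-\varepsilon$. Then $$q_1(x)=q_2(x)\quad\text{for a.e. } x\in[0,a].$$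
   Context: The branch of the square root is fixed by $\mathrm{Im}(z^{1/2})\ge 0$. $\mathrm{AC}$ denotes absolutely continuous functions. For real-valued $q$ with $q\in L^1([0,R])$ for all $R>0$, the (Dirichlet) operator $H$ in $L^2([0,\infty))$ is $Hg=-g''+qg$ with domain $$\mathrm{dom}(H)=\{g\in L^2([0,\infty)) : g,g'\in \mathrm{AC}([0,R])\ \forall R>0;\ g(0_+)=0;\ \text{s.-a. b.c. at }\infty;\ -g''+qg\in L^2([0,\infty))\}.$$ Here ''s.-a. b.c. at $\infty$'' is a fixed self-adjoint boundary condition at $\infty$, present only if $q$ is in the limit circle case at $\infty$ (in the limit point case there is no condition); e.g. it can be given as $\lim_{x\to\infty}(f g'-f'g)(x)=0$, where $f\in L^2([0,\infty))$ is a nonzero solution of $-f''+qf=z_0f$ for some $z_0\in\mathbb{C}\setminus\mathbb{R}$, chosen such that $H$ is self-adjoint. The Weyl solution $\psi(z,\cdot)$, $z\in\mathbb{C}\setminus\mathbb{R}$, is the nonzero solution, unique up to constant multiples, of $-\psi''(z,x)+[q(x)-z]\psi(z,x)=0$ with $\psi(z,\cdot)\in L^2([0,\infty))$ satisfying the s.-a. b.c. of $H$ at $\infty$ (if any). The Weyl-Titchmarsh $m$-function of $H$ is $m(z)=\psi'(z,0_+)/\psi(z,0_+)$. Primes denote $x$-derivatives. *)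

(* Defs.v *)
From mathcomp Require Import all_boot all_order all_algebra.
From mathcomp Require Import all_classical all_reals all_analysis.
From mathcomp Require Export complex.

Set Implicit Arguments.
Unset Strict Implicit.
Unset Printing Implicit Defensive.

Import Order.TTheory GRing.Theory Num.Theory.
Import numFieldNormedType.Exports.

Local Open Scope classical_set_scope.
Local Open Scope ring_scope.
Local Open Scope complex_scope.

Notation normc := ComplexField.Normc.normc.

(* Functions on the half-line [0, oo[ are represented by functions on R; every
   notion below depends only on their values at nonnegative arguments. *)
Section HalfLine.
Context {R : realType}.
Local Notation C := R[i].
Local Notation mu := (@lebesgue_measure R).
Local Notation half_line := (`[0%R, +oo[%classic : set R).

(* The square root with Im (z^(1/2)) >= 0; the library's sqrtc takes the root
   with nonnegative real part. *)
Definition sqrt_up (z : C) : C :=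
  if 0 <= complex.Im (sqrtc z) then sqrtc z else - sqrtc z.

Definition ray (theta r : R) : C := (r * cos theta) +i* (r * sin theta).

Definition ae_half_line (P : R -> Prop) : Prop :=
  {ae mu, forall x, 0 <= x -> P x}.

(* lebesgue_measure lives on the Borel sigma-algebra. Lebesgue measurability
   amounts to a.e. equality with a Borel function, whence the representatives
   q0 in L1_loc and h in L2. *)
Definition L1_loc (q : R -> R) : Prop :=
  forall b : R, 0 < b ->
  exists2 q0 : R -> R, mu.-integrable `[0, b]%classic (EFin \o q0) &
    {ae mu, forall x, x \in `[0, b] -> q x = q0 x}.

Definition borel_L2 (h : R -> C) : Prop :=
  [/\ measurable_fun half_line (fun x => complex.Re (h x)),
      measurable_fun half_line (fun x => complex.Im (h x)) &
      (\int[mu]_(x in half_line) (normc (h x) ^+ 2)%:E < +oo)%E].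

Definition L2 (g : R -> C) : Prop :=
  exists2 h : R -> C, borel_L2 h & ae_half_line (fun x => g x = h x).

Definition L2_inner (u v : R -> C) : C :=
  (\int[mu]_(x in half_line) complex.Re (u x * (v x)^*)) +i*
  (\int[mu]_(x in half_line) complex.Im (u x * (v x)^*)).

Definition absolutely_continuous (a b : R) (g : R -> C) : Prop :=
  forall e : R, 0 < e -> exists2 d : R, 0 < d &
  forall (n : nat) (u v : 'I_n -> R),
    (forall i, [&& a <= u i, u i <= v i & v i <= b]) ->
    trivIset setT (fun i => `]u i, v i[%classic) ->
    \sum_(i < n) (v i - u i) < d ->
    \sum_(i < n) normc (g (v i) - g (u i)) < e.

(* Difference quotients only use points of [0, oo[, so that the derivative at
   0 is the right derivative. *)
Definition diff_quot (g : R -> R) (x : R) : set_system R :=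
  (fun y => (g y - g x) / (y - x)) @ within half_line x^'.

Definition hl_derivable (g : R -> C) (x : R) : Prop :=
  cvg (diff_quot (fun y => complex.Re (g y)) x) /\
  cvg (diff_quot (fun y => complex.Im (g y)) x).

Definition hl_deriv (g : R -> C) (x : R) : C :=
  lim (diff_quot (fun y => complex.Re (g y)) x) +i*
  lim (diff_quot (fun y => complex.Im (g y)) x).

(* g and g' are in AC([0, b]) for all b > 0; in particular g'(0) = g'(0+). *)
Definition AC1 (g : R -> C) : Prop :=
  (forall x, 0 <= x -> hl_derivable g x) /\
  (forall b, 0 < b -> absolutely_continuous 0 b g /\
                      absolutely_continuous 0 b (hl_deriv g)).

Definition schrodinger_expr (q : R -> R) (g : R -> C) (x : R) : C :=
  - hl_deriv (hl_deriv g) x + (q x)%:C * g x.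

Definition wronskian (f g : R -> C) (x : R) : C :=
  f x * hl_deriv g x - hl_deriv f x * g x.

Definition solution (q : R -> R) (z : C) (g : R -> C) : Prop :=
  AC1 g /\
  ae_half_line
    (fun x => - hl_deriv (hl_deriv g) x + ((q x)%:C - z) * g x = 0).

Definition nonzero (g : R -> C) : Prop := exists2 x, 0 <= x & g x != 0.

Definition limit_circle (q : R -> R) : Prop :=
  forall (z : C) (g : R -> C), solution q z g -> L2 g.

(* The boundary condition at oo is given by a function f, and is void (f being
   then irrelevant) in the limit point case. *)
Definition bc_function (q : R -> R) (f : R -> C) : Prop :=
  limit_circle q ->
  exists2 z0 : C, complex.Im z0 != 0 &
    [/\ solution q z0 f, nonzero f & L2 f].

Definition bc_infty (q : R -> R) (f g : R -> C) : Prop :=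
  limit_circle q -> normc (wronskian f g x) @[x --> +oo] --> (0 : R).

Definition dom_H (q : R -> R) (f : R -> C) : set (R -> C) :=
  [set g | [/\ L2 g, AC1 g, g 0 = 0, bc_infty q f g &
               L2 (schrodinger_expr q g)]].

(* h is a Borel representative of H g. *)
Definition graph_H (q : R -> R) (f g h : R -> C) : Prop :=
  [/\ dom_H q f g, borel_L2 h &
      ae_half_line (fun x => h x = schrodinger_expr q g x)].

Definition densely_defined (q : R -> R) (f : R -> C) : Prop :=
  forall u : R -> C, borel_L2 u -> forall e : R, 0 < e ->
  exists2 g, dom_H q f g &
    (\int[mu]_(x in half_line) (normc (u x - g x) ^+ 2)%:E < e%:E)%E.

(* (u, w) is in the graph of the adjoint of H. *)
Definition adjoint_graph_H (q : R -> R) (f u w : R -> C) : Prop :=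
  [/\ borel_L2 u, borel_L2 w &
      forall g h, graph_H q f g h -> L2_inner h u = L2_inner g w].

Definition self_adjoint_H (q : R -> R) (f : R -> C) : Prop :=
  densely_defined q f /\
  forall u w : R -> C, borel_L2 u -> borel_L2 w ->
    (adjoint_graph_H q f u w <->
     exists g h, [/\ graph_H q f g h, ae_half_line (fun x => g x = u x) &
                     ae_half_line (fun x => h x = w x)]).

Definition weyl_solution (q : R -> R) (f : R -> C) (z : C) (psi : R -> C) :
    Prop :=
  [/\ solution q z psi, nonzero psi, L2 psi & bc_infty q f psi].

Definition is_m_function (q : R -> R) (f : R -> C) (m : C -> C) : Prop :=
  forall z : C, complex.Im z != 0 ->
  exists2 psi, weyl_solution q f z psi & m z = hl_deriv psi 0 / psi 0.

End HalfLine.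

(* Main.v *)
(* For x <= a let phi_j, theta_j be the solutions of -y'' + q_j y = z y with
   Dirichlet and Neumann data at 0, and F(z) = phi_1 theta_2 - phi_2 theta_1 at x,
   an entire function of order 1/2 in z. With the Weyl solutions
   psi_j = theta_j + m_j phi_j one has
     F = phi_1 psi_2 - phi_2 psi_1 + (m_1 - m_2) phi_1 phi_2.
   The last term is O(1/|z|) on the ray by hypothesis, and phi_i psi_j is
   O(|z|^(-1/2)) by the sign of Im (psi' conj psi). By conjugation F tends to 0 on
   two rays bounding sectors of opening less than 2 pi, so F is bounded by
   Phragmen-Lindelof and vanishes. Differentiating F(i) = 0 in x and using the
   Wronskians gives phi_1^2 = phi_2^2 at z = i, whence q_1 = q_2. *)

Require Import Defs.
From mathcomp Require Import all_boot all_order all_algebra.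
From mathcomp Require Import all_classical all_reals all_analysis.
From mathcomp Require Import complex.
From mathcomp Require Import measurable_realfun.
From mathcomp Require Import ring lra zify.

Set Implicit Arguments.
Unset Strict Implicit.
Unset Printing Implicit Defensive.

Import Order.TTheory GRing.Theory Num.Theory.
Import numFieldNormedType.Exports.

Local Open Scope classical_set_scope.
Local Open Scope ring_scope.

(** * Absolutely continuous functions *)

(** Solutions are AC in the epsilon-delta sense and satisfy their equation only a.e., for a
    [hl_deriv] that takes a default value where the limit does not exist. Nothing can be integrated
    before two facts are known: an AC function is a.e. differentiable, and its derivative controls
    its increments. Both are derived from Vitali coverings.

    The sign of Im (psi' conj psi) comes from its being Im z times the integral of |psi|^2 beyond x.
    This is read off from the symmetry of [H], tested on psi cut off near 0, so that limit point and
    limit circle are treated alike.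

    No contour integral occurs. F is a limit of polynomials, uniform on disks; the maximum principle
    on rectangles passes to such limits, and z = e^(s + i t) turns sectors into half-strips.
    Phragmen-Lindelof carries the decay |z|^(-1/2) from the ray to every direction, and large
    squares then force F = 0. The exponent 2 Im (z^(1/2)) a in the hypothesis matches the growth
    e^(2 Im (z^(1/2)) x) of phi_1 phi_2, which is why x stops at a. *)

Section IntervalFamilies.
Context {R : realType}.
Local Notation mu := (@lebesgue_measure R).
Implicit Types (g : R -> R) (a b : R) (I J s : seq (R * R)).

(** Real counterpart of [absolutely_continuous]; complex functions are treated through their two
    components, see [cacP]. *)
Definition ac a b g : Prop :=
  forall e : R, 0 < e -> exists2 d : R, 0 < d &
  forall (n : nat) (u v : 'I_n -> R),
    (forall i, [&& a <= u i, u i <= v i & v i <= b]) ->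
    trivIset setT (fun i => `]u i, v i[%classic) ->
    \sum_(i < n) (v i - u i) < d ->
    \sum_(i < n) `|g (v i) - g (u i)| < e.

Definition nonoverlapping : seq (R * R) -> bool :=
  pairwise (fun p q => (p.2 <= q.1) || (q.2 <= p.1)).

Definition in_itvs a b s : bool := all (fun p => [&& a <= p.1, p.1 <= p.2 & p.2 <= b]) s.

Definition cover s : set R := \big[setU/set0]_(p <- s) `[p.1, p.2]%classic.

Definition increment g s : R := \sum_(p <- s) (g p.2 - g p.1).

Lemma coverP s t : cover s t <-> exists2 p, p \in s & p.1 <= t <= p.2.
Proof.
rewrite /cover; split; rewrite -bigcup_seq.
  by move=> [p ps]; rewrite /= in_itv/= => h; exists p.
by move=> [p ps h]; exists p => //=; rewrite in_itv.
Qed.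

Lemma measurable_cover s : measurable (cover s).
Proof. by rewrite /cover; apply: bigsetU_measurable => p _. Qed.

(** The function [g], composed with the clamp to [p.1, p.2], telescopes along the grid [x]. No
    endpoint of [p] lies strictly inside a cell, so on each cell the clamp is the identity or
    constant. *)
Lemma increment_telescope g (x : nat -> R) n (p : R * R) : p.1 <= p.2 ->
  x 0%N <= p.1 -> p.2 <= x n ->
  (forall k, (k < n)%N -> x k <= x k.+1) ->
  (forall k y, (k < n)%N -> y \in [:: p.1; p.2] -> (y <= x k) || (x k.+1 <= y)) ->
  g p.2 - g p.1 = \sum_(k < n) (((p.1 <= x k) && (x k.+1 <= p.2))%:R * (g (x k.+1) - g (x k))).
Proof.
move=> p12 x0 xn xS adj.
pose c t := Num.min (Num.max t p.1) p.2.
have -> : g p.2 - g p.1 = g (c (x n)) - g (c (x 0%N)).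
  rewrite /c (max_idPr x0) (min_idPl p12).
  by rewrite (min_idPr _)// le_max xn.
rewrite -(telescope_sumr (fun k => g (c (x k)))) // big_mkord.
apply: eq_bigr => k _.
have kn : (k < n)%N by [].
have xk := xS _ kn.
have := adj k p.1 kn; have := adj k p.2 kn.
rewrite !inE !eqxx orbT => /(_ isT) a2 /(_ isT) a1.
rewrite /c.
have [h1|h1] := lerP p.1 (x k); rewrite /=.
  rewrite (@max_l _ _ (x k.+1)) ?(le_trans h1)//.
  have [h2|h2] := lerP (x k.+1) p.2; rewrite ?mul1r ?mul0r.
    rewrite !min_l//; exact: le_trans h2.
  have h3 : p.2 <= x k by move: a2; rewrite (leNgt (x k.+1)) h2 orbF.
  by rewrite min_r ?subrr.
have h3 : x k.+1 <= p.1 by move: a1; rewrite (leNgt p.1) h1.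
rewrite mul0r (max_idPr h3) (min_idPl p12).
by rewrite subrr.
Qed.

(** Exchange of two sums: the increment over a cell is counted once for every interval of [s] that
    contains the cell. For a nonoverlapping family this count is 0 or 1 on nondegenerate cells. *)
Lemma increment_partition g (x : nat -> R) n s :
  (forall k, (k < n)%N -> x k <= x k.+1) ->
  (forall p, p \in s -> [&& x 0%N <= p.1, p.1 <= p.2 & p.2 <= x n]) ->
  (forall k p y, (k < n)%N -> p \in s -> y \in [:: p.1; p.2] ->
    (y <= x k) || (x k.+1 <= y)) ->
  increment g s = \sum_(k < n) ((count (fun p => (p.1 <= x k) && (x k.+1 <= p.2)) s)%:R
                                * (g (x k.+1) - g (x k))).
Proof.
move=> xS bd adj; rewrite /increment.
transitivity (\sum_(p <- s) \sum_(k < n)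
    (((p.1 <= x k) && (x k.+1 <= p.2))%:R * (g (x k.+1) - g (x k)))).
  rewrite big_seq [RHS]big_seq; apply: eq_bigr => p ps.
  have /and3P[p0 p12 pn] := bd _ ps.
  by apply: increment_telescope => // k y kn yp; exact: (adj k p).
rewrite exchange_big; apply: eq_bigr => k _.
rewrite -mulr_suml; congr (_ * _).
by rewrite -sum1_count natr_sum [RHS]big_mkcond; apply: eq_bigr => p _; case: ifP.
Qed.

Lemma count_nonoverlapping (y z : R) s : y < z -> nonoverlapping s ->
  (count (fun p => (p.1 <= y)%R && (z <= p.2)%R) s <= 1)%N.
Proof.
move=> yz; elim: s => //= p s IH /andP[/allP ps /IH{}IH].
have [/andP[py pz]|_] := boolP (_ && _); last by rewrite add0n.
suff -> : count (fun p0 => (p0.1 <= y) && (z <= p0.2)) s = 0%N by [].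
apply/eqP; rewrite -leqn0 leqNgt -has_count; apply/negP => /hasP[q qs /andP[qy qz]].
have /orP[h|h] := ps _ qs.
  by have := lt_le_trans (le_lt_trans qy yz) (le_trans pz h); rewrite ltxx.
by have := lt_le_trans (le_lt_trans py yz) (le_trans qz h); rewrite ltxx.
Qed.

Lemma sum_lengths_le n (u v : 'I_n -> R) (A : set R) (d : R) :
  (forall i, u i <= v i) -> trivIset setT (fun i => `]u i, v i[%classic) ->
  measurable A -> (forall i, `]u i, v i[%classic `<=` A) -> (mu A < d%:E)%E ->
  \sum_(i < n) (v i - u i) < d.
Proof.
move=> uv tI mA sub muA; rewrite -lte_fin; apply: le_lt_trans muA.
have -> : ((\sum_(i < n) (v i - u i))%:E = mu (\big[setU/set0]_(i < n) `]u i, v i[%classic))%E.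
  rewrite measure_semi_additive_ord//; last exact: bigsetU_measurable.
  rewrite -sumEFin; apply: eq_bigr => i _.
  rewrite -[RHS]/(lebesgue_measure _) lebesgue_measure_itv /= lte_fin.
  case: ltP => // h; have -> : v i = u i by apply/eqP; rewrite eq_le h uv.
  by rewrite subrr.
apply: le_measure; rewrite ?inE//; first exact: bigsetU_measurable.
by rewrite -bigcup_seq => t [i _]; exact: sub.
Qed.

(** On the grid of all endpoints of [I] and [J], the increments differ only through cells that
    belong to exactly one family, each with coefficient 1 or -1. These cells lie in the symmetric
    difference of the covers, so absolute continuity applies. The increment over a family thus
    nearly depends on the covered set alone. *)
Lemma ac_increment_symm_diff a b g e : ac a b g -> 0 < e ->
  exists2 d, 0 < d & forall I J, in_itvs a b I -> in_itvs a b J ->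
    nonoverlapping I -> nonoverlapping J ->
    (mu ((cover I `\` cover J) `|` (cover J `\` cover I)) < d%:E)%E ->
    `|increment g I - increment g J| < e.
Proof.
move=> acg e0; have [d d0 H] := acg e e0; exists d => // I J Iab Jab nI nJ muIJ.
pose pts := sort <=%O (flatten [seq [:: p.1; p.2] | p <- I ++ J]).
have ptsP p y : p \in I ++ J -> y \in [:: p.1; p.2] -> y \in pts.
  move=> pIJ yp; rewrite mem_sort; apply/flattenP.
  by exists [:: p.1; p.2] => //; apply/mapP; exists p.
have [pts0|szpts] := posnP (size pts).
  suff IJ0 : I ++ J = [::].
    case: I J IJ0 {Iab Jab nI nJ muIJ pts ptsP pts0} => // -[] // _.
    by rewrite subrr normr0.
  case: (I ++ J) ptsP => // p s /(_ p p.1 (mem_head _ _) (mem_head _ _)).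
  by rewrite -index_mem pts0.
pose x k := nth 0 pts k; pose n := (size pts).-1.
have nE : n.+1 = size pts by rewrite prednK.
have spts : sorted <=%O pts by exact/sort_sorted/le_total.
have xle i j : (i <= j)%N -> (j <= n)%N -> x i <= x j.
  move=> ij jn; apply: le_sorted_leq_nth => //; rewrite inE -nE ltnS//.
  exact: leq_trans jn.
have xS k : (k < n)%N -> x k <= x k.+1 by move=> kn; apply: xle.
have ptsx y : y \in pts -> exists2 i, (i <= n)%N & y = x i.
  by move=> /(nthP 0)[i ilt <-]; exists i; rewrite // -ltnS nE.
have xpts i : (i <= n)%N -> exists2 p, p \in I ++ J & x i \in [:: p.1; p.2].
  move=> ilt; have : x i \in pts by rewrite mem_nth// -nE ltnS.
  rewrite mem_sort => /flattenP[_ /mapP[p pIJ ->] h].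
  by exists p.
have bdp p : p \in I ++ J -> [&& a <= p.1, p.1 <= p.2 & p.2 <= b].
  by rewrite mem_cat => /orP[|]; [move/(allP Iab)|move/(allP Jab)].
have xab i : (i <= n)%N -> a <= x i <= b.
  move=> /xpts[p /bdp/and3P[h1 h2 h3]].
  rewrite !inE => /orP[|] /eqP ->; first by rewrite h1 (le_trans h2).
  by rewrite h3 (le_trans h1).
have adj k p y : (k < n)%N -> p \in I ++ J -> y \in [:: p.1; p.2] ->
    (y <= x k) || (x k.+1 <= y).
  move=> kn pIJ yp; have [i ilt ->] := ptsx _ (ptsP _ _ pIJ yp).
  have [ik|ki] := leqP i k; first by rewrite (xle _ _ ik (ltnW kn)).
  by rewrite (xle _ _ ki ilt) orbT.
have bd p : p \in I ++ J -> [&& x 0%N <= p.1, p.1 <= p.2 & p.2 <= x n].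
  move=> pIJ; have /and3P[_ -> _] := bdp _ pIJ.
  have [i ilt ->] := ptsx p.1 (ptsP _ _ pIJ (mem_head _ _)).
  have [j jn ->] : exists2 j, (j <= n)%N & p.2 = x j.
    by apply: ptsx; apply: (ptsP p) => //; rewrite !inE eqxx orbT.
  by rewrite !xle.
pose N s k := count (fun p => (p.1 <= x k) && (x k.+1 <= p.2)) s.
have incE s : {subset s <= I ++ J} ->
    increment g s = \sum_(k < n) ((N s k)%:R * (g (x k.+1) - g (x k))).
  move=> sIJ; apply: increment_partition => // [p ps|k p y kn ps].
    exact/bd/sIJ.
  by apply: adj => //; exact: sIJ.
have subI : {subset I <= I ++ J} by move=> p pI; rewrite mem_cat pI.
have subJ : {subset J <= I ++ J} by move=> p pI; rewrite mem_cat pI orbT.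
rewrite !incE// -sumrB.
pose bad k := (x k < x k.+1) && (N I k != N J k).
(* A cell that does not count is shrunk to an empty interval, so that absolute continuity applies to
   a family indexed by all cells. *)
pose v (k : 'I_n) := if bad k then x k.+1 else x k.
have N1 s k : nonoverlapping s -> x k < x k.+1 -> (N s k <= 1)%N.
  by move=> ns xk; exact: count_nonoverlapping.
apply: (le_lt_trans (ler_norm_sum _ _ _)).
apply: (@le_lt_trans _ _ (\sum_(k < n) `|g (v k) - g (x k)|)).
  apply: ler_sum => k _; rewrite -mulrBl normrM /v /bad.
  have := xS k (ltn_ord k); rewrite le_eqVlt => /orP[/eqP ->|xk].
    by rewrite !subrr normr0 mulr0 if_same.
  rewrite xk/=.
  have [->|NIJ] := eqVneq (N I k) (N J k); first by rewrite !subrr normr0 mul0r.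
  rewrite /= -[leRHS]mul1r ler_wpM2r//.
  move: (N1 _ _ nI xk) (N1 _ _ nJ xk) NIJ.
  case: (N I k) => [|[|//]]; case: (N J k) => [|[|//]] _ _ // _.
    by rewrite sub0r normrN normr1.
  by rewrite subr0 normr1.
have vx (k : 'I_n) : x k <= v k by rewrite /v; case: ifP => // /andP[/ltW].
have tI : trivIset setT (fun i : 'I_n => `]x i, v i[%classic).
  apply/trivIsetP => i j _ _; wlog ij : i j / (i < j)%N.
    move=> W nij; have [ij|ji|ij] := ltngtP i j; first exact: W.
      by rewrite setIC; apply: W => //; rewrite eq_sym.
    by move: nij; rewrite (ord_inj ij) eqxx.
  move=> _; rewrite -subset0 => t [] /=; rewrite !in_itv/= => /andP[_ tv] /andP[xt _].
  have : v i <= x j.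
    rewrite /v; case: ifP => _; apply: xle => //; first exact: ltnW.
      exact: ltnW.
    exact: ltnW.
  by move=> vj; have := lt_trans xt (lt_le_trans tv vj); rewrite ltxx.
apply: H.
- move=> i; rewrite vx/=; have /andP[-> _]/= := xab i (ltnW (ltn_ord i)).
  rewrite /v; case: ifP => _; first by have /andP[] := xab i.+1 (ltn_ord i).
  by have /andP[] := xab i (ltnW (ltn_ord i)).
- exact: tI.
- apply: (sum_lengths_le (A := (cover I `\` cover J) `|` (cover J `\` cover I))) => //.
  + by apply: measurableU; apply: measurableD; exact: measurable_cover.
  + move=> k t /=; rewrite in_itv/= => /andP[xt]; rewrite /v.
    case: ifP => [/andP[xk NIJ] tx|_ tx]; last by have := lt_trans xt tx; rewrite ltxx.
    (* An interior point of a cell is covered by [s] exactly when some interval of [s] contains the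
       whole cell, since no endpoint falls strictly inside. *)
    have inN s : {subset s <= I ++ J} -> (cover s t <-> (0 < N s k)%N).
      move=> sIJ; rewrite coverP -has_count; split.
        move=> [p ps /andP[p1 p2]]; apply/hasP; exists p => //.
        have kn := ltn_ord k.
        have /orP[->/=|h] := adj k p p.1 kn (sIJ _ ps) (mem_head _ _); last first.
          by have := lt_le_trans tx (le_trans h p1); rewrite ltxx.
        have p2p : p.2 \in [:: p.1; p.2] by rewrite !inE eqxx orbT.
        have /orP[h|//] := adj k p p.2 kn (sIJ _ ps) p2p.
        by have := le_lt_trans (le_trans p2 h) xt; rewrite ltxx.
      move=> /hasP[p ps /andP[p1 p2]]; exists p => //.
      by rewrite (le_trans p1 (ltW xt)) (le_trans (ltW tx) p2).
    have cI := inN _ subI; have cJ := inN _ subJ.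
    have [NI|NI] := posnP (N I k).
      right; split; first by apply/cJ; rewrite lt0n; apply: contra NIJ => /eqP ->; rewrite NI.
      by rewrite cI NI.
    have [NJ|NJ] := posnP (N J k).
      by left; split; [apply/cI|rewrite cJ NJ].
    move: NIJ NI NJ (N1 _ _ nI xk) (N1 _ _ nJ xk).
    by case: (N I k) => [|[|]]; case: (N J k) => [|[|]].
Qed.

End IntervalFamilies.

(** * Vitali coverings and intervals of large slope *)

Section Vitali.
Context {R : realType}.
Local Notation mu := (@lebesgue_measure R).
Implicit Types (g : R -> R) (a b : R) (s : seq (R * R)) (E : set R).

(** Rational centres and radii make the candidate balls countable, so that the covering theorem for
    sequences of balls applies; [P] is read as a property of the two endpoints. *)
Lemma vitali_family E (P : R -> R -> Prop) : (mu E < +oo)%E ->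
  (forall x, E x -> forall e : R, 0 < e -> exists c r : rat,
    [/\ 0 < (ratr r : R) < e, (ratr c - ratr r : R) < x < ratr c + ratr r &
        P (ratr c - ratr r) (ratr c + ratr r)]) ->
  forall e : R, 0 < e -> exists s, [/\ nonoverlapping s,
    forall p, p \in s -> p.1 < p.2 /\ P p.1 p.2 & (mu (E `\` cover s) < e%:E)%E].
Proof.
move=> Efin fine e e0.
(* Indices that decode to no ball of positive radius get centre 0 and radius 1. This is harmless:
   [V] admits an index only if [P] holds for the endpoints of its ball. *)
pose par n : R * R := if (unpickle n : option (rat * rat)) is Some (c, r)
  then if 0 < r then (ratr c, ratr r) else (0, 1) else (0, 1).
pose B n : set R := ball (par n).1 (par n).2.
have par0 n : 0 < (par n).2.
  rewrite /par; case: unpickle => [[c r]|//].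
  by case: ifP => // r0; rewrite ltr0q.
have B0 n : 0 < (radius (B n))%:num by rewrite radius_ball_num// ltW.
pose V := [set n | P ((par n).1 - (par n).2) ((par n).1 + (par n).2)].
have VB : vitali_cover E B V.
  split=> [n|x Ex d d0]; first exact: is_ball_ball.
  have [c [r [/andP[r0 rd] xcr Pcr]]] := fine x Ex d d0.
  have parE : par (pickle (c, r)) = (ratr c, ratr r).
    by rewrite /par pickleK -[0 < r](ltr0q R) r0.
  move: (pickle (c, r)) parE => n parE.
  exists n; split; rewrite /V /B /mkset parE//.
    by rewrite ball_itv /= in_itv.
  by rewrite radius_ball_num// ltW.
have [G [GV tG muG]] := vitali_theorem_corollary B0 Efin VB e0.
pose f n := ((par n).1 - (par n).2, (par n).1 + (par n).2).
have clB n : closure (B n) = `[(f n).1, (f n).2]%classic.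
  by rewrite closure_ballE closed_ball_itv.
exists [seq f n | n <- finmap.enum_fset G]; split.
- rewrite /nonoverlapping pairwise_map.
  have uG : uniq (finmap.enum_fset G) by exact: finmap.fset_uniq.
  suff H l : uniq l -> {subset l <= finmap.enum_fset G} ->
      pairwise (relpre f (fun p q : R * R => (p.2 <= q.1) || (q.2 <= p.1))) l by exact: H.
  elim: l => //= n l IH /andP[nl ul] sub.
  rewrite IH//; last by move=> m ml; apply: sub; rewrite inE ml orbT.
  rewrite andbT; apply/allP => m ml.
  have nm : n != m by apply: contraNneq nl => ->.
  apply/orP; have [h1|h1] := leP (f n).2 (f m).1; [by left|right].
  rewrite leNgt; apply/negP => h2.
  have nG : n \in finmap.enum_fset G by apply: sub; rewrite inE eqxx.
  have mG : m \in finmap.enum_fset G by apply: sub; rewrite inE ml orbT.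
  move/trivIsetP : tG => /(_ n m nG mG nm).
  rewrite /= !clB; apply/eqP/set0P.
  have n12 : (f n).1 < (f n).2 by rewrite /f/=; have := par0 n; lra.
  have m12 : (f m).1 < (f m).2 by rewrite /f/=; have := par0 m; lra.
  (* If neither interval lies to the left of the other, the larger left endpoint belongs to both,
     against disjointness. *)
  exists (Num.max (f n).1 (f m).1); split; rewrite /= in_itv/=.
    by rewrite le_max lexx/= ge_max (ltW n12) ltW.
  by rewrite le_max lexx orbT/= ge_max (ltW m12) andbT ltW.
- move=> p /mapP[n nG ->]; split; last exact: (GV _ nG).
  by rewrite /f/=; have := par0 n; lra.
- rewrite /cover big_map (eq_bigr (fun n => closure (B n)))//.
Qed.

Lemma ac_uniform_continuous a b g e : ac a b g -> 0 < e ->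
  exists2 d, 0 < d & forall u v, a <= u <= b -> a <= v <= b -> `|v - u| < d ->
    `|g v - g u| < e.
Proof.
move=> acg e0; have [d d0 H] := acg _ e0; exists d => //.
have W u v : a <= u -> v <= b -> u <= v -> v - u < d -> `|g v - g u| < e.
  move=> au vb uv vud.
  have := H 1%N (fun=> u) (fun=> v); rewrite !big_ord1; apply=> //.
    by move=> _; rewrite au uv vb.
  by apply/trivIsetP => i j _ _; rewrite !ord1 eqxx.
move=> u v /andP[au ub] /andP[av vb].
have [uv|/ltW vu] := leP u v.
  by rewrite ger0_norm ?subr_ge0//; exact: W.
by rewrite distrC ger0_norm ?subr_ge0// [`|g v - _|]distrC; exact: W.
Qed.

(* [u, v] is a slight enlargement of the interval between x and y, hence the
   strict inequality survives, by continuity. *)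
Lemma rat_itv_slope a b g (O : set R) c x e :
  ac a b g -> open O -> O x -> a < x < b ->
  (forall e : R, 0 < e -> exists y, [/\ y != x, `|y - x| < e & c < (g y - g x) / (y - x)]) ->
  0 < e -> exists q r : rat, [/\ 0 < (ratr r : R) < e, (ratr q - ratr r : R) < x < ratr q + ratr r &
    `[ratr q - ratr r, ratr q + ratr r]%classic `<=` O `&` `]a, b[%classic /\
    c * ((ratr q + ratr r) - (ratr q - ratr r)) < g (ratr q + ratr r) - g (ratr q - ratr r)].
Proof.
move=> acg oO Ox /andP[ax xb] sl e0.
have [d0 /= d00 dO] : nbhs x O by exact: open_nbhs_nbhs.
pose e1 := Num.min (Num.min e d0) (Num.min (x - a) (b - x)) / 4.
have : 0 < e1 by rewrite /e1 divr_gt0// !lt_min e0 d00 !subr_gt0 ax xb.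
have : e1 <= e / 4 by rewrite /e1 ler_pM2r// !ge_min lexx.
have : e1 <= d0 / 4 by rewrite /e1 ler_pM2r// !ge_min lexx !orbT.
have : e1 <= (x - a) / 4 by rewrite /e1 ler_pM2r// !ge_min lexx !orbT.
have : e1 <= (b - x) / 4 by rewrite /e1 ler_pM2r// !ge_min lexx !orbT.
move: e1 => e1 h1 h2 h3 h4 e10.
have [y [yx yxe cs]] := sl e1 e10.
have [p [q [pq xpq pqe cpq]]] : exists p q, [/\ p < q, p <= x <= q,
    (x - e1 < p /\ q < x + e1) & c * (q - p) < g q - g p].
  move: yxe; rewrite ltr_distl => /andP[xy yxe].
  move: yx; rewrite neq_lt => /orP[yx|yx].
    exists y, x; rewrite yx (ltW yx) lexx; split => //; first by split => //; lra.
    rewrite -ltr_pdivlMr ?subr_gt0//.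
    by rewrite -opprB -[x - y]opprB invrN mulrNN.
  exists x, y; rewrite yx (ltW yx) lexx; split => //; first by split => //; lra.
  by rewrite -ltr_pdivlMr ?subr_gt0.
have {}xpq : p <= x /\ x <= q by case/andP: xpq.
case: xpq pqe => px xq [ep eq].
(* [m] is the surplus in the slope inequality on [p, q]. Moving to rational endpoints within [d1]
   costs less than [m / 4] for each value of [g] and at most [m / 2] for the term in [c]. *)
pose m := g q - g p - c * (q - p).
have m0 : 0 < m by rewrite subr_gt0.
have m4 : 0 < m / 4 by rewrite divr_gt0.
have [d d_gt0 gd] := ac_uniform_continuous acg m4.
pose d1 := Num.min (Num.min d e1) (m / 4 / (`|c| + 1)).
have c1 : 0 < `|c| + 1 by rewrite ltr_wpDl.
have d10 : 0 < d1 by rewrite /d1 !lt_min d_gt0 e10/= divr_gt0.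
have d1d : d1 <= d by rewrite /d1 !ge_min lexx.
have d1e : d1 <= e1 by rewrite /d1 !ge_min lexx !orbT.
have d1m : d1 * (`|c| + 1) <= m / 4.
  by rewrite -ler_pdivlMr// /d1 !ge_min lexx !orbT.
have pd : p - d1 < p by lra.
have [u] := rat_in_itvoo pd.
rewrite in_itv/= => /andP[u1 u2].
have qd : q < q + d1 by lra.
have [v] := rat_in_itvoo qd.
rewrite in_itv/= => /andP[v1 v2].
exists ((u + v) / 2), ((v - u) / 2).
have r2 : ratr 2 = 2 :> R by rewrite ratr_nat.
have -> : ratr ((u + v) / 2) = (ratr u + ratr v) / 2 :> R.
  by rewrite fmorph_div rmorphD/= r2.
have -> : ratr ((v - u) / 2) = (ratr v - ratr u) / 2 :> R.
  by rewrite fmorph_div rmorphB/= r2.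
move: (ratr u) (ratr v) u1 u2 v1 v2 => {}u {}v u1 u2 v1 v2.
have -> : (u + v) / 2 - (v - u) / 2 = u by field.
have -> : (u + v) / 2 + (v - u) / 2 = v by field.
split; [lra|lra|split].
  move=> t /=; rewrite in_itv/= => /andP[ut tv]; split.
    by apply: dO; rewrite /ball/= ltr_distl; lra.
  by rewrite /= in_itv/=; lra.
have gv : `|g v - g q| < m / 4 by apply: gd; [lra|lra|rewrite gtr0_norm; lra].
have gu : `|g u - g p| < m / 4.
  by apply: gd; [lra|lra|rewrite distrC gtr0_norm; lra].
have cc : `|c * (v - u - (q - p))| <= m / 2.
  rewrite normrM.
  apply: (@le_trans _ _ (`|c| * (2 * d1))).
    by apply: ler_wpM2l => //; rewrite ger0_norm; lra.
  have -> : `|c| * (2 * d1) = 2 * (d1 * (`|c| + 1)) - 2 * d1 by ring.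
  by lra.
move: gv gu cc; rewrite !ltr_norml ler_norml => /andP[gv1 gv2] /andP[gu1 gu2] /andP[_].
rewrite mulrBr; rewrite /m in gv1 gv2 gu1 gu2 *.
by move: (c * (v - u)) (c * (q - p)) gv1 gu2 => A B; lra.
Qed.

End Vitali.

(** * Slopes and monotonicity of absolutely continuous functions *)

Section Differentiation.
Context {R : realType}.
Local Notation mu := (@lebesgue_measure R).
Implicit Types (g : R -> R) (a b : R) (s : seq (R * R)) (E : set R).

Definition good_family E (O : set R) (eta : R) s : Prop :=
  [/\ nonoverlapping s,
      forall p, p \in s -> p.1 < p.2 /\ `[p.1, p.2]%classic `<=` O &
      (mu (E `\` cover s) < eta%:E)%E].

(** Substitute for a bound on the upper derivate: it holds if the upper derivate at [x] exceeds [c],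
    and implies that it is at least [c]. Applied to [- g] and [- c], it concerns the lower
    derivate. *)
Definition frequent_slope g (x c : R) : Prop :=
  forall e : R, 0 < e ->
    exists y, [/\ y != x, `|y - x| < e & c < (g y - g x) / (y - x)].

(** [E] is an arbitrary set, on which [mu] is Lebesgue outer measure; sets described by derivates
    can thus be used without a proof that they are measurable. *)
Lemma frequent_slope_family a b g E (O : set R) c eta :
  ac a b g -> open O -> E `<=` O `&` `]a, b[%classic ->
  (forall x, E x -> frequent_slope g x c) -> 0 < eta ->
  exists s, good_family E (O `&` `]a, b[%classic) eta s /\
    forall p, p \in s -> c * (p.2 - p.1) < g p.2 - g p.1.
Proof.
move=> acg oO EO sl eta0.
have Efin : (mu E < +oo)%E.
  apply: (@le_lt_trans _ _ (mu `]a, b[)).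
    by apply: (@le_outer_measure _ _ ((wlength idfun)^*)%mu) => x /EO[].
  by rewrite lebesgue_measure_itv/=; case: ifP => _; rewrite ?ltry// -EFinB ltry.
have [|s [ns sP muE]] := @vitali_family R E
  (fun u v => `[u, v]%classic `<=` O `&` `]a, b[%classic /\ c * (v - u) < g v - g u) Efin _ _ eta0.
  move=> x Ex e e0; have [Ox] := EO _ Ex; rewrite /= in_itv/= => xab.
  exact: (rat_itv_slope acg oO Ox xab (sl x Ex) e0).
exists s; split; last by move=> p /sP[_ []].
by split=> // p /sP[? []].
Qed.

Lemma measure_cover_le s : all (fun p => p.1 <= p.2) s ->
  (mu (cover s) <= (\sum_(p <- s) (p.2 - p.1))%:E)%E.
Proof.
elim: s => [|p s IH] /=; first by rewrite /cover !big_nil measure0.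
move=> /andP[p12 /IH{}IH]; rewrite /cover !big_cons EFinD.
apply: (le_trans (measureU2 _ _ _)) => //; first exact: measurable_cover.
apply: leeD => //; rewrite -[leLHS]/(lebesgue_measure _) lebesgue_measure_itv/= lte_fin.
by case: ifP => _; rewrite -?EFinB// lee_fin subr_ge0.
Qed.

Lemma acD a b f g : ac a b f -> ac a b g -> ac a b (fun x => f x + g x).
Proof.
move=> acf acg e e0; have e20 : 0 < e / 2 by rewrite divr_gt0.
have [d d0 Hf] := acf _ e20; have [d' d'0 Hg] := acg _ e20.
exists (Num.min d d'); first by rewrite lt_min d0.
move=> n u v uv tI; rewrite lt_min => /andP[h1 h2].
rewrite [e]splitr; apply: le_lt_trans (ltrD (Hf n u v uv tI h1) (Hg n u v uv tI h2)).
rewrite -big_split/=; apply: ler_sum => i _.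
by apply: le_trans (ler_normD _ _); rewrite opprD addrACA.
Qed.

Lemma ac_lipschitz a b f (K : R) :
  (forall x y, a <= x -> x <= y -> y <= b -> `|f y - f x| <= K * (y - x)) -> ac a b f.
Proof.
move=> lip e e0; have K0 : 0 < `|K| + 1 by rewrite ltr_wpDl.
exists (e / (`|K| + 1)); first by rewrite divr_gt0.
move=> n u v uv _; rewrite ltr_pdivlMr// => h.
have uv' i : 0 <= v i - u i by rewrite subr_ge0; have /and3P[] := uv i.
apply: le_lt_trans h; rewrite mulr_suml; apply: ler_sum => i _.
have /and3P[h1 h2 h3] := uv i; apply: (le_trans (lip _ _ h1 h2 h3)).
rewrite mulrC ler_wpM2l//; apply: (le_trans (ler_norm _)).
by rewrite lerDl.
Qed.

Lemma ac_cst a b (c : R) : ac a b (fun=> c).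
Proof. by apply: (ac_lipschitz (K := 0)) => x y _ _ _; rewrite subrr normr0 mul0r. Qed.

Lemma ac_affine a b (c : R) : ac a b (fun x => c * x).
Proof.
apply: (ac_lipschitz (K := `|c|)) => x y _ xy _.
by rewrite -mulrBr normrM [X in _ * X]ger0_norm// subr_ge0.
Qed.

Lemma acN a b f : ac a b f -> ac a b (fun x => - f x).
Proof.
move=> acf e e0; have [d d0 H] := acf _ e0; exists d => // n u v uv tI h.
apply: le_lt_trans (H n u v uv tI h); apply: ler_sum => i _.
by rewrite -opprD normrN.
Qed.

Lemma ac_ext a b f g : (forall x, a <= x <= b -> f x = g x) -> ac a b f -> ac a b g.
Proof.
move=> fg acf e e0; have [d d0 H] := acf _ e0; exists d => // n u v uv tI h.
apply: le_lt_trans (H n u v uv tI h); apply: ler_sum => i _.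
have /and3P[h1 h2 h3] := uv i.
by rewrite -!fg// ?h1 ?h3 ?(le_trans h1 h2) ?(le_trans h2 h3).
Qed.

Lemma acS a b a' b' f : a <= a' -> b' <= b -> ac a b f -> ac a' b' f.
Proof.
move=> aa bb acf e e0; have [d d0 H] := acf _ e0; exists d => // n u v uv.
apply: H => i; have /and3P[h1 -> h3] := uv i.
by rewrite (le_trans aa h1) (le_trans h3 bb).
Qed.

(* The increments over almost covering families of intervals add up to at most
   0, and the increment over [a, b] differs from their sum by little. *)
Lemma ac_le_of_slopes a b f E : a <= b -> ac a b f ->
  mu.-negligible (`]a, b[%classic `\` E) ->
  (forall x c, E x -> a < x < b -> 0 < c -> frequent_slope (fun x => - f x) x (- c)) ->
  f b <= f a.
Proof.
move=> ab acf nE slE; apply/ler_addgt0Pr => e e0.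
have e20 : 0 < e / 2 by rewrite divr_gt0.
(* The tilt [c * x] makes the slopes of [g] frequently positive and costs at most [e / 2] over
   [a, b]; the [+ 1] covers the case [a = b]. *)
pose c := (e / 2) / (b - a + 1).
have ba0 : 0 < b - a + 1 by rewrite ltr_wpDl ?subr_ge0.
have c0 : 0 < c by rewrite divr_gt0.
pose g x := - f x + c * x.
have acg : ac a b g by apply: acD; [exact: acN|exact: ac_affine].
have [d d0 H] := ac_increment_symm_diff acg e20.
have [|x|s [[ns sab mus] incs]] := @frequent_slope_family a b g (E `&` `]a, b[%classic) setT 0 d acg openT _ _ d0.
  by move=> x []; split.
  move=> [Ex]; rewrite /= in_itv/= => xab r r0.
  have [y [yx yxr cl]] := slE x c Ex xab c0 r r0.
  exists y; split => //; rewrite -subr_gt0 subr0.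
  move: cl; rewrite -[- c]sub0r ltrBlDr => cl.
  have yx0 : y - x != 0 by rewrite subr_eq0.
  rewrite (_ : (g y - g x) / (y - x) = (- f y - - f x) / (y - x) + c)//.
  rewrite /g /=; move: (c) (f y) (f x) => c' u v.
  by field.
have s_ab : in_itvs a b s.
  apply/allP => p ps; have [p12 psub] := sab _ ps.
  have p1 : `[p.1, p.2]%classic p.1 by rewrite /= in_itv/= lexx ltW.
  have p2 : `[p.1, p.2]%classic p.2 by rewrite /= in_itv/= lexx andbT ltW.
  move: (psub _ p1) (psub _ p2) => [_] /=; rewrite in_itv/= => /andP[/ltW h1 _] [_].
  by rewrite /= in_itv/= => /andP[_ /ltW h2]; rewrite h1 h2 ltW.
have := H [:: (a, b)] s _ s_ab isT ns _; rewrite /in_itvs/= !lexx ab => /(_ isT).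
have cab : cover [:: (a, b)] = `[a, b]%classic by rewrite /cover big_seq1.
have inc1 : increment g [:: (a, b)] = g b - g a by rewrite /increment big_seq1.
rewrite cab inc1.
have -> : `[a, b]%classic `\` cover s `|` cover s `\` `[a, b]%classic = `[a, b]%classic `\` cover s.
  rewrite [X in _ `|` X](_ : _ = set0) ?setU0//; apply/seteqP; split => // x [] /coverP[p ps px] nab.
  apply: nab; rewrite /= in_itv/=; move: (allP s_ab _ ps) px => /and3P[h1 h2 h3] /andP[h4 h5].
  by rewrite (le_trans h1)//= (le_trans h5).
have -> : (mu (`[a, b]%classic `\` cover s) < d%:E)%E.
  pose oM := ((wlength idfun)^*)%mu : set R -> \bar R.
  rewrite -[mu _]/(oM _).
  have nul : oM ((`]a, b[%classic `\` E) `|` ([set a] `|` [set b])) = 0%E.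
    apply/negligible_outer_measure; apply: negligibleU => //; apply: negligibleU.
      by exists [set a]; split => //; exact: lebesgue_measure_set1.
    by exists [set b]; split => //; exact: lebesgue_measure_set1.
  apply: (@le_lt_trans _ _ (oM (((E `&` `]a, b[%classic) `\` cover s) `|`
      ((`]a, b[%classic `\` E) `|` ([set a] `|` [set b]))))).
    apply: le_outer_measure => x [] /=; rewrite in_itv/= => /andP[ax xb] ncs.
    have [->|xa] := eqVneq x a; first by right; right; left.
    have [->|xb'] := eqVneq x b; first by right; right; right.
    have xab : `]a, b[%classic x by rewrite /= in_itv/= !lt_neqAle ax xb eq_sym xa xb'.
    have [Ex|nEx] := pselect (E x); first by left.
    by right; left.
  apply: le_lt_trans mus; apply: (le_trans (outer_measureU2 _ _ _)).
  by rewrite -[X in (_ + X <= _)%E]/(oM _) nul adde0.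
move=> /(_ isT) le_e2.
have incs0 : 0 <= increment g s.
  rewrite /increment big_seq; apply: sumr_ge0 => p /incs; rewrite mul0r; exact: ltW.
have : - (e / 2) < g b - g a.
  move: le_e2; rewrite ltr_norml => /andP[h _].
  by clear -h incs0; lra.
rewrite /g => h.
have cba : c * (b - a) <= e / 2.
  by rewrite /c mulrAC ler_pdivrMr// ler_pM2l// lerDl ler01.
rewrite mulrBr in cba.
by clear -h cba; lra.
Qed.

End Differentiation.

(** * Null sets of exceptional derivates *)

Section AEDerivability.
Context {R : realType}.
Local Notation mu := (@lebesgue_measure R).
Local Notation oM := ((wlength idfun)^*%mu : set R -> \bar R).
Implicit Types (g : R -> R) (a b : R) (s : seq (R * R)) (E : set R).

Lemma good_family_lt E O eta s p : good_family E O eta s -> p \in s ->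
  [/\ p.1 < p.2, O p.1 & O p.2].
Proof.
move=> [_ sO _] ps; have [p12 psub] := sO _ ps; split => //; apply: psub.
  by rewrite /= in_itv/= lexx ltW.
by rewrite /= in_itv/= lexx ltW.
Qed.

Lemma good_family_cover E O eta s : good_family E O eta s -> cover s `<=` O.
Proof.
move=> [_ sO _] x /coverP[p ps px]; have [_] := sO _ ps; apply.
by rewrite /= in_itv.
Qed.

Lemma good_family_itvs a b E O eta s :
  good_family E (O `&` `]a, b[%classic) eta s -> in_itvs a b s.
Proof.
move=> gs; apply/allP => p ps; have [p12 [_ h1] [_ h2]] := good_family_lt gs ps.
move: h1 h2; rewrite /= !in_itv/= => /andP[/ltW-> _] /andP[_ /ltW->].
by rewrite ltW.
Qed.

Lemma measure_le_good_family E O eta s : good_family E O eta s ->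
  (mu E <= mu (cover s) + eta%:E)%E.
Proof.
move=> [_ _ mus].
apply: (@le_trans _ _ (oM (cover s `|` (E `\` cover s)))).
  apply: le_outer_measure => x Ex.
  by have [?|?] := pselect (cover s x); [left|right].
apply: (le_trans (outer_measureU2 _ _ _)).
by apply: leeD => //; exact: ltW.
Qed.

Lemma good_family_increment_ge E O eta s g c M : good_family E O eta s ->
  (forall p, p \in s -> c * (p.2 - p.1) < g p.2 - g p.1) -> 0 <= c ->
  (M%:E <= mu E)%E -> c * (M - eta) <= increment g s.
Proof.
move=> gs incs c0 ME.
apply: (@le_trans _ _ (c * \sum_(p <- s) (p.2 - p.1))).
  apply: ler_wpM2l => //; rewrite lerBlDr -lee_fin.
  apply: (le_trans ME); apply: (le_trans (measure_le_good_family gs)).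
  rewrite EFinD; apply: leeD => //; apply: measure_cover_le.
  by apply/allP => p ps; have [/ltW] := good_family_lt gs ps.
rewrite /increment mulr_sumr big_seq [leRHS]big_seq; apply: ler_sum => p ps.
exact/ltW/incs.
Qed.

(** Two good families inside an open set barely larger than [E] cover almost the same points, so
    their increments almost agree. This is what excludes, on a set of positive outer measure, two
    systems of intervals with very different slopes. *)
Lemma ac_increment_covers a b g E e eta0 : ac a b g -> E `<=` `]a, b[%classic ->
  0 < e -> 0 < eta0 -> exists eta O, [/\ 0 < eta <= eta0, open O, E `<=` O &
    forall I J, good_family E (O `&` `]a, b[%classic) eta I ->
      good_family E (O `&` `]a, b[%classic) eta J ->
      `|increment g I - increment g J| < e].
Proof.
move=> acg Eab e0 eta00; have [d d0 H] := ac_increment_symm_diff acg e0.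
(* Each of the two differences of covers has measure at most [2 * eta], one [eta] from [O] and one
   from the family; four times [d / 5] is less than [d]. *)
pose eta := Num.min eta0 (d / 5).
have eta_gt0 : 0 < eta by rewrite lt_min eta00 divr_gt0.
have [ O [oO EO muO]] := outer_measure_open_le E eta_gt0.
exists eta, O; split => //; first by rewrite eta_gt0 ge_min lexx.
have mO' : measurable (O `&` `]a, b[%classic).
  by apply: measurableI => //; exact: measurable_realfun.open_measurable.
have half I J : good_family E (O `&` `]a, b[%classic) eta I ->
    good_family E (O `&` `]a, b[%classic) eta J ->
    (mu (cover I `\` cover J) <= (2 * eta)%:E)%E.
  move=> gI gJ; have cJ := good_family_cover gJ.
  have mJ : measurable (cover J) by exact: measurable_cover.
  apply: (@le_trans _ _ (mu ((O `&` `]a, b[%classic) `\` cover J))).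
    apply: le_measure; rewrite ?inE; try exact: measurableD.
      by apply: measurableD => //; exact: measurable_cover.
    by apply: setSD; exact: good_family_cover gI.
  have fJ : mu (cover J) \is a fin_num.
    rewrite ge0_fin_numE//; apply: (@le_lt_trans _ _ (mu `]a, b[%classic)).
      by apply: le_measure; rewrite ?inE// => x /cJ[].
    by rewrite lebesgue_measure_itv/=; case: ifP => _; rewrite ?ltry// -EFinB ltry.
  rewrite -(@leeD2rE _ (mu (cover J)))// [leLHS](_ : _ = mu (O `&` `]a, b[%classic)); last first.
    rewrite -measureU//; [|exact: measurableD|by rewrite setIC setDE setIA setIAC setICr set0I].
    by rewrite setUC setDUK.
  apply: (@le_trans _ _ (mu O)).
    by apply: le_measure; rewrite ?inE//; exact: measurable_realfun.open_measurable.
  apply: (le_trans muO); rewrite mulr_natl mulr2n EFinD [leRHS]addeC addeA.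
  by apply: leeD => //; exact: measure_le_good_family gJ.
move=> I J gI gJ; apply: H; try exact: good_family_itvs gI; try exact: good_family_itvs gJ.
- by case: gI.
- by case: gJ.
- apply: (le_lt_trans (measureU2 _ _ _)); try by apply: measurableD; exact: measurable_cover.
  apply: (@le_lt_trans _ _ ((2 * eta)%:E + (2 * eta)%:E)%E).
    by apply: leeD; exact: half.
  rewrite -EFinD lte_fin.
  have : eta <= d / 5 by rewrite ge_min lexx orbT.
  by clear -d0; move: eta => r; lra.
Qed.

Lemma outer_measure_itv_fin a b E : E `<=` `]a, b[%classic -> oM E \is a fin_num.
Proof.
move=> Eab; rewrite ge0_fin_numE ?outer_measure_ge0//.
apply: (@le_lt_trans _ _ (oM `]a, b[%classic)); first exact: le_outer_measure.
rewrite -[oM _]/(lebesgue_measure _) lebesgue_measure_itv/=.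
by case: ifP => _; rewrite ?ltry// -EFinB ltry.
Qed.

(** If the set had outer measure M > 0, families of slope n would have increments at least n M / 2,
    yet all of them stay within 1 of the increment of one fixed family. *)
Lemma infinite_slope_negligible a b g : ac a b g ->
  mu.-negligible [set x | a < x < b /\ forall n : nat, frequent_slope g x n%:R].
Proof.
move=> acg; set E := (X in mu.-negligible X).
have Eab : E `<=` `]a, b[%classic by move=> x [xab _]; rewrite /= in_itv.
have Efin := outer_measure_itv_fin Eab.
apply/negligible_outer_measure; pose M := fine (oM E).
have ME : oM E = M%:E by rewrite fineK.
rewrite ME; congr EFin; apply/eqP; rewrite eq_le [X in _ && X](_ : _ = true); last first.
  by rewrite -lee_fin -ME outer_measure_ge0.
rewrite andbT leNgt; apply/negP => M0.
have M2 : 0 < M / 2 by rewrite divr_gt0.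
have [eta [ O [/andP[eta0 etaM] oO EO H]]] := ac_increment_covers acg Eab ltr01 M2.
have EOab : E `<=` O `&` `]a, b[%classic by move=> x Ex; split; [exact: EO|exact: Eab].
have fam (n : nat) : exists s, good_family E (O `&` `]a, b[%classic) eta s /\
    forall p, p \in s -> n%:R * (p.2 - p.1) < g p.2 - g p.1.
  by apply: frequent_slope_family => // x [].
have [I [gI _]] := fam 0%N.
have bnd (n : nat) : n%:R * (M / 2) <= increment g I + 1.
  have [J [gJ incJ]] := fam n.
  have := good_family_increment_ge gJ incJ (ler0n _ _) (_ : (M%:E <= mu E)%E).
  rewrite -ME => /(_ (lexx _)) h.
  have := H I J gI gJ; rewrite ltr_norml => /andP[h1 _].
  have : n%:R * (M / 2) <= n%:R * (M - eta) by apply: ler_wpM2l => //; clear -etaM; lra.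
  by move=> h2; clear -h h1 h2; move: h1 h h2; move: (increment g I) (increment g J) (n%:R * _) (n%:R * _) => *; lra.
have := bnd (Num.truncn ((`|increment g I| + 1) / (M / 2))).+1.
apply/negP; rewrite -ltNge -ltr_pdivrMr//.
apply: le_lt_trans (truncnS_gt _).
by rewrite ler_pM2r ?invr_gt0// lerD2r ler_norm.
Qed.

(** After the midpoint slope [m] is subtracted, one family has slopes above [c] and another slopes
    below [- c], with [c] half the gap. Their increments differ by at least 2 c (M - eta) and by
    less than c e, so the outer measure M lies below every [e]. *)
Lemma separated_slopes_negligible a b g (r t : R) : ac a b g -> r < t ->
  mu.-negligible [set x | a < x < b /\
    (frequent_slope (fun y => - g y) x (- r) /\ frequent_slope g x t)].
Proof.
move=> acg rt; set E := (X in mu.-negligible X).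
have Eab : E `<=` `]a, b[%classic by move=> x [xab _]; rewrite /= in_itv.
have Efin := outer_measure_itv_fin Eab.
apply/negligible_outer_measure; pose M := fine (oM E).
have ME : oM E = M%:E by rewrite fineK.
rewrite ME; congr EFin; apply/eqP; rewrite eq_le [X in _ && X](_ : _ = true); last first.
  by rewrite -lee_fin -ME outer_measure_ge0.
rewrite andbT; apply/ler_addgt0Pr => e e0; rewrite add0r.
pose c := (t - r) / 2; have c0 : 0 < c by rewrite divr_gt0// subr_gt0.
pose m := (r + t) / 2.
pose h x := g x + (- m) * x.
have ach : ac a b h by apply: acD => //; exact: ac_affine.
have ce : 0 < c * e by rewrite mulr_gt0.
have e2 : 0 < e / 2 by rewrite divr_gt0.
have [eta [ O [/andP[eta0 etae] oO EO H]]] := ac_increment_covers ach Eab ce e2.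
have EOab : E `<=` O `&` `]a, b[%classic by move=> x Ex; split; [exact: EO|exact: Eab].
have [I [gI incI]] : exists s, good_family E (O `&` `]a, b[%classic) eta s /\
    forall p, p \in s -> c * (p.2 - p.1) < h p.2 - h p.1.
  apply: frequent_slope_family => // x [_ [_ sl]] d d0.
  have [y [yx yxd cs]] := sl _ d0; exists y; split => //.
  have yx0 : y - x != 0 by rewrite subr_eq0.
  rewrite (_ : _ / _ = (g y - g x) / (y - x) - m); last first.
    by rewrite /h; move: (m) (g y) (g x) => m' u v; field.
  by clear -cs; move: cs; rewrite /c /m; move: (_ / (y - x)) => ?; lra.
have [J [gJ incJ]] : exists s, good_family E (O `&` `]a, b[%classic) eta s /\
    forall p, p \in s -> c * (p.2 - p.1) < (fun x => - h x) p.2 - (fun x => - h x) p.1.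
  apply: (frequent_slope_family (g := fun x => - h x)) => //; first exact: acN.
  move=> x [_ [sl _]] d d0.
  have [y [yx yxd cs]] := sl _ d0; exists y; split => //.
  have yx0 : y - x != 0 by rewrite subr_eq0.
  rewrite (_ : _ / _ = (- g y - - g x) / (y - x) + m); last first.
    by rewrite /h; move: (m) (g y) (g x) => m' u v; field.
  by clear -cs; move: cs; rewrite /c /m; move: (_ / (y - x)) => ?; lra.
have MI := good_family_increment_ge gI incI (ltW c0) (_ : (M%:E <= mu E)%E).
have MJ := good_family_increment_ge (g := fun x => - h x) gJ incJ (ltW c0) (_ : (M%:E <= mu E)%E).
have {}MI : c * (M - eta) <= increment h I by apply: MI; rewrite -ME.
have {}MJ : c * (M - eta) <= increment (fun x => - h x) J by apply: MJ; rewrite -ME.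
have JN : increment (fun x => - h x) J = - increment h J.
  by rewrite /increment -sumrN; apply: eq_bigr => p _; rewrite opprB opprK addrC.
have := H I J gI gJ; rewrite ltr_norml => /andP[_ h1].
rewrite JN in MJ.
have : c * (2 * (M - eta)) < c * e.
  rewrite mulr_natl mulrnAr mulr2n.
  by clear -MI MJ h1; move: MI MJ h1; move: (c * _) (c * _) (increment h I) (increment h J) => *; lra.
rewrite ltr_pM2l// => h2.
by clear -h2 etae; lra.
Qed.

End AEDerivability.

(** * Derivatives on the half-line *)

Section HalfLineDerivative.
Context {R : realType}.
Local Notation mu := (@lebesgue_measure R).
Local Notation half_line := (`[0%R, +oo[%classic : set R).
Implicit Types (f g : R -> R) (a b x d : R).

(** Relational version of the derivative behind [hl_deriv]: it asserts that the limit exists, which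
    [lim] alone does not. *)
Definition rder f x d : Prop := diff_quot f x --> d.

Lemma rderP f x d : rder f x d <-> forall e, 0 < e -> exists2 r, 0 < r &
  forall y, 0 <= y -> y != x -> `|y - x| < r -> `|(f y - f x) / (y - x) - d| < e.
Proof.
rewrite /rder /diff_quot; split=> [/cvgrPdist_lt H e e0|H].
  have := H e e0; rewrite /within/= => -[r /= r0 Hr].
  exists r => // y y0 yx yr; rewrite distrC; apply: Hr => //=.
    by rewrite distrC.
  by rewrite in_itv/= y0.
apply/cvgrPdist_lt => e e0; have [r r0 Hr] := H e e0.
exists r => //= y /=; rewrite distrC => yr yx; rewrite in_itv/= andbT => y0.
by rewrite distrC; exact: Hr.
Qed.

Lemma rder_interior f x d : 0 < x ->
  (f y - f x) / (y - x) @[y --> x^'] --> d <-> rder f x d.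
Proof.
move=> x0; rewrite rderP; split=> [/cvgrPdist_lt H e e0|H].
  have [r /= r0 Hr] := H e e0.
  by exists r => // y y0 yx yr; rewrite distrC; apply: Hr => //=; rewrite distrC.
apply/cvgrPdist_lt => e e0; have [r r0 Hr] := H e e0.
exists (Num.min r x) => /=; first by rewrite lt_min r0.
move=> y /=; rewrite distrC lt_min => /andP[yr yx'] yx; rewrite distrC; apply: Hr => //.
by move: yx'; rewrite ltr_norml; clear -x0; lra.
Qed.

Lemma half_line_point (x r : R) : 0 <= x -> 0 < r ->
  exists y, [/\ 0 <= y, y != x & `|y - x| < r].
Proof.
move=> x0 r0; exists (x + r / 2); split; first by rewrite addr_ge0// divr_ge0// ltW.
  by rewrite -subr_eq0 addrC addKr gt_eqF// divr_gt0.
by rewrite addrC addKr gtr0_norm ?divr_gt0// ltr_pdivrMr// ltr_pMr// ltr1n.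
Qed.

Lemma rder_unique f x d d' : 0 <= x -> rder f x d -> rder f x d' -> d = d'.
Proof.
move=> x0 /rderP H /rderP H'; apply/eqP; rewrite -subr_eq0 -normr_le0.
apply/ler_addgt0Pr => e e0; rewrite add0r.
have e2 : 0 < e / 2 by rewrite divr_gt0.
have [r r0 Hr] := H _ e2; have [r' r'0 Hr'] := H' _ e2.
have [|y [y0 yx]] := half_line_point (r := Num.min r r') x0.
  by rewrite lt_min r0.
rewrite lt_min => /andP[yr yr'].
have h := Hr _ y0 yx yr; have h' := Hr' _ y0 yx yr'.
rewrite distrC in h.
rewrite [e]splitr; apply: ltW; apply: le_lt_trans (ltrD h h').
apply: le_trans (ler_normD _ _); rewrite addrA subrK//.
Qed.

Lemma rder_lim f x d : 0 <= x -> rder f x d -> lim (diff_quot f x) = d.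
Proof.
move=> x0 fd; have fl : rder f x (lim (diff_quot f x)).
  by apply: cvgP fd.
exact: rder_unique fl fd.
Qed.

Lemma rder_local f g x d r : 0 < r ->
  (forall y, 0 <= y -> `|y - x| < r -> f y = g y) -> rder f x d -> 0 <= x -> rder g x d.
Proof.
move=> r0 fg /rderP H x0; apply/rderP => e e0; have [s s0 Hs] := H e e0.
exists (Num.min r s); first by rewrite lt_min r0.
move=> y y0 yx; rewrite lt_min => /andP[yr ys].
by rewrite -!fg ?subrr ?normr0//; exact: Hs.
Qed.

Lemma rder_cst (c : R) x : rder (fun=> c) x 0.
Proof.
apply/rderP => e e0; exists 1 => // y _ _ _.
by rewrite subrr mul0r subrr normr0.
Qed.

Lemma rder_id x : rder id x 1.
Proof.
apply/rderP => e e0; exists 1 => // y _ yx _.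
by rewrite divff ?subrr ?normr0// subr_eq0.
Qed.

Lemma rder_eq f x d (g : R -> R) :
  g y @[y --> within half_line x^'] --> d ->
  (forall y, y != x -> g y = (f y - f x) / (y - x)) -> rder f x d.
Proof.
move=> gd gf; rewrite /rder /diff_quot; apply: cvg_trans gd.
apply: near_eq_cvg; apply: (@filterS _ x^' _ _ _ _ (nbhs_dnbhs_neq x)) => y yx _.
exact: gf.
Qed.

Lemma rderD f g x d d' : rder f x d -> rder g x d' ->
  rder (fun y => f y + g y) x (d + d').
Proof.
move=> fd gd; apply: (rder_eq (g := fun y => (f y - f x) / (y - x) + (g y - g x) / (y - x))).
  exact: cvgD fd gd.
by move=> y _; rewrite -mulrDl opprD addrACA.
Qed.

Lemma rderN f x d : rder f x d -> rder (fun y => - f y) x (- d).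
Proof.
move=> fd; apply: (rder_eq (g := fun y => - ((f y - f x) / (y - x)))).
  exact: cvgN fd.
by move=> y _; rewrite -mulNr opprD.
Qed.

Lemma rderB f g x d d' : rder f x d -> rder g x d' ->
  rder (fun y => f y - g y) x (d - d').
Proof. by move=> fd gd; apply: rderD => //; exact: rderN. Qed.

Lemma rder_continuous f x d : rder f x d ->
  f y @[y --> within half_line x^'] --> f x.
Proof.
move=> fd; have h : (f y - f x) / (y - x) * (y - x) + f x @[y --> within half_line x^'] --> d * (x - x) + f x.
  apply: cvgD; last exact: cvg_cst.
  apply: cvgM; first exact: fd.
  apply: cvgB; last exact: cvg_cst.
  by apply: cvg_within_filter; apply: cvg_within_filter; exact: cvg_id.
move: h; rewrite subrr mulr0 add0r; apply: cvg_trans; apply: near_eq_cvg.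
apply: (@filterS _ x^' _ _ _ _ (nbhs_dnbhs_neq x)) => y yx _.
by rewrite divfK ?subrK// subr_eq0.
Qed.

Lemma rderM f g x d d' : rder f x d -> rder g x d' ->
  rder (fun y => f y * g y) x (d * g x + f x * d').
Proof.
move=> fd gd; apply: (rder_eq (g := fun y => (f y - f x) / (y - x) * g x + f y * ((g y - g x) / (y - x)))).
  apply: cvgD; first by apply: cvgM; [exact: fd|exact: cvg_cst].
  by apply: cvgM; [exact: rder_continuous fd|exact: gd].
by move=> y _; rewrite mulrAC mulrA -mulrDl; congr (_ / _); ring.
Qed.

Lemma derivable_rder f x d : 0 < x -> derivable f x 1 -> derive1 f x = d -> rder f x d.
Proof.
move=> x0 df fd; have <- : 'D_1 f x = d by rewrite -derive1E.
apply/(rder_interior f ('D_1 f x) x0).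
have h : h^-1 *: ((f \o shift x) (h *: 1) - f x) @[h --> 0^'] --> 'D_1 f x by [].
apply/cvgrPdist_lt => e e0; move/cvgrPdist_lt : h => /(_ e e0)[r /= r0 Hr].
exists r => //= y yr yx; have := Hr (y - x); rewrite /= sub0r normrN distrC => /(_ yr).
by rewrite subr_eq0 => /(_ yx); rewrite /GRing.scale/= mulr1 subrK [_^-1 * _]mulrC.
Qed.

Lemma rder_frequent_slope f x d (c : R) : 0 < x -> rder f x d -> c < d ->
  frequent_slope f x c.
Proof.
move=> x0 /rderP H cd e e0; have dc : 0 < d - c by rewrite subr_gt0.
have [r r0 Hr] := H _ dc.
have [|y [y0 yx]] := half_line_point (r := Num.min e r) (ltW x0).
  by rewrite lt_min e0.
rewrite lt_min => /andP[ye yr]; exists y; split => //.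
have := Hr _ y0 yx yr; rewrite ltr_norml => /andP[h _].
by clear -h; move: h; move: (_ / _) => ?; lra.
Qed.

(** An a.e. sign of the derivative gives monotonicity, which fails for merely continuous functions.
    The integral comparisons and the energy inequalities below all derive from this. *)
Lemma ac_nonincreasing a b f : 0 <= a -> a <= b -> ac a b f ->
  {ae mu, forall x, a < x < b -> exists2 d, d <= 0 & rder f x d} -> f b <= f a.
Proof.
move=> a0 ab acf [N [mN muN subN]].
apply: (ac_le_of_slopes (E := ~` N) ab acf).
  by exists N; split => // x [_ /= /contrapT].
move=> x c nNx /andP[ax xb] c0.
have [d d0 fd] : exists2 d, d <= 0 & rder f x d.
  have : ~ ~ (a < x < b -> exists2 d, d <= 0 & rder f x d) by move=> h; exact/nNx/subN.
  by move=> /contrapT; apply; rewrite ax.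
apply: (rder_frequent_slope (d := - d)); first exact: le_lt_trans ax.
  exact: rderN.
by clear -c0 d0; lra.
Qed.

(** The derivative is the infimum of the numbers that bound the difference quotients near [x], that
    is, the upper derivate. If the lower derivate were smaller, two rationals would separate
    them. *)
Lemma rder_of_bounded_slopes f x (n m : nat) : 0 < x ->
  ~ frequent_slope f x n%:R -> ~ frequent_slope (fun y => - f y) x m%:R ->
  (forall p q : rat, p < q -> ~ (frequent_slope (fun y => - f y) x (- ratr p) /\
    frequent_slope f x (ratr q))) ->
  exists d, rder f x d.
Proof.
move=> x0 fn fm fpq.
pose slope y := (f y - f x) / (y - x).
have slopeN y : (- f y - - f x) / (y - x) = - slope y by rewrite -opprD mulNr.
have notfreq g c : ~ frequent_slope g x c -> exists2 e, 0 < e &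
    forall y, y != x -> `|y - x| < e -> (g y - g x) / (y - x) <= c.
  move=> /existsNP[e /not_implyP[e0 /forallNP H]]; exists e => // y yx ye.
  rewrite leNgt; apply/negP => h; exact: (H y).
pose S := [set s | exists2 e, 0 < e & forall y, y != x -> `|y - x| < e -> slope y <= s].
have Sn : S n%:R by exact: notfreq fn.
have [em em0 Hm] := notfreq _ _ fm.
have pt (e : R) : 0 < e -> exists2 y, y != x & `|y - x| < e.
  by move=> e0; have [y [_ ? ?]] := half_line_point (ltW x0) e0; exists y.
have Sinf : has_inf S.
  split; first by exists n%:R.
  exists (- m%:R) => s [e e0 Hs].
  have [|y yx] := pt (Num.min e em); first by rewrite lt_min e0.
  rewrite lt_min => /andP[ye yem].
  have := Hm _ yx yem; rewrite slopeN; have := Hs _ yx ye.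
  by move: (slope y) => ?; clear; lra.
exists (inf S); apply/rderP => e e0.
have [s [e1 e10 Hs] slt] := inf_adherent e0 Sinf.
have i1 : inf S - e / 2 < inf S by rewrite ltrBlDr ltrDl divr_gt0.
have i2 : inf S - e < inf S - e / 2.
  by rewrite ltrD2l ltrN2 ltr_pdivrMr// ltr_pMr// ltr1n.
have [q] := rat_in_itvoo i1.
rewrite in_itv/= => /andP[q1 q2].
have [p] := rat_in_itvoo i2.
rewrite in_itv/= => /andP[p1 p2].
have pq : p < q by rewrite -(ltr_rat R) (lt_trans p2).
have fq : frequent_slope f x (ratr q).
  apply: contrapT => /notfreq h; have : inf S <= ratr q by apply: ge_inf => //; exact: Sinf.2.
  by rewrite leNgt q2.
have [|e2 e20 Hp] := notfreq (fun y => - f y) (- ratr p).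
  by move=> h; exact: (fpq p q).
exists (Num.min e1 e2); first by rewrite lt_min e10.
move=> y _ yx; rewrite lt_min => /andP[ye1 ye2].
have := Hs _ yx ye1; have := Hp _ yx ye2; rewrite slopeN -/(slope y).
rewrite ltr_norml; move: (slope y) (ratr p : R) p1 slt => u p' p1 slt; clear -p1 slt.
by move: (inf S) p1 slt => *; lra.
Qed.

(** Where the derivative fails to exist, the quotients are unbounded above, or unbounded below, or
    oscillate across a pair of rationals; this makes countably many null sets. *)
Lemma ac_ae_rder a b f : 0 <= a -> ac a b f ->
  {ae mu, forall x, a < x < b -> exists d, rder f x d}.
Proof.
move=> a0 acf.
pose N1 := [set x | a < x < b /\ forall n : nat, frequent_slope f x n%:R].
pose N2 := [set x | a < x < b /\ forall n : nat, frequent_slope (fun y => - f y) x n%:R].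
pose N3 n := if (unpickle n : option (rat * rat)) is Some (p, q) then
  [set x | p < q /\ (a < x < b /\
    (frequent_slope (fun y => - f y) x (- ratr p) /\ frequent_slope f x (ratr q)))]
  else set0.
have : mu.-negligible (N1 `|` (N2 `|` \bigcup_n N3 n)).
  apply: negligibleU; first exact: infinite_slope_negligible.
  apply: negligibleU; first exact/infinite_slope_negligible/acN.
  apply: negligible_bigcup => n; rewrite /N3.
  case: unpickle => [[p q]|]; last exact: negligible_set0.
  have [pq|qp] := ltP p q.
    have pq' : ratr p < ratr q :> R by rewrite ltr_rat.
    apply: negligibleS (separated_slopes_negligible acf pq').
    by move=> x [].
  by apply: negligibleS (negligible_set0 _) => x [].
apply: negligibleS => x /= /not_implyP[xab nd]; apply: contrapT => nN; apply: nd.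
have /andP[ax xb] := xab.
have x0 : 0 < x by exact: le_lt_trans ax.
have [n fn] : exists n : nat, ~ frequent_slope f x n%:R.
  by apply/existsNP => h; apply: nN; left.
have [m fm] : exists n : nat, ~ frequent_slope (fun y => - f y) x n%:R.
  by apply/existsNP => h; apply: nN; right; left.
apply: (rder_of_bounded_slopes x0 fn fm) => p q pq h; apply: nN; right; right.
have : N3 (pickle (p, q)) x by rewrite /N3 pickleK.
by move: (pickle (p, q)) => k N3k; exists k.
Qed.

End HalfLineDerivative.

(** * Primitives and the fundamental theorem of calculus *)

Section Primitive.
Context {R : realType}.
Local Notation mu := (@lebesgue_measure R).
Implicit Types (f g h : R -> R) (a b x d : R).

Lemma ae_mono (P Q : R -> Prop) : (forall x, P x -> Q x) ->
  {ae mu, forall x, P x} -> {ae mu, forall x, Q x}.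
Proof. by move=> PQ; apply: filterS; first exact: (ae_filter_ringOfSetsType mu). Qed.

Lemma ae_mono2 (P Q S : R -> Prop) : (forall x, P x -> Q x -> S x) ->
  {ae mu, forall x, P x} -> {ae mu, forall x, Q x} -> {ae mu, forall x, S x}.
Proof. by move=> PQS; apply: filterS2; first exact: (ae_filter_ringOfSetsType mu). Qed.

Definition int0 h x : R := \int[mu]_(t in `[0, x]) h t.

Lemma ac_continuous a b f : ac a b f -> {within `[a, b], continuous f}.
Proof.
move=> acf; apply/subspace_continuousP => x; rewrite /= in_itv/= => xab.
apply/cvgrPdist_lt => e e0; have [d d0 H] := ac_uniform_continuous acf e0.
by exists d => //= y yd; rewrite in_itv/= => yab; apply: H.
Qed.

Lemma continuous_bounded a b f : {within `[a, b], continuous f} ->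
  exists2 K, 0 <= K & forall x, a <= x <= b -> `|f x| <= K.
Proof.
move=> fc; have cpt := continuous_compact fc (@segment_compact R a b).
have [M [_ HM]] := compact_bounded cpt.
exists (`|M| + 1); first by rewrite addr_ge0.
move=> x xab; apply: HM; first by rewrite (le_lt_trans (ler_norm _))// ltrDl.
by exists x => //; rewrite /= in_itv.
Qed.

Lemma ac_bounded a b f : ac a b f ->
  exists2 K, 0 <= K & forall x, a <= x <= b -> `|f x| <= K.
Proof. by move=> /ac_continuous/continuous_bounded. Qed.

Lemma acM a b f g : ac a b f -> ac a b g -> ac a b (fun x => f x * g x).
Proof.
move=> acf acg; have [F F0 HF] := ac_bounded acf; have [G G0 HG] := ac_bounded acg.
move=> e e0.
have F1 : 0 < F + 1 by rewrite ltr_wpDl.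
have G1 : 0 < G + 1 by rewrite ltr_wpDl.
have eF : 0 < e / 2 / (F + 1) by rewrite !divr_gt0.
have eG : 0 < e / 2 / (G + 1) by rewrite !divr_gt0.
have [d d0 Hf] := acf _ eG; have [d' d'0 Hg] := acg _ eF.
exists (Num.min d d'); first by rewrite lt_min d0.
move=> n u v uv tI; rewrite lt_min => /andP[h1 h2].
have := Hf n u v uv tI h1; rewrite ltr_pdivlMr// => hf.
have := Hg n u v uv tI h2; rewrite ltr_pdivlMr// => hg.
rewrite [e]splitr; apply: le_lt_trans (ltrD hf hg).
rewrite !mulr_suml -big_split/=; apply: ler_sum => i _.
have /and3P[ui1 ui2 ui3] := uv i.
have -> : f (v i) * g (v i) - f (u i) * g (u i) =
  (f (v i) - f (u i)) * g (u i) + (g (v i) - g (u i)) * f (v i) by ring.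
apply: (le_trans (ler_normD _ _)); rewrite !normrM; apply: lerD; apply: ler_wpM2l => //.
  by apply: (le_trans (HG _ _)); rewrite ?lerDl// ui1 (le_trans ui2).
by apply: (le_trans (HF _ _)); rewrite ?lerDl// ui3 (le_trans ui1).
Qed.

Lemma int0_0 h : int0 h 0 = 0.
Proof. by rewrite /int0 set_itv1 Rintegral_set1. Qed.

Lemma integrable_itvS a b a' b' h : a <= a' -> b' <= b ->
  mu.-integrable `[a, b] (EFin \o h) -> mu.-integrable `[a', b'] (EFin \o h).
Proof.
move=> aa bb; apply: integrableS => // x /=; rewrite !in_itv/= => /andP[h1 h2].
by rewrite (le_trans aa h1) (le_trans h2 bb).
Qed.

Lemma int0B b h x y : mu.-integrable `[0, b] (EFin \o h) -> 0 <= x -> x <= y -> y <= b ->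
  int0 h y - int0 h x = \int[mu]_(t in `]x, y[) h t.
Proof.
move=> ih x0 xy yb; rewrite /int0 Rintegral_itvB; last 3 first.
- exact: integrable_itvS ih.
- by rewrite bnd_simp.
- by rewrite bnd_simp.
rewrite Rintegral_itv_bndo_bndc//; apply: integrableS ih => // t /=.
by rewrite !in_itv/= => /andP[h1 h2]; rewrite (le_trans x0 (ltW h1)) (le_trans (ltW h2) yb).
Qed.

Lemma ac_int0 b h : mu.-integrable `[0, b] (EFin \o h) -> ac 0 b (int0 h).
Proof.
move=> ih e e0; pose k := h \_ `[0, b].
have ik : mu.-integrable setT (EFin \o k).
  by rewrite /k -restrict_EFin; apply: (integrable_mkcond _ _).1.
have [d [d0 H]] := integral_normr_continuous ik e0.
exists d => // n u v uv tI sd.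
pose A := \big[setU/set0]_(i < n) `]u i, v i[%classic.
have muA : mu A = (\sum_(i < n) (v i - u i))%:E.
  rewrite /A measure_semi_additive_ord//; last exact: bigsetU_measurable.
  rewrite -sumEFin; apply: eq_bigr => i _.
  rewrite -[LHS]/(lebesgue_measure _) lebesgue_measure_itv /= lte_fin.
  have /and3P[_ uvi _] := uv i.
  case: ltP => // hi; have -> : v i = u i by apply/eqP; rewrite eq_le hi uvi.
  by rewrite subrr.
have mA : measurable A by exact: bigsetU_measurable.
have muAd : (mu A < d%:E)%E by rewrite muA lte_fin.
have := H A mA muAd; apply: le_lt_trans.
have ikn : mu.-integrable setT (EFin \o (fun x => `|k x|)).
  exact: (integrable_norm ik).
have -> : \int[mu]_(x in A) `|k x| = \sum_(i < n) \int[mu]_(x in `]u i, v i[) `|k x|.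
  rewrite /Rintegral /A integral_bigsetU_EFin//=; last 3 first.
  - exact: index_enum_uniq.
  - by apply: sub_trivIset tI.
  - by apply: (measurable_funS measurableT) => //; case/integrableP: ikn.
  rewrite -sum_fine// => i _; apply: integrable_fin_num => //.
  exact: integrableS ikn.
apply: ler_sum => i _; have /and3P[u0 uvi vb] := uv i.
rewrite (int0B ih)//.
have -> : \int[mu]_(t in `]u i, v i[) h t = \int[mu]_(t in `]u i, v i[) k t.
  apply: eq_Rintegral => t; rewrite inE/= in_itv/= => /andP[h1 h2].
  rewrite /k patchE mem_set//= in_itv/= (le_trans u0 (ltW h1))/=.
  exact: le_trans (ltW h2) vb.
by apply: le_normr_Rintegral => //; exact: integrableS ik.
Qed.

Lemma int0_rder b h : mu.-integrable `[0, b] (EFin \o h) ->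
  {ae mu, forall x, 0 < x < b -> rder (int0 h) x (h x)}.
Proof.
(* Extension by 0 gives the local integrability on the whole line that Lebesgue differentiation asks
   for; the two primitives agree on [0, b], hence near [x]. *)
move=> ih; pose k := h \_ `[0, b].
have ik : mu.-integrable setT (EFin \o k).
  by rewrite /k -restrict_EFin; apply: (integrable_mkcond _ _).1.
have lk : locally_integrable setT k by apply: open_integrable_locally => //; exact: openT.
have ik' y : mu.-integrable `[0, y] (EFin \o k) by exact: integrableS ik.
have := @FTC1 R k (BLeft 0) ik' lk; apply: ae_mono => x Hx /andP[x0 xb].
case: Hx => [|dk kE]; first by rewrite lte_fin.
have kx : k x = h x by rewrite /k patchE mem_set//= in_itv/= !ltW.
rewrite -kx; have Fd := derivable_rder x0 dk kE.
apply: (rder_local (r := b - x) _ _ Fd (ltW x0)); first by rewrite subr_gt0.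
move=> y y0 yx.
apply: eq_Rintegral => t; rewrite inE/= in_itv/= => /andP[t0 ty].
rewrite /k patchE mem_set//= in_itv/= t0/= (le_trans ty)//.
by move: yx; rewrite ltr_norml; clear; lra.
Qed.

Lemma rder_int0_continuous b h x : mu.-integrable `[0, b] (EFin \o h) -> 0 < x < b ->
  {for x, continuous h} -> rder (int0 h) x (h x).
Proof.
move=> ih /andP[x0 xb] hx; have [] := continuous_FTC1_closed xb ih x0 hx.
exact: derivable_rder.
Qed.

(** Monotonicity applied to [f - int0 h], whose derivative is a.e. nonpositive. *)
Lemma ac_increment_le b f h x y : 0 <= x -> x <= y -> y <= b -> ac 0 b f ->
  mu.-integrable `[0, b] (EFin \o h) ->
  {ae mu, forall t, x < t < y -> exists2 d, d <= h t & rder f t d} ->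
  f y - f x <= int0 h y - int0 h x.
Proof.
move=> x0 xy yb acf ih fd.
suff : f y - int0 h y <= f x - int0 h x by lra.
apply: (ac_nonincreasing (f := fun t => f t - int0 h t) x0 xy).
  by apply: acD; [|apply: acN]; [exact: acS acf|apply: acS (ac_int0 ih)].
move: fd (int0_rder ih); apply: ae_mono2 => t fd hd txy.
have [d dh fd'] := fd txy.
exists (d - h t); first by rewrite subr_le0.
apply: rderB => //; apply: hd; case/andP: txy => h1 h2.
by rewrite (le_lt_trans x0 h1) (lt_le_trans h2 yb).
Qed.

Lemma ac_FTC b f h x y : 0 <= x -> x <= y -> y <= b -> ac 0 b f ->
  mu.-integrable `[0, b] (EFin \o h) ->
  {ae mu, forall t, x < t < y -> rder f t (h t)} ->
  f y - f x = int0 h y - int0 h x.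
Proof.
move=> x0 xy yb acf ih fd; apply/eqP; rewrite eq_le; apply/andP; split.
  apply: (ac_increment_le x0 xy yb acf ih).
  by move: fd; apply: ae_mono => t fd /fd; exists (h t).
have ihN : mu.-integrable `[0, b] (EFin \o (fun t => - h t)).
  by have := integrableN ih; apply: eq_integrable.
have intN t : 0 <= t -> t <= b -> int0 (fun t => - h t) t = - int0 h t.
  move=> t0 tb; rewrite /int0.
  have it : mu.-integrable `[0, t] (EFin \o h) by exact: integrable_itvS ih.
  have := @RintegralZl _ _ R mu `[0, t]%classic h (-1) (measurable_itv _) it.
  by under eq_Rintegral do rewrite mulN1r; rewrite mulN1r.
have := ac_increment_le x0 xy yb (acN acf) ihN.
rewrite !intN ?(le_trans x0 xy) ?(le_trans xy yb)// => H.
suff : - f y - - f x <= - int0 h y - - int0 h x by lra.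
by apply: H; move: fd; apply: ae_mono => t fd /fd; exists (- h t); rewrite ?lexx//; exact: rderN.
Qed.

End Primitive.

Local Open Scope complex_scope.
Local Notation Re := complex.Re.
Local Notation Im := complex.Im.

(** * Complex-valued functions on the half-line *)

Section ComplexNorm.
Context {R : realType}.
Implicit Types (x y z : R[i]) (a b : R).

Lemma ReD x y : Re (x + y) = Re x + Re y. Proof. by case: x y => [? ?] []. Qed.
Lemma ImD x y : Im (x + y) = Im x + Im y. Proof. by case: x y => [? ?] []. Qed.
Lemma ReN x : Re (- x) = - Re x. Proof. by case: x. Qed.
Lemma ImN x : Im (- x) = - Im x. Proof. by case: x. Qed.
Lemma ReM x y : Re (x * y) = Re x * Re y - Im x * Im y.
Proof. by case: x y => [? ?] []. Qed.
Lemma ImM x y : Im (x * y) = Re x * Im y + Im x * Re y.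
Proof. by case: x y => [? ?] [? ?] /=; rewrite addrC mulrC [X in _ + X]mulrC; congr (_ + _); rewrite mulrC. Qed.
Lemma ReB x y : Re (x - y) = Re x - Re y. Proof. by rewrite ReD ReN. Qed.
Lemma ImB x y : Im (x - y) = Im x - Im y. Proof. by rewrite ImD ImN. Qed.
Lemma ReJ x : Re x^* = Re x. Proof. by case: x. Qed.
Lemma ImJ x : Im x^* = - Im x. Proof. by case: x. Qed.

Definition ReIm := (ReD, ImD, ReB, ImB, ReN, ImN, ReM, ImM, ReJ, ImJ).

Lemma complex_eqP x y : Re x = Re y -> Im x = Im y -> x = y.
Proof. by case: x y => [? ?] [? ?] /= -> ->. Qed.

Lemma normc_sqr x : normc x ^+ 2 = Re x ^+ 2 + Im x ^+ 2.
Proof. by case: x => a b; rewrite sqr_sqrtr// addr_ge0 ?sqr_ge0. Qed.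

Lemma normc_ge0 x : 0 <= normc x.
Proof. by case: x => a b; exact: sqrtr_ge0. Qed.

Lemma normcD x y : normc (x + y) <= normc x + normc y.
Proof. exact: le_normcD. Qed.

Lemma normcM x y : normc (x * y) = normc x * normc y.
Proof. exact: ComplexField.Normc.normcM. Qed.

Lemma normcN x : normc (- x) = normc x.
Proof. by case: x => a b /=; rewrite !sqrrN. Qed.

Lemma normcB x y : normc (x - y) = normc (y - x).
Proof. by rewrite -normcN opprB. Qed.

Lemma normcJ x : normc x^* = normc x.
Proof. by case: x => a b /=; rewrite sqrrN. Qed.

Lemma normcX x n : normc (x ^+ n) = normc x ^+ n.
Proof.
elim: n => [|n IH]; first by rewrite !expr0 ComplexField.Normc.normc1.
by rewrite !exprS normcM IH.
Qed.

Lemma normc_real a : normc a%:C = `|a|.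
Proof. by rewrite /= expr0n addr0 sqrtr_sqr. Qed.

Lemma normc_eq0 x : (normc x == 0) = (x == 0).
Proof.
apply/eqP/eqP => [|->]; first exact: ComplexField.Normc.eq0_normc.
exact: ComplexField.Normc.normc0.
Qed.

Lemma normc_gt0 x : (0 < normc x) = (x != 0).
Proof. by rewrite lt_neqAle normc_ge0 andbT eq_sym normc_eq0. Qed.

Lemma Re_le_normc x : `|Re x| <= normc x.
Proof.
rewrite -(ler_pXn2r (n := 2)) ?nnegrE ?normc_ge0// normc_sqr real_normK ?num_real//.
by rewrite lerDl sqr_ge0.
Qed.

Lemma Im_le_normc x : `|Im x| <= normc x.
Proof.
rewrite -(ler_pXn2r (n := 2)) ?nnegrE ?normc_ge0// normc_sqr real_normK ?num_real//.
by rewrite lerDr sqr_ge0.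
Qed.

Lemma normc_le_ReIm x : normc x <= `|Re x| + `|Im x|.
Proof.
rewrite -(ler_pXn2r (n := 2)) ?nnegrE ?normc_ge0 ?addr_ge0// normc_sqr sqrrD.
by rewrite !real_normK ?num_real// lerD2r lerDl mulrn_wge0// mulr_ge0.
Qed.

Lemma mulcJ x : x * x^* = (normc x ^+ 2)%:C.
Proof.
by rewrite normc_sqr; apply: complex_eqP; rewrite !ReIm /=; ring.
Qed.

Lemma normc_sum (I : Type) (r : seq I) (P : pred I) (F : I -> R[i]) :
  normc (\sum_(i <- r | P i) F i) <= \sum_(i <- r | P i) normc (F i).
Proof.
elim/big_rec2 : _ => [|i y x _ H]; first by rewrite ComplexField.Normc.normc0.
by apply: (le_trans (normcD _ _)); rewrite lerD2l.
Qed.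

End ComplexNorm.

(** * Derivatives and absolute continuity of complex functions *)

Section ComplexDerivative.
Context {R : realType}.
Local Notation mu := (@lebesgue_measure R).
Implicit Types (f g : R -> R[i]) (a b x : R).

Definition cder f x (d : R[i]) : Prop :=
  rder (fun y => Re (f y)) x (Re d) /\ rder (fun y => Im (f y)) x (Im d).

Lemma rder_ext (u v : R -> R) x d e : u = v -> d = e -> rder u x d -> rder v x e.
Proof. by move=> -> ->. Qed.

Lemma cder_cst (c : R[i]) x : cder (fun=> c) x 0.
Proof. by split; exact: rder_cst. Qed.

Lemma cder_real (u : R -> R) x d : rder u x d -> cder (fun y => (u y)%:C) x d%:C.
Proof. by move=> ud; split; [exact: ud|exact: rder_cst]. Qed.

Lemma cderD f g x d e : cder f x d -> cder g x e -> cder (fun y => f y + g y) x (d + e).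
Proof.
move=> [fr fi] [gr gi]; split.
  by apply: rder_ext (rderD fr gr); rewrite ?ReIm//; apply/funext => y; rewrite ReIm.
by apply: rder_ext (rderD fi gi); rewrite ?ReIm//; apply/funext => y; rewrite ReIm.
Qed.

Lemma cderN f x d : cder f x d -> cder (fun y => - f y) x (- d).
Proof.
move=> [fr fi]; split.
  by apply: rder_ext (rderN fr); rewrite ?ReIm//; apply/funext => y; rewrite ReIm.
by apply: rder_ext (rderN fi); rewrite ?ReIm//; apply/funext => y; rewrite ReIm.
Qed.

Lemma cderB f g x d e : cder f x d -> cder g x e -> cder (fun y => f y - g y) x (d - e).
Proof. by move=> fd ge; apply: cderD => //; exact: cderN. Qed.

Lemma cderJ f x d : cder f x d -> cder (fun y => (f y)^*) x d^*.
Proof.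
move=> [fr fi]; split.
  by apply: rder_ext fr; rewrite ?ReIm//; apply/funext => y; rewrite ReIm.
by apply: rder_ext (rderN fi); rewrite ?ReIm//; apply/funext => y; rewrite ReIm.
Qed.

Lemma cderM f g x d e : cder f x d -> cder g x e ->
  cder (fun y => f y * g y) x (d * g x + f x * e).
Proof.
move=> [fr fi] [gr gi]; split.
  apply: rder_ext (rderB (rderM fr gr) (rderM fi gi)).
    by apply/funext => y; rewrite ReIm.
  by rewrite !ReIm; ring.
apply: rder_ext (rderD (rderM fr gi) (rderM fi gr)).
  by apply/funext => y; rewrite ReIm.
by rewrite !ReIm; ring.
Qed.

Lemma cderZ (c : R[i]) f x d : cder f x d -> cder (fun y => c * f y) x (c * d).
Proof.
move=> fd; have := cderM (cder_cst c x) fd.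
by rewrite mul0r add0r.
Qed.

Lemma cder_local f g x d r : 0 < r -> 0 <= x ->
  (forall y, 0 <= y -> `|y - x| < r -> f y = g y) -> cder f x d -> cder g x d.
Proof.
move=> r0 x0 fg [fr fi]; split.
  by apply: (rder_local r0 _ fr x0) => y y0 yx; rewrite fg.
by apply: (rder_local r0 _ fi x0) => y y0 yx; rewrite fg.
Qed.

Lemma cder_deriv f x d : 0 <= x -> cder f x d -> hl_deriv f x = d.
Proof.
move=> x0 [fr fi]; rewrite /hl_deriv (rder_lim x0 fr) (rder_lim x0 fi).
by case: d {fr fi}.
Qed.

Lemma hl_derivable_cder f x : hl_derivable f x -> cder f x (hl_deriv f x).
Proof. by move=> [fr fi]; split. Qed.

Lemma cder_hl_derivable f x d : cder f x d -> hl_derivable f x.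
Proof. by move=> [fr fi]; split; [apply: cvgP fr|apply: cvgP fi]. Qed.

Definition cac a b f := ac a b (fun x => Re (f x)) /\ ac a b (fun x => Im (f x)).

Lemma cacP a b f : absolutely_continuous a b f <-> cac a b f.
Proof.
split=> [H|[Hr Hi] e e0].
  split=> e e0; have [d d0 Hd] := H e e0; exists d => // n u v uv tI sd;
    apply: le_lt_trans (Hd n u v uv tI sd); apply: ler_sum => i _.
    by rewrite -ReB; exact: Re_le_normc.
  by rewrite -ImB; exact: Im_le_normc.
have e2 : 0 < e / 2 by rewrite divr_gt0.
have [d d0 Hf] := Hr _ e2; have [d' d'0 Hg] := Hi _ e2.
exists (Num.min d d'); first by rewrite lt_min d0.
move=> n u v uv tI; rewrite lt_min => /andP[h1 h2].
rewrite [e]splitr; apply: le_lt_trans (ltrD (Hf n u v uv tI h1) (Hg n u v uv tI h2)).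
rewrite -big_split/=; apply: ler_sum => i _.
by apply: (le_trans (normc_le_ReIm _)); rewrite ReB ImB.
Qed.

Lemma cac_real a b (u : R -> R) : ac a b u -> cac a b (fun x => (u x)%:C).
Proof. by move=> acu; split => //=; exact: ac_cst. Qed.

Lemma cac_cst a b (c : R[i]) : cac a b (fun=> c).
Proof. by split; exact: ac_cst. Qed.

Lemma cacD a b f g : cac a b f -> cac a b g -> cac a b (fun x => f x + g x).
Proof.
move=> [fr fi] [gr gi]; split.
  by apply: ac_ext (acD fr gr) => x _; rewrite ReIm.
by apply: ac_ext (acD fi gi) => x _; rewrite ReIm.
Qed.

Lemma cacN a b f : cac a b f -> cac a b (fun x => - f x).
Proof.
move=> [fr fi]; split.
  by apply: ac_ext (acN fr) => x _; rewrite ReIm.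
by apply: ac_ext (acN fi) => x _; rewrite ReIm.
Qed.

Lemma cacB a b f g : cac a b f -> cac a b g -> cac a b (fun x => f x - g x).
Proof. by move=> fc gc; apply: cacD => //; exact: cacN. Qed.

Lemma cacJ a b f : cac a b f -> cac a b (fun x => (f x)^*).
Proof.
move=> [fr fi]; split.
  by apply: ac_ext fr => x _; rewrite ReIm.
by apply: ac_ext (acN fi) => x _; rewrite ReIm.
Qed.

Lemma cacM a b f g : cac a b f -> cac a b g -> cac a b (fun x => f x * g x).
Proof.
move=> [fr fi] [gr gi]; split.
  by apply: ac_ext (acD (acM fr gr) (acN (acM fi gi))) => x _; rewrite ReIm.
by apply: ac_ext (acD (acM fr gi) (acM fi gr)) => x _; rewrite ReIm.
Qed.

Lemma cacZ a b (c : R[i]) f : cac a b f -> cac a b (fun x => c * f x).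
Proof. by apply: cacM; exact: cac_cst. Qed.

Lemma cacS a b a' b' f : a <= a' -> b' <= b -> cac a b f -> cac a' b' f.
Proof. by move=> aa bb [fr fi]; split; [exact: acS fr|exact: acS fi]. Qed.

Lemma cac_ext a b f g : (forall x, a <= x <= b -> f x = g x) -> cac a b f -> cac a b g.
Proof.
by move=> fg [fr fi]; split; [apply: ac_ext fr|apply: ac_ext fi] => x /fg ->.
Qed.

(* The increment is projected on its own direction. *)
Lemma cac_increment_le b f (h : R -> R) x y : 0 <= x -> x <= y -> y <= b -> cac 0 b f ->
  mu.-integrable `[0, b] (EFin \o h) ->
  {ae mu, forall t, x < t < y -> exists2 d, normc d <= h t & cder f t d} ->
  normc (f y - f x) <= int0 h y - int0 h x.
Proof.
move=> x0 xy yb fc ih fd.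
pose D := f y - f x; have [D0|D0] := eqVneq D 0.
  rewrite -/D D0 ComplexField.Normc.normc0.
  have -> : 0 = (fun=> 0 : R) y - (fun=> 0 : R) x by rewrite subrr.
  apply: (ac_increment_le x0 xy yb _ ih); first by case: (cac_cst 0 b (0 : R[i])).
  move: fd; apply: ae_mono => t fd /fd[d dh _]; exists 0; last exact: rder_cst.
  exact: le_trans (normc_ge0 _) dh.
have n0 : 0 < normc D by rewrite normc_gt0.
pose c := ((normc D)^-1)%:C * D^*.
have nc : normc c = 1.
  by rewrite normcM normc_real normcJ ger0_norm ?invr_ge0 ?normc_ge0// mulVf// gt_eqF.
have -> : normc (f y - f x) = Re (c * f y) - Re (c * f x).
  rewrite -ReB -mulrBr /c -/D -mulrA [D^* * D]mulrC mulcJ.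
  rewrite [in RHS]ReM /= mul0r subr0 expr2 mulrA mulVf ?mul1r//.
  by rewrite gt_eqF.
apply: (ac_increment_le (f := fun t => Re (c * f t)) x0 xy yb _ ih).
  by case: (cacZ c fc).
move: fd; apply: ae_mono => t fd /fd[d dh fd']; exists (Re (c * d)).
  apply: le_trans dh; apply: (le_trans (ler_norm _)); apply: (le_trans (Re_le_normc _)).
  by rewrite normcM nc mul1r.
by have [] := cderZ c fd'.
Qed.

Lemma cac_constant b f x y : 0 <= x -> x <= y -> y <= b -> cac 0 b f ->
  {ae mu, forall t, x < t < y -> cder f t 0} -> f y = f x.
Proof.
move=> x0 xy yb fc fd; apply/eqP; rewrite -subr_eq0 -normc_eq0 eq_le normc_ge0 andbT.
have := cac_increment_le (h := fun=> 0) x0 xy yb fc.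
rewrite /int0 /Rintegral !integral0 subrr => -> //.
  exact: integrable0.
move: fd; apply: ae_mono => t fd /fd ?; exists 0 => //.
by rewrite ComplexField.Normc.normc0.
Qed.

Lemma cac_ae_cder a b f : 0 <= a -> cac a b f ->
  {ae mu, forall x, a < x < b -> exists d, cder f x d}.
Proof.
move=> a0 [fr fi]; apply: ae_mono2 (ac_ae_rder a0 fr) (ac_ae_rder a0 fi) => x hr hi xab.
by have [d hd] := hr xab; have [e he] := hi xab; exists (d +i* e).
Qed.

End ComplexDerivative.

(** * Holomorphic functions and the Phragmen-Lindelof principle *)

Section Holomorphic.
Context {R : realType}.
Implicit Types (f g : R -> R -> R[i]) (s t x : R).

(** Two-sided derivative on the whole line, meant for functions of the coordinates s and t of the
    complex plane; [rder] is the variant for the half-line. *)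
Definition der (f : R -> R) (x d : R) : Prop := is_derive x (1 : R) f d.

Lemma derD (f g : R -> R) x d e : der f x d -> der g x e -> der (fun y => f y + g y) x (d + e).
Proof. by move=> fd ge; exact: (is_deriveD fd ge). Qed.

Lemma derN (f : R -> R) x d : der f x d -> der (fun y => - f y) x (- d).
Proof. by move=> fd; exact: (is_deriveN fd). Qed.

Lemma derB (f g : R -> R) x d e : der f x d -> der g x e -> der (fun y => f y - g y) x (d - e).
Proof. by move=> fd ge; apply: derD => //; exact: derN. Qed.

Lemma derM (f g : R -> R) x d e : der f x d -> der g x e ->
  der (fun y => f y * g y) x (d * g x + f x * e).
Proof.
move=> fd ge; apply: (is_derive_eq (is_deriveM fd ge)).
by rewrite /GRing.scale/= addrC [g x * d]mulrC.
Qed.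

Lemma der_comp (f g : R -> R) x d e : der f (g x) d -> der g x e ->
  der (fun y => f (g y)) x (d * e).
Proof. by move=> fd ge; exact: (is_derive1_comp fd ge). Qed.

Lemma der_eq (f : R -> R) x d e : der f x d -> d = e -> der f x e.
Proof. by move=> fd <-. Qed.

(** The Cauchy-Riemann equations with [f1] as complex derivative: the partial derivative of [f] in s
    is [f1], and that in t is i times [f1]. *)
Definition CR f f1 : Prop := forall s t,
  [/\ der (fun s => Re (f s t)) s (Re (f1 s t)), der (fun s => Im (f s t)) s (Im (f1 s t)),
      der (fun t => Re (f s t)) t (- Im (f1 s t)) & der (fun t => Im (f s t)) t (Re (f1 s t))].

Definition jointly_continuous f : Prop :=
  continuous (fun p : R * R => Re (f p.1 p.2)) /\ continuous (fun p : R * R => Im (f p.1 p.2)).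

(* n times complex differentiable as a function of s + i t. *)
Fixpoint holo n f : Prop :=
  if n is n'.+1 then jointly_continuous f /\ exists2 f1, CR f f1 & holo n' f1 else True.

Lemma holoW n f : holo n.+1 f -> holo n f.
Proof.
elim: n f => // n IH f [jf [f1 ff1 /IH hf1]]; split => //.
by exists f1.
Qed.

Lemma holo_cst n (c : R[i]) : holo n (fun _ _ => c).
Proof.
elim: n c => // n IH c; split; first by split=> p; exact: cst_continuous.
exists (fun _ _ => 0) => // s t; rewrite oppr0; split; exact: is_derive_cst.
Qed.

Lemma holo_id n : holo n (fun s t => s +i* t).
Proof.
case: n => // n; split; first by split=> p; [exact: cvg_fst|exact: cvg_snd].
exists (fun _ _ => 1); last exact: holo_cst.
move=> s t; rewrite /= oppr0.
by split; [exact: is_derive_id|exact: is_derive_cst|exact: is_derive_cst|exact: is_derive_id].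
Qed.

Lemma der_ext (f g : R -> R) x d e : f = g -> d = e -> der f x d -> der g x e.
Proof. by move=> -> ->. Qed.

Lemma holoD n f g : holo n f -> holo n g -> holo n (fun s t => f s t + g s t).
Proof.
elim: n f g => // n IH f g [[fr fi] [f1 ff hf]] [[gr gi] [g1 gg hg]]; split.
  split=> p.
    under eq_fun do rewrite ReD.
    by apply: continuousD; [exact: fr|exact: gr].
  under eq_fun do rewrite ImD.
  by apply: continuousD; [exact: fi|exact: gi].
exists (fun s t => f1 s t + g1 s t); last exact: IH.
move=> s t; have [a1 a2 a3 a4] := ff s t; have [b1 b2 b3 b4] := gg s t; split.
- by apply: der_ext (derD a1 b1); rewrite ?ReIm//; apply/funext => y; rewrite ReIm.
- by apply: der_ext (derD a2 b2); rewrite ?ReIm//; apply/funext => y; rewrite ReIm.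
- by apply: der_ext (derD a3 b3); rewrite ?ReIm ?opprD//; apply/funext => y; rewrite ReIm.
- by apply: der_ext (derD a4 b4); rewrite ?ReIm//; apply/funext => y; rewrite ReIm.
Qed.

Lemma holoM n f g : holo n f -> holo n g -> holo n (fun s t => f s t * g s t).
Proof.
elim: n f g => // n IH f g hf hg.
have hf' := holoW hf; have hg' := holoW hg.
move: hf hg => [[fr fi] [f1 ff hf]] [[gr gi] [g1 gg hg]]; split.
  split=> p.
    under eq_fun do rewrite ReM.
    apply: cvgB; apply: cvgM;
      [exact: fr|exact: gr|exact: fi|exact: gi].
  under eq_fun do rewrite ImM.
  apply: cvgD; apply: cvgM;
    [exact: fr|exact: gi|exact: fi|exact: gr].
exists (fun s t => f1 s t * g s t + f s t * g1 s t); last first.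
  by apply: holoD; exact: IH.
move=> s t; have [a1 a2 a3 a4] := ff s t; have [b1 b2 b3 b4] := gg s t; split.
- apply: der_ext (derB (derM a1 b1) (derM a2 b2)).
    by apply/funext => y; rewrite ReIm.
  by rewrite !ReIm; ring.
- apply: der_ext (derD (derM a1 b2) (derM a2 b1)).
    by apply/funext => y; rewrite ReIm.
  by rewrite !ReIm; ring.
- apply: der_ext (derB (derM a3 b3) (derM a4 b4)).
    by apply/funext => y; rewrite ReIm.
  by rewrite !ReIm; ring.
- apply: der_ext (derD (derM a3 b4) (derM a4 b3)).
    by apply/funext => y; rewrite ReIm.
  by rewrite !ReIm; ring.
Qed.

Definition expc (w : R[i]) : R[i] :=
  (expR (Re w) * cos (Im w)) +i* (expR (Re w) * sin (Im w)).

Lemma expcD (w z : R[i]) : expc (w + z) = expc w * expc z.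
Proof.
case: w z => [a b] [c d]; apply: complex_eqP; rewrite /expc /= expRD.
  by rewrite cosD; ring.
by rewrite sinD; ring.
Qed.

Lemma normc_expc (w : R[i]) : normc (expc w) = expR (Re w).
Proof.
by rewrite /normc /expc !exprMn -mulrDr cos2Dsin2 mulr1 sqrtr_sqr ger0_norm ?expR_ge0.
Qed.

Lemma holo_expc n f : holo n f -> holo n (fun s t => expc (f s t)).
Proof.
elim: n f => // n IH f hf; have hf' := holoW hf.
move: hf => [[fr fi] [f1 ff hf]]; split.
  split=> p; apply: cvgM; apply: continuous_comp.
  - exact: fr.
  - exact: continuous_expR.
  - exact: fi.
  - exact: continuous_cos.
  - exact: fr.
  - exact: continuous_expR.
  - exact: fi.
  - exact: continuous_sin.
exists (fun s t => expc (f s t) * f1 s t); last by apply: holoM => //; exact: IH.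
move=> s t; have [a1 a2 a3 a4] := ff s t.
have E x d (u : R -> R) : der u x d -> der (fun y => expR (u y)) x (expR (u x) * d).
  by move=> ud; apply: der_comp ud; exact: is_derive_expR.
have C x d (u : R -> R) : der u x d -> der (fun y => cos (u y)) x (- sin (u x) * d).
  by move=> ud; apply: der_comp ud; exact: is_derive_cos.
have S x d (u : R -> R) : der u x d -> der (fun y => sin (u y)) x (cos (u x) * d).
  by move=> ud; apply: der_comp ud; exact: is_derive_sin.
split.
- by apply: der_eq (derM (E _ _ _ a1) (C _ _ _ a2)) _; rewrite !ReIm /=; ring.
- by apply: der_eq (derM (E _ _ _ a1) (S _ _ _ a2)) _; rewrite !ReIm /=; ring.
- by apply: der_eq (derM (E _ _ _ a3) (C _ _ _ a4)) _; rewrite !ReIm /=; ring.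
- by apply: der_eq (derM (E _ _ _ a3) (S _ _ _ a4)) _; rewrite !ReIm /=; ring.
Qed.

Lemma holo_horner n f (p : {poly R[i]}) : holo n f -> holo n (fun s t => p.[f s t]).
Proof.
move=> hf; elim/poly_ind : p => [|p c IH].
  by under eq_fun do under eq_fun do rewrite horner0; exact: holo_cst.
under eq_fun do under eq_fun do rewrite hornerMXaddC.
by apply: holoD; [exact: holoM|exact: holo_cst].
Qed.

(** A positive second derivative at the critical point [c] makes [F1] positive just to the right of
    it, and by the mean value theorem [F] would exceed [F c] there. *)
Lemma second_derivative_test (F F1 : R -> R) c d r : 0 < r ->
  (forall x, der F x (F1 x)) -> der F1 c d ->
  (forall x, `|x - c| < r -> F x <= F c) -> d <= 0.
Proof.
move=> r0 FF1 F1d Fmax; rewrite leNgt; apply/negP => d0.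
have near_c t : t \in `](c - r), (c + r)[ -> F t <= F c.
  by rewrite in_itv/= => h; apply: Fmax; rewrite ltr_distl.
have crc : c \in `](c - r), (c + r)[ by rewrite in_itv/= ltrBlDr !ltrDl r0.
have F1c : F1 c = 0.
  have : is_derive c 1 F 0.
    apply: (derive1_at_max _ _ crc near_c); first by lra.
    by move=> t _; apply: ex_derive; exact: FF1.
  by move=> [_ <-]; have [_ ->] := FF1 c.
have [e e0 He] : exists2 e, 0 < e & forall x, c < x -> x < c + e -> 0 < F1 x.
  have := F1d => -[dF dE].
  have h : h^-1 *: ((F1 \o shift c) (h *: 1) - F1 c) @[h --> 0^'] --> d by rewrite -dE.
  move/cvgrPdist_lt : h => /(_ d d0)[e /= e0 He]; exists e => // x cx xce.
  have := He (x - c); rewrite /= sub0r normrN gtr0_norm ?subr_gt0// ltrBlDl.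
  move=> /(_ xce); rewrite subr_eq0 gt_eqF// => /(_ isT).
  rewrite /GRing.scale/= mulr1 subrK F1c subr0.
  rewrite ltr_norml => /andP[_]; rewrite ltrBlDl ltrDr; rewrite pmulr_rgt0//.
  by rewrite invr_gt0 subr_gt0.
pose y := c + Num.min e r / 2.
have m0 : 0 < Num.min e r by rewrite lt_min e0.
have cy : c < y by rewrite ltrDl divr_gt0.
have m2 : Num.min e r / 2 < Num.min e r by rewrite ltr_pdivrMr// ltr_pMr// ltr1n.
have [ye yr] : y < c + e /\ y < c + r.
  rewrite /y !ltrD2l; split; apply: (lt_le_trans m2); by rewrite ge_min lexx ?orbT.
have [] := @MVT R F F1 c y cy.
- by move=> x _; exact: FF1.
- by apply: derivable_within_continuous => x _; apply: ex_derive; exact: FF1.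
- move=> x; rewrite in_itv/= => /andP[cx xy] Fy.
  have : 0 < F y - F c by rewrite Fy mulr_gt0 ?subr_gt0// He// (lt_trans xy).
  by rewrite subr_gt0 ltNge Fmax// gtr0_norm ?subr_gt0// ltrBlDl.
Qed.

End Holomorphic.

(** * Maximum principle on rectangles *)

Section MaximumPrinciple.
Context {R : realType}.
Implicit Types (f g G : R -> R -> R[i]) (s t : R).

Definition in_rect (s0 s1 t0 t1 s t : R) : bool := [&& s0 <= s, s <= s1, t0 <= t & t <= t1].

Definition on_boundary (s0 s1 t0 t1 s t : R) : bool :=
  [|| s == s0, s == s1, t == t0 | t == t1].

(* |f|^2 is subharmonic: its Laplacian is 4 |f'|^2. *)
Lemma maximum_principle f (s0 s1 t0 t1 K s t : R) : holo 2 f ->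
  (forall s t, in_rect s0 s1 t0 t1 s t -> on_boundary s0 s1 t0 t1 s t -> normc (f s t) <= K) ->
  0 <= K -> in_rect s0 s1 t0 t1 s t -> normc (f s t) <= K.
Proof.
move=> [[fr fi] [f1 ff1 [_ [f2 f12 _]]]] bd K0 sin.
pose u s t := Re (f s t) ^+ 2 + Im (f s t) ^+ 2.
have uE s' t' : u s' t' = normc (f s' t') ^+ 2 by rewrite normc_sqr.
rewrite -(ler_pXn2r (n := 2)) ?nnegrE ?normc_ge0// -uE leNgt; apply/negP => Ku.
have /and4P[h1 h2 h3 h4] := sin.
have s01 : 0 <= s1 - s0 by rewrite subr_ge0 (le_trans h1).
(* Adding [eta * (s - s0) ^+ 2] makes the Laplacian strictly positive, while [eta] is so small that
   a violation at (s, t) still beats every boundary value. *)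
pose eta := (u s t - K ^+ 2) / (2 * ((s1 - s0) ^+ 2 + 1)).
have den : 0 < (s1 - s0) ^+ 2 + 1 by rewrite ltr_wpDl ?sqr_ge0.
have eta0 : 0 < eta by rewrite divr_gt0 ?subr_gt0// mulr_gt0.
have etaK : eta * (s1 - s0) ^+ 2 < u s t - K ^+ 2.
  rewrite /eta mulrAC ltr_pdivrMr ?mulr_gt0// ltr_pM2l ?subr_gt0//.
  by have := sqr_ge0 (s1 - s0); clear; lra.
pose v s t := u s t + eta * (s - s0) ^+ 2.
pose rect : set (R * R) := `[s0, s1]%classic `*` `[t0, t1]%classic.
have rect0 : rect !=set0 by exists (s, t); split; rewrite /= in_itv/= ?h1 ?h3.
have rectc : compact rect by apply: compact_setX; exact: segment_compact.
have vc : {within rect, continuous (fun p : R * R => v p.1 p.2)}.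
  apply: continuous_subspaceT => p.
  apply: cvgD; first apply: cvgD.
  - under eq_fun do rewrite expr2.
    by apply: cvgM; exact: fr.
  - under eq_fun do rewrite expr2.
    by apply: cvgM; exact: fi.
  - apply: cvgM; first exact: cvg_cst.
    under eq_fun do rewrite expr2.
    by apply: cvgM; (apply: cvgB; [exact: cvg_fst|exact: cvg_cst]).
have [[a b]] := compact_EVT_max rect0 rectc vc.
rewrite inE => -[/=]; rewrite !in_itv/= => /andP[as0 as1] /andP[bt0 bt1] vmax.
have {}vmax s' t' : in_rect s0 s1 t0 t1 s' t' -> v s' t' <= v a b.
  move=> /and4P[g1 g2 g3 g4]; apply: (vmax (s', t')).
  by rewrite inE; split; rewrite /= in_itv/= ?g1 ?g3.
have abin : in_rect s0 s1 t0 t1 a b by rewrite /in_rect as0 as1 bt0.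
have nbd : ~~ on_boundary s0 s1 t0 t1 a b.
  apply/negP => abd; have := vmax _ _ sin; apply/negP; rewrite -ltNge.
  apply: (@le_lt_trans _ _ (K ^+ 2 + eta * (s1 - s0) ^+ 2)).
    apply: lerD; first by rewrite uE ler_pXn2r ?nnegrE ?normc_ge0// bd.
    apply: ler_wpM2l; first exact: ltW.
    by rewrite ler_pXn2r ?nnegrE ?subr_ge0 ?(le_trans h1 h2)// lerD2r.
  rewrite addrC -ltrBrDr; apply: lt_le_trans etaK _.
  by rewrite lerD2r lerDl mulr_ge0 ?sqr_ge0// ltW.
move: nbd; rewrite !negb_or => /and4P[na0 na1 nb0 nb1].
have {}as0 : s0 < a by rewrite lt_neqAle eq_sym na0.
have {}as1 : a < s1 by rewrite lt_neqAle na1.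
have {}bt0 : t0 < b by rewrite lt_neqAle eq_sym nb0.
have {}bt1 : b < t1 by rewrite lt_neqAle nb1.
have sq (w w1 : R -> R) x : der w x (w1 x) -> der (fun y => w y ^+ 2) x (2 * w x * w1 x).
  move=> wd; apply: der_ext (derM wd wd); last by ring.
  by apply/funext => y; rewrite expr2.
pose A := Re (f a b); pose B := Im (f a b); pose A1 := Re (f1 a b); pose B1 := Im (f1 a b).
pose A2 := Re (f2 a b); pose B2 := Im (f2 a b).
have derZ (c : R) (w : R -> R) x d : der w x d -> der (fun y => c * w y) x (c * d).
  by move=> wd; apply: der_eq (derM (is_derive_cst c x 1) wd) _; rewrite mul0r add0r.
have shift (x : R) : der (fun y => y - s0) x 1.
  by apply: der_eq (derB (is_derive_id x 1) (is_derive_cst s0 x 1)) _; rewrite subr0.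
have ds : 2 * (A1 ^+ 2 + A * A2) + 2 * (B1 ^+ 2 + B * B2) + eta * 2 <= 0.
  pose F1 x := 2 * Re (f x b) * Re (f1 x b) + 2 * Im (f x b) * Im (f1 x b) + eta * (2 * (x - s0) * 1).
  apply: (@second_derivative_test _ (fun x => v x b) F1 a _ (Num.min (a - s0) (s1 - a))).
  - by rewrite lt_min !subr_gt0 as0.
  - move=> x; have [a1 a2 _ _] := ff1 x b.
    apply: derD; first apply: derD.
    + exact: (sq (fun y => Re (f y b)) (fun y => Re (f1 y b))).
    + exact: (sq (fun y => Im (f y b)) (fun y => Im (f1 y b))).
    + by apply: derZ; exact: (sq (fun y => y - s0) (fun=> 1)).
  - have [a1 a2 _ _] := ff1 a b; have [b1 b2 _ _] := f12 a b.
    have d3 : der (fun x => eta * (2 * (x - s0) * 1)) a (eta * 2).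
      apply: der_ext (derZ (eta * 2) _ _ _ (shift a)); last by rewrite mulr1.
      by apply/funext => y; ring.
    apply: der_eq (derD (derD (derM (derZ 2 _ _ _ a1) b1) (derM (derZ 2 _ _ _ a2) b2)) d3) _.
    by rewrite -/A -/B -/A1 -/B1 -/A2 -/B2; ring.
  - move=> x; rewrite lt_min !ltr_norml => /andP[/andP[x1 _] /andP[_ x2]].
    apply: vmax; rewrite /in_rect (ltW bt0) (ltW bt1) !andbT.
    by move: x1 x2; clear; lra.
have dt : 2 * (B1 ^+ 2 - A * A2) + 2 * (A1 ^+ 2 - B * B2) <= 0.
  pose F1 y := 2 * Re (f a y) * (- Im (f1 a y)) + 2 * Im (f a y) * Re (f1 a y) + 0.
  apply: (@second_derivative_test _ (fun y => v a y) F1 b _ (Num.min (b - t0) (t1 - b))).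
  - by rewrite lt_min !subr_gt0 bt0.
  - move=> y; have [_ _ a3 a4] := ff1 a y.
    apply: derD; first apply: derD.
    + exact: (sq (fun y => Re (f a y)) (fun y => - Im (f1 a y))).
    + exact: (sq (fun y => Im (f a y)) (fun y => Re (f1 a y))).
    + exact: is_derive_cst.
  - have [_ _ a3 a4] := ff1 a b; have [_ _ b3 b4] := f12 a b.
    apply: der_eq (derD (derD (derM (derZ 2 _ _ _ a3) (derN b4)) (derM (derZ 2 _ _ _ a4) b3))
      (is_derive_cst 0 b 1)) _.
    by rewrite -/A -/B -/A1 -/B1 -/A2 -/B2; ring.
  - move=> y; rewrite lt_min !ltr_norml => /andP[/andP[y1 _] /andP[_ y2]].
    apply: vmax; rewrite /in_rect (ltW as0) (ltW as1)/=.
    by move: y1 y2; clear; lra.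
(* In the sum of [ds] and [dt] the terms with [f2] cancel, leaving 4 |f1|^2 + 2 eta <= 0. *)
have := sqr_ge0 A1; have := sqr_ge0 B1; move: ds dt eta0.
by move: (A1 ^+ 2) (B1 ^+ 2) (A * A2) (B * B2) (eta) => *; lra.
Qed.

(** The bounds survive uniform approximation, so a limit of holomorphic functions can be treated
    without differentiating it. *)
Lemma maximum_principle_approx G (s0 s1 t0 t1 K s t : R) :
  (forall e : R, 0 < e -> exists2 f, holo 2 f &
    forall s t, in_rect s0 s1 t0 t1 s t -> normc (G s t - f s t) <= e) ->
  (forall s t, in_rect s0 s1 t0 t1 s t -> on_boundary s0 s1 t0 t1 s t -> normc (G s t) <= K) ->
  0 <= K -> in_rect s0 s1 t0 t1 s t -> normc (G s t) <= K.
Proof.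
move=> ap bd K0 sin; apply/ler_addgt0Pr => e e0.
have e2 : 0 < e / 2 by rewrite divr_gt0.
have [f hf Hf] := ap _ e2.
have : normc (f s t) <= K + e / 2.
  apply: (maximum_principle hf _ _ sin); last by rewrite addr_ge0// ltW.
  move=> s' t' sin' bd'; have := bd _ _ sin' bd'; have := Hf _ _ sin'.
  rewrite normcB; have := normcD (f s' t' - G s' t') (G s' t').
  rewrite subrK; clear.
  by move: (normc _) (normc _) (normc (G _ _)) => *; lra.
have := Hf _ _ sin; have := normcD (G s t - f s t) (f s t).
rewrite subrK; clear.
by move: (normc _) (normc _) (normc _) => *; lra.
Qed.

End MaximumPrinciple.

(** * Phragmen-Lindelof in a sector *)

Section PhragmenLindelof.
Context {R : realType}.
Implicit Types (F : R[i] -> R[i]) (s t : R).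

(** Working substitute for being entire. The Picard series provide it directly, and after
    composition with [expc] it feeds [maximum_principle_approx]. *)
Definition poly_approx F : Prop := forall rho e : R, 0 < e ->
  exists p : {poly R[i]}, forall z, normc z <= rho -> normc (F z - p.[z]) <= e.

Lemma holo_affine n (b t0 : R) : holo n (fun s t => b%:C * (s +i* t) + (0 +i* t0)).
Proof. by apply: holoD; [apply: holoM; [exact: holo_cst|exact: holo_id]|exact: holo_cst]. Qed.

Lemma expc_affine (b t0 s t : R) :
  expc (b%:C * (s +i* t) + (0 +i* t0)) = expc ((b * s) +i* (b * t + t0)).
Proof. by congr expc; apply: complex_eqP; rewrite !ReIm /=; ring. Qed.

(* With X = e^(s/2), this says that A e^(c X) X e^(- kappa X^(1 + g)) <= 1. *)
Lemma exp_domination (A c kappa g s : R) : 0 < A -> 0 <= c -> 0 < kappa -> 0 < g -> 0 <= s ->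
  2 * (c + 1 + A) / (kappa * g) <= s ->
  A * expR (c * expR (s / 2)) * expR (s / 2) * expR (- (kappa * expR ((1 + g) / 2 * s))) <= 1.
Proof.
move=> A0 c0 k0 g0 s0 hs.
have -> : A = expR (ln A) by rewrite lnK.
rewrite -!expRD -[leRHS]expR0 ler_expR.
pose X := expR (s / 2); pose Y := expR (g * s / 2).
have -> : expR ((1 + g) / 2 * s) = X * Y.
  by rewrite /X /Y -expRD; congr expR; field.
rewrite -/X.
have sX : 1 + s / 2 <= X by exact: expR_ge1Dx.
have sY : 1 + g * s / 2 <= Y by exact: expR_ge1Dx.
have lnA : ln A <= A.
  by rewrite -ler_expR lnK//; apply: le_trans (expR_ge1Dx _); rewrite lerDr ler01.
have X1 : 1 <= X by apply: le_trans sX; rewrite lerDl divr_ge0.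
have kY : c + 1 + A <= kappa * Y.
  have h : c + 1 + A <= kappa * (g * s / 2).
    move: hs; rewrite ler_pdivrMr ?mulr_gt0//.
    have -> : kappa * (g * s / 2) = s * (kappa * g) / 2 by field.
    by move: (s * _) => *; lra.
  apply: (le_trans h); apply: ler_wpM2l; first exact: ltW.
  by apply: le_trans sY; rewrite lerDr.
have : (c + 1 + A) * X <= kappa * (X * Y).
  by rewrite [X * Y]mulrC mulrA ler_wpM2r// (le_trans _ X1).
have : A * 1 <= A * X by rewrite ler_pM2l.
have : (c + 1 + A) * X = c * X + X + A * X by ring.
move: (kappa * _) (c * X) (A * X) ((c + 1 + A) * X) => u v w y -> h1 h2.
by clear -h1 h2 sX lnA s0; lra.
Qed.

(** In the variable w = s + i t a sector becomes a half-strip. The factor e^(w/2) offsets the decay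
    on the edges. The factor exp(- delta e^(b w)), with b > 1/2, overcomes the growth e^(c e^(s/2)),
    while b theta0 < pi / 2 keeps its modulus at most 1. Finally delta tends to 0. *)
Lemma phragmen_lindelof F (theta0 thetac A c D s0 : R) : poly_approx F ->
  0 < theta0 -> theta0 < pi -> 0 < A -> 0 <= c -> 0 <= s0 ->
  (forall s t, s0 <= s -> normc (F (expc (s +i* t))) <= A * expR (c * expR (s / 2))) ->
  (forall s, s0 <= s -> normc (F (expc (s +i* (thetac + theta0)))) <= D * expR (- (s / 2))) ->
  (forall s, s0 <= s -> normc (F (expc (s +i* (thetac - theta0)))) <= D * expR (- (s / 2))) ->
  exists2 K, 0 <= K & forall s t, s0 <= s -> `|t| <= theta0 ->
    normc (F (expc (s +i* (thetac + t)))) <= K * expR (- (s / 2)).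
Proof.
move=> ap th0 thpi A0 c0 s00 growth up lo.
(* Half of the critical value pi / theta0 - 1, at which [b * theta0] would reach pi / 2. *)
pose g := (pi / theta0 - 1) / 2.
have g0 : 0 < g by rewrite divr_gt0// subr_gt0 ltr_pdivlMr// mul1r.
pose b := (1 + g) / 2.
have bth : b * theta0 < pi / 2.
  have -> : b * theta0 = (theta0 + pi) / 4.
    by rewrite /b /g; field; rewrite gt_eqF.
  by clear -thpi; lra.
have b0 : 0 < b by rewrite divr_gt0// ltr_wpDl.
have bcos t : `|t| <= theta0 -> cos (b * theta0) <= cos (b * t).
  move=> tth; have -> : cos (b * t) = cos (b * `|t|).
    by have [|] := ger0P t => // _; rewrite mulrN cosN.
  have h : b * `|t| <= b * theta0 by rewrite ler_pM2l.
  have bp : b * theta0 <= pi.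
    by apply: (le_trans (ltW bth)); rewrite ler_pdivrMr// ler_peMr ?pi_ge0// ler1n.
  have i1 : b * theta0 \in `[0, pi] by rewrite in_itv/= bp mulr_ge0 ?ltW.
  have i2 : b * `|t| \in `[0, pi] by rewrite in_itv/= (le_trans h bp) mulr_ge0// ltW.
  by rewrite leNgt (ltr_cos i1 i2) -leNgt.
have kap0 : 0 < cos (b * theta0).
  apply: cos_gt0_pihalf; rewrite bth andbT.
  by apply: (@lt_trans _ _ 0); rewrite ?oppr_lt0 ?divr_gt0 ?pi_gt0// mulr_gt0.
pose K := Num.max (Num.max D (A * expR (c * expR (s0 / 2)) * expR (s0 / 2))) 1.
have K0 : 0 <= K by rewrite le_max ler01 orbT.
exists K => // s t ss tth.
rewrite expRN ler_pdivlMr ?expR_gt0//.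
apply/ler_addgt0Pr => e e0.
set X := _ * expR (s / 2).
have X0 : 0 <= X by rewrite mulr_ge0 ?normc_ge0 ?expR_ge0.
pose M := expR (b * s) * cos (b * t).
have M0 : 0 <= M by rewrite mulr_ge0 ?expR_ge0// (le_trans (ltW kap0)) ?bcos.
(* The limit delta -> 0 in explicit form: e^(- d M) >= 1 - d M, and [d] is chosen so that the loss X
   d M is at most [e]. *)
suff main delta : 0 < delta -> X * expR (- (delta * M)) <= K.
  have XM : 0 < X * M + 1 by rewrite ltr_wpDl// mulr_ge0.
  have d0 : 0 < e / (X * M + 1) by rewrite divr_gt0.
  have := main _ d0; set d := e / _ => h.
  have h2 : X * (1 - d * M) <= X * expR (- (d * M)).
    by rewrite ler_wpM2l//; have := expR_ge1Dx (- (d * M)).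
  have h3 : X * (d * M) <= e.
    have -> : X * (d * M) = d * (X * M) by ring.
    by rewrite /d mulrAC ler_pdivrMr// ler_pM2l// lerDl ler01.
  rewrite -lerBlDr; apply: le_trans h; apply: le_trans h2.
  by rewrite mulrBr mulr1; clear -h3; lra.
move=> d0.
(* The right edge lies beyond [s] and far enough for [exp_domination]. It depends on [delta],
   whereas the bound [K] does not. *)
pose S := Num.max (s + 1) (2 * (c + 1 + A) / (delta * cos (b * theta0) * g)).
have sS : s <= S by rewrite le_max lerDl ler01.
have s0S : s0 <= S by rewrite (le_trans ss).
pose G s t := F (expc (s +i* (thetac + t))) * (expc ((1/2)%:C * (s +i* t) + (0 +i* 0)) *
  expc ((- delta)%:C * expc (b%:C * (s +i* t) + (0 +i* 0)))).
have nG s' t' : normc (G s' t') = normc (F (expc (s' +i* (thetac + t')))) * expR (s' / 2) *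
    expR (- (delta * (expR (b * s') * cos (b * t')))).
  rewrite /G !normcM !expc_affine !normc_expc mulrA; congr (_ * expR _ * expR _).
    by rewrite /=; field.
  by rewrite !ReIm /= addr0 mul0r subr0 mulNr.
have -> : X * expR (- (delta * M)) = normc (G s t) by rewrite nG.
apply: (@maximum_principle_approx _ G s0 S (- theta0) theta0) => //; last first.
  by rewrite /in_rect ss sS -ler_norml.
- move=> s' t' /and4P[g1 g2 g3 g4].
  have t'th : `|t'| <= theta0 by rewrite ler_norml g3.
  have e1 : expR (- (delta * (expR (b * s') * cos (b * t')))) <= 1.
    rewrite -[leRHS]expR0 ler_expR oppr_le0 !mulr_ge0 ?expR_ge0 ?(ltW d0)//.
    by rewrite (le_trans (ltW kap0)) ?bcos.
  have Fle B : normc (F (expc (s' +i* (thetac + t')))) * expR (s' / 2) <= B -> 0 <= B -> normc (G s' t') <= B.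
    move=> h B0; rewrite nG; apply: (le_trans (ler_pM _ _ h e1)); rewrite ?mulr1//.
    by rewrite mulr_ge0 ?normc_ge0 ?expR_ge0.
  have Dle : normc (F (expc (s' +i* (thetac + t')))) <= D * expR (- (s' / 2)) -> normc (G s' t') <= K.
    rewrite expRN ler_pdivlMr ?expR_gt0// => h.
    by apply: Fle => //; apply: (le_trans h); rewrite !le_max lexx.
  case/or4P => /eqP E.
  + apply: Fle => //; apply: (@le_trans _ _ (A * expR (c * expR (s0 / 2)) * expR (s0 / 2))).
      by rewrite E ler_wpM2r ?expR_ge0// growth.
    by rewrite !le_max lexx orbT.
  + rewrite nG; apply: (@le_trans _ _ 1); last by rewrite le_max lexx orbT.
    apply: (le_trans _ (@exp_domination A c (delta * cos (b * theta0)) g S _ _ _ _ _ _)) => //; last 3 first.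
    * by rewrite mulr_gt0.
    * by rewrite (le_trans s00).
    * by rewrite le_max lexx orbT.
    rewrite E; apply: ler_pM; rewrite ?mulr_ge0 ?normc_ge0 ?expR_ge0//.
      by rewrite ler_wpM2r ?expR_ge0// growth.
    rewrite ler_expR lerN2 -/b -mulrA ler_pM2l// mulrC ler_pM2l ?expR_gt0//.
    exact: bcos.
  + by apply: Dle; rewrite E lo.
  + by apply: Dle; rewrite E up.
- move=> e' e'0.
  pose W := expR (S / 2).
  have W0 : 0 < W by exact: expR_gt0.
  (* On the rectangle |z| <= e^S and the multiplier has modulus at most [W], so the polynomial has
     to be within [e' / W]. *)
  have [p Hp] := ap (expR S) (e' / W) (divr_gt0 e'0 W0).
  exists (fun s t => p.[expc (1%:C * (s +i* t) + (0 +i* thetac))] *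
    (expc ((1/2)%:C * (s +i* t) + (0 +i* 0)) *
     expc ((- delta)%:C * expc (b%:C * (s +i* t) + (0 +i* 0))))).
    apply: holoM; first by apply/holo_horner/holo_expc/holo_affine.
    apply: holoM; first exact/holo_expc/holo_affine.
    by apply: holo_expc; apply: holoM; [exact: holo_cst|exact/holo_expc/holo_affine].
  move=> s' t' /and4P[g1 g2 g3 g4].
  have t'th : `|t'| <= theta0 by rewrite ler_norml g3.
  rewrite /G !expc_affine !mul1r [t' + _]addrC -mulrBl !normcM !normc_expc /=.
  have h1 : normc (F (expc (s' +i* (thetac + t'))) - p.[expc (s' +i* (thetac + t'))]) <= e' / W.
    by apply: Hp; rewrite normc_expc ler_expR.
  have e1 : expR (- (delta * (expR (b * s') * cos (b * t')))) <= 1.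
    rewrite -[leRHS]expR0 ler_expR oppr_le0 !mulr_ge0 ?expR_ge0 ?(ltW d0)//.
    by rewrite (le_trans (ltW kap0)) ?bcos.
  rewrite -[leRHS](divfK (lt0r_neq0 W0)) !addr0 mul0r subr0 mulNr.
  apply: ler_pM => //; rewrite ?normc_ge0 ?mulr_ge0 ?expR_ge0//.
  rewrite -[leRHS]mulr1; apply: ler_pM => //; rewrite ?expR_ge0//.
  by rewrite ler_expR mulrC ler_pM2r.
Qed.

Lemma expc_polar (z : R[i]) : 0 <= Im z -> z != 0 ->
  exists2 t, 0 <= t <= pi & z = expc (ln (normc z) +i* t).
Proof.
move=> im0 z0; have n0 : 0 < normc z by rewrite normc_gt0.
pose x := Re z / normc z.
have x1 : -1 <= x <= 1.
  by rewrite -ler_norml normrM normfV (gtr0_norm n0) ler_pdivrMr// mul1r Re_le_normc.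
have [tpi cost] := acos_def x1.
exists (acos x) => //; apply: complex_eqP; rewrite /expc /= lnK// ?cost.
  by rewrite /x mulrC divfK// gt_eqF.
rewrite sin_acos//.
have -> : 1 - x ^+ 2 = (Im z / normc z) ^+ 2.
  rewrite /x !expr_div_n; apply/eqP; rewrite subr_eq -mulrDl addrC -normc_sqr divff//.
  by rewrite sqrf_eq0 gt_eqF.
by rewrite sqrtr_sqr ger0_norm ?divr_ge0 ?(ltW n0)// mulrC divfK// gt_eqF.
Qed.

Lemma expcJ (z : R[i]) : (expc z)^* = expc z^*.
Proof. by case: z => a b; apply: complex_eqP; rewrite /expc /= ?cosN ?sinN ?mulrN. Qed.

(** Two sectors cover all directions: half-opening [pi - eps] around the positive axis and [eps]
    around the negative one, with the given ray and its conjugate as edges. Half-openings below pi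
    are admissible because the growth has order 1/2. The resulting decay, fed to the maximum
    principle on large squares, makes [F z] arbitrarily small. *)
Lemma entire_eq0 F (eps A c D s0 : R) : poly_approx F ->
  (forall z, normc (F z^*) = normc (F z)) ->
  0 < eps -> eps < pi / 2 -> 0 < A -> 0 <= c -> 0 <= s0 ->
  (forall s t, s0 <= s -> normc (F (expc (s +i* t))) <= A * expR (c * expR (s / 2))) ->
  (forall s, s0 <= s -> normc (F (expc (s +i* (pi - eps)))) <= D * expR (- (s / 2))) ->
  forall z, F z = 0.
Proof.
move=> ap FJ e0 epi A0 c0 s00 growth ray_le.
have pi0 := @pi_gt0 R.
have ray_le' s : s0 <= s -> normc (F (expc (s +i* (- (pi - eps))))) <= D * expR (- (s / 2)).
  have -> : expc (s +i* (- (pi - eps))) = (expc (s +i* (pi - eps)))^* by rewrite expcJ.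
  by move=> ss; rewrite FJ; exact: ray_le.
have [||||K1 K10 HK1] := @phragmen_lindelof F (pi - eps) 0 A c D s0 ap _ _ A0 c0 s00 growth.
- by clear -e0 epi pi0; lra.
- by clear -e0; lra.
- by move=> s ss; rewrite add0r; exact: ray_le.
- by move=> s ss; rewrite add0r; exact: ray_le'.
have [|||K2 K20 HK2] := @phragmen_lindelof F eps pi A c D s0 ap e0 _ A0 c0 s00 growth.
- by clear -epi pi0; lra.
- move=> s ss; suff -> : expc (s +i* (pi + eps)) = expc (s +i* (- (pi - eps))) by exact: ray_le'.
  have E : pi + eps = - (pi - eps) + pi *+ 2 by rewrite mulr2n; ring.
  by rewrite /expc /= E cosD2pi sinD2pi.
- by move=> s ss; exact: ray_le.
pose K := K1 + K2.
have decay z : expR s0 <= normc z -> normc (F z) <= K * expR (- (ln (normc z) / 2)).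
  move=> zs.
  have z0 : z != 0 by rewrite -normc_gt0 (lt_le_trans (expR_gt0 s0)).
  have n0 : 0 < normc z by rewrite normc_gt0.
  have ls : s0 <= ln (normc z) by rewrite -ler_expR lnK.
  wlog im0 : z zs z0 n0 ls / 0 <= Im z.
    move=> W; have [|/ltW im0] := leP 0 (Im z); first exact: W.
    have := W z^*; rewrite normcJ FJ ImJ oppr_ge0 -normc_gt0 normcJ normc_gt0.
    by apply.
  have [t /andP[t0 tpi] zE] := expc_polar im0 z0.
  rewrite [F z](_ : _ = F (expc (ln (normc z) +i* t))) -?zE//.
  rewrite {1}zE; have [tle|tgt] := leP t (pi - eps).
    apply: (@le_trans _ _ (K1 * expR (- (ln (normc z) / 2)))).
      by have := HK1 _ t ls; rewrite add0r ger0_norm//; apply.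
    by rewrite ler_wpM2r ?expR_ge0// lerDl.
  apply: (@le_trans _ _ (K2 * expR (- (ln (normc z) / 2)))).
    have := HK2 _ (t - pi) ls; rewrite addrCA subrr addr0; apply.
    by rewrite ler_norml; clear -tgt tpi e0; lra.
  by rewrite ler_wpM2r ?expR_ge0// lerDr.
have K0 : 0 <= K by rewrite addr_ge0.
move=> z; apply/eqP; rewrite -normc_eq0 eq_le normc_ge0 andbT.
apply/ler_addgt0Pr => e e_gt0; rewrite add0r.
(* The last term ensures K e^(- ln r / 2) <= e, since ln r / 2 >= K / e and e^u >= u. *)
pose r := Num.max (Num.max (normc z) (expR s0)) (expR (2 * (K / e))).
have rz : normc z <= r by rewrite !le_max lexx.
have rs : expR s0 <= r by rewrite !le_max lexx orbT.
have re : expR (2 * (K / e)) <= r by rewrite !le_max lexx !orbT.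
have r0 : 0 < r by exact: lt_le_trans (expR_gt0 s0) rs.
have small y : r <= normc y -> normc (F y) <= e.
  move=> ry; apply: (le_trans (decay _ (le_trans rs ry))).
  have y0 : 0 < normc y by exact: lt_le_trans ry.
  have lny : K / e <= ln (normc y) / 2.
    by rewrite ler_pdivlMr// mulrC -ler_expR lnK// (le_trans re).
  rewrite expRN ler_pdivrMr ?expR_gt0// mulrC -ler_pdivrMr//.
  apply: (le_trans lny); apply: le_trans (expR_ge1Dx _).
  by rewrite lerDr ler01.
have in_z : in_rect (- r) r (- r) r (Re z) (Im z).
  have := le_trans (Re_le_normc z) rz; have := le_trans (Im_le_normc z) rz.
  by rewrite !ler_norml /in_rect => /andP[-> ->] /andP[-> ->].
have -> : z = Re z +i* Im z by case: (z).
apply: (@maximum_principle_approx _ (fun s t => F (s +i* t)) (- r) r (- r) r) (ltW e_gt0) in_z.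
  move=> e' e'0; have [p Hp] := ap (r + r) e' e'0.
  exists (fun s t => p.[s +i* t]); first by apply: holo_horner; exact: holo_id.
  move=> s t /and4P[h1 h2 h3 h4]; apply: Hp; apply: (le_trans (normc_le_ReIm _)).
  by apply: lerD; rewrite /= ler_norml ?h1 ?h3.
move=> s t _ bd; apply: small.
have [ns nt] : `|s| <= normc (s +i* t) /\ `|t| <= normc (s +i* t).
  by split; [exact: (Re_le_normc (s +i* t))|exact: (Im_le_normc (s +i* t))].
by case/or4P: bd => /eqP E; [apply: le_trans ns|apply: le_trans ns|
  apply: le_trans nt|apply: le_trans nt]; rewrite E ?normrN ler_norm.
Qed.

End PhragmenLindelof.

(** * Solutions entire in the spectral parameter *)

Section ComplexSeries.
Context {R : realType}.
Implicit Types (u : nat -> R[i]) (C M : R).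

(** Remainder of the exponential series, the single error scale of the Picard iteration. *)
Definition exp_tail M N : R := expR M - series (exp_coeff M) N.

Lemma series_exp_le M N N' : 0 <= M -> (N <= N')%N ->
  series (exp_coeff M) N <= series (exp_coeff M) N'.
Proof.
move=> M0; apply: nondecreasing_series => n _ _; exact: exp_coeff_ge0.
Qed.

Lemma series_exp_le_expR M N : 0 <= M -> series (exp_coeff M) N <= expR M.
Proof.
move=> M0; apply: nondecreasing_cvgn_le; last exact: is_cvg_series_exp_coeff.
by move=> n m; exact: series_exp_le.
Qed.

Lemma exp_tail_ge0 M N : 0 <= M -> 0 <= exp_tail M N.
Proof. by move=> M0; rewrite subr_ge0 series_exp_le_expR. Qed.

Lemma exp_tail_small M e : 0 <= M -> 0 < e -> exists N, forall n, (N <= n)%N -> exp_tail M n <= e.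
Proof.
move=> M0 e0; have := @is_cvg_series_exp_coeff R M.
move/cvgrPdist_le => /(_ e e0)[N _ HN]; exists N => n Nn.
by have := HN n Nn; rewrite ger0_norm// ?exp_tail_ge0// subr_ge0 series_exp_le_expR.
Qed.

Lemma real_series_tail (v : nat -> R) C M N : 0 <= M -> 0 <= C ->
  (forall n, `|v n| <= C * exp_coeff M n) ->
  `|limn (series v) - series v N| <= C * exp_tail M N.
Proof.
move=> M0 C0 vle.
have cv : cvgn (series v).
  apply: normed_cvg; apply: (@series_le_cvg _ _ (fun n => C * exp_coeff M n)) => //=.
  - by move=> n; rewrite mulr_ge0 ?exp_coeff_ge0.
  - rewrite (_ : series _ = fun n => C * series (exp_coeff M) n).
      by apply: is_cvgZr; exact: is_cvg_series_exp_coeff.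
    by apply/funext => n; rewrite /series /= mulr_sumr.
have bd n : (N <= n)%N -> `|series v n - series v N| <= C * exp_tail M N.
  move=> Nn; rewrite sub_series Nn.
  apply: (le_trans (ler_norm_sum _ _ _)).
  apply: (@le_trans _ _ (\sum_(N <= k < n) C * exp_coeff M k)); first exact: ler_sum.
  rewrite -mulr_sumr ler_wpM2l// lerBrDl.
  have -> : series (exp_coeff M) N + \sum_(N <= k < n) exp_coeff M k = series (exp_coeff M) n.
    by rewrite /series /= -big_cat_nat.
  exact: series_exp_le_expR.
have : `|series v n - series v N| @[n --> \oo] --> `|limn (series v) - series v N|.
  by apply: cvg_norm; apply: cvgB => //; exact: cvg_cst.
move=> h; rewrite -(cvg_lim (@Rhausdorff R) h).
apply: limr_le; first exact: cvgP h.
by exists N => // n /=; exact: bd.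
Qed.

Definition csum u : R[i] :=
  limn (series (fun n => Re (u n))) +i* limn (series (fun n => Im (u n))).

Lemma Re_sum (I : Type) (r : seq I) (P : pred I) (F : I -> R[i]) :
  Re (\sum_(i <- r | P i) F i) = \sum_(i <- r | P i) Re (F i).
Proof. by elim/big_rec2 : _ => // i x y _ <-; rewrite ReD. Qed.

Lemma Im_sum (I : Type) (r : seq I) (P : pred I) (F : I -> R[i]) :
  Im (\sum_(i <- r | P i) F i) = \sum_(i <- r | P i) Im (F i).
Proof. by elim/big_rec2 : _ => // i x y _ <-; rewrite ImD. Qed.

(** The factor 2 comes from summing real and imaginary parts separately. *)
Lemma csum_tail u C M N : 0 <= M -> 0 <= C ->
  (forall n, normc (u n) <= C * exp_coeff M n) ->
  normc (csum u - \sum_(0 <= n < N) u n) <= 2 * C * exp_tail M N.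
Proof.
move=> M0 C0 ule; apply: (le_trans (normc_le_ReIm _)).
rewrite !ReB !ImB /= Re_sum Im_sum -mulrA mulr_natl mulr2n.
apply: lerD; apply: real_series_tail => // n; apply: le_trans (ule n).
  exact: Re_le_normc.
exact: Im_le_normc.
Qed.

Lemma normc_partial_sum u C M N : 0 <= M -> 0 <= C ->
  (forall n, normc (u n) <= C * exp_coeff M n) ->
  normc (\sum_(0 <= n < N) u n) <= C * expR M.
Proof.
move=> M0 C0 ule; apply: (le_trans (normc_sum _ _ _)).
apply: (@le_trans _ _ (\sum_(0 <= n < N) C * exp_coeff M n)); first exact: ler_sum.
by rewrite -mulr_sumr ler_wpM2l// series_exp_le_expR.
Qed.

End ComplexSeries.

(** * Picard iteration *)

Section Picard.
Context {R : realType}.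
Local Notation mu := (@lebesgue_measure R).
Implicit Types (x t : R) (z : R[i]).

(** The equation as a first-order system. Carrying [w] along, instead of [hl_deriv y], lets the
    Picard solutions and the Weyl solutions share all estimates. *)
Definition sol2 (q : R -> R) z b (y w : R -> R[i]) : Prop :=
  [/\ cac 0 b y, cac 0 b w, (forall x, 0 < x < b -> cder y x (w x)) &
      {ae mu, forall x, 0 < x < b -> cder w x (((q x)%:C - z) * y x)}].

Lemma integrable_mul_ac b (h u : R -> R) : mu.-integrable `[0, b] (EFin \o h) -> ac 0 b u ->
  mu.-integrable `[0, b] (EFin \o (fun x => h x * u x)).
Proof.
move=> ih acu; have uc := ac_continuous acu.
have [K K0 HK] := ac_bounded acu.
rewrite (_ : EFin \o _ = ((EFin \o h) \* (EFin \o u))%E); last first.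
  by apply/funext => x; rewrite /= EFinM.
apply: integrableMl => //; first exact: measurable_realfun.subspace_continuous_measurable_fun.
exists K; split; first exact: num_real.
move=> M KM x /=; rewrite in_itv/= => xb; apply: (le_trans (HK x xb)); exact: ltW.
Qed.

Lemma integrable_ac b (u : R -> R) : ac 0 b u -> mu.-integrable `[0, b] (EFin \o u).
Proof.
move=> acu; apply: continuous_compact_integrable; first exact: segment_compact.
exact: ac_continuous.
Qed.

Lemma integrableD_EFin b (h k : R -> R) : mu.-integrable `[0, b] (EFin \o h) ->
  mu.-integrable `[0, b] (EFin \o k) -> mu.-integrable `[0, b] (EFin \o (fun x => h x + k x)).
Proof. by move=> ih ik; have := integrableD _ ih ik; apply; exact: measurable_itv. Qed.

Variables (b : R) (q : R -> R).
Hypotheses (b0 : 0 < b) (iq : mu.-integrable `[0, b] (EFin \o q)).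
Variables (alpha beta : R).

(* Coefficient of z^j in the n-th Picard correction. *)
Fixpoint picard (n : nat) : (nat -> R -> R) * (nat -> R -> R) :=
  if n is n'.+1 then
    (fun j => int0 ((picard n').2 j),
     fun j => int0 (fun t => q t * (picard n').1 j t -
                             (if j is j'.+1 then (picard n').1 j' t else 0)))
  else (fun j _ => if j is 0%N then alpha else 0, fun j _ => if j is 0%N then beta else 0).

Lemma picard_ac n j : ac 0 b ((picard n).1 j) /\ ac 0 b ((picard n).2 j).
Proof.
elim: n j => [|n IH] j /=; first by split; exact: ac_cst.
have [h1 h2] := IH j; split; apply: ac_int0; first exact: integrable_ac.
apply: integrableD_EFin; first exact: integrable_mul_ac.
apply: integrable_ac; apply: acN; case: j {h1 h2} => [|j]; first exact: ac_cst.
by have [] := IH j.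
Qed.

Lemma int0_zero (h : R -> R) x : (forall t, h t = 0) -> int0 h x = 0.
Proof.
by move=> h0; rewrite /int0 (_ : h = fun=> 0) ?/Rintegral ?integral0//; exact/funext.
Qed.

(** Each iteration multiplies by z at most once, so the n-th correction has degree at most n in z;
    this explains the range of the sums in [picY] and [picW]. *)
Lemma picard_gt n j x : (n < j)%N -> (picard n).1 j x = 0 /\ (picard n).2 j x = 0.
Proof.
elim: n j x => [|n IH] [|j] x //= nj; split; apply: int0_zero => t.
  by have [] := IH j.+1 t (ltnW nj).
have [-> _] := IH j.+1 t (ltnW nj); have [-> _] := IH j t nj.
by rewrite mulr0 subrr.
Qed.

Definition picY n z x : R[i] := \sum_(j < n.+1) ((picard n).1 j x)%:C * z ^+ j.
Definition picW n z x : R[i] := \sum_(j < n.+1) ((picard n).2 j x)%:C * z ^+ j.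

Lemma cac_sum n (f : 'I_n -> R -> R[i]) : (forall i, cac 0 b (f i)) ->
  cac 0 b (fun x => \sum_(i < n) f i x).
Proof.
elim: n f => [|n IH] f fc.
  by apply: cac_ext (cac_cst 0 b 0) => x _; rewrite big_ord0.
apply: cac_ext (cacD (IH (fun i => f (widen_ord (leqnSn n) i)) _) (fc ord_max)) => [x _|//].
by rewrite big_ord_recr.
Qed.

Lemma cder_sum n (f : 'I_n -> R -> R[i]) x (d : 'I_n -> R[i]) : (forall i, cder (f i) x (d i)) ->
  cder (fun x => \sum_(i < n) f i x) x (\sum_(i < n) d i).
Proof.
elim: n f d => [|n IH] f d fd.
  rewrite big_ord0 (_ : (fun _ => _) = fun=> 0); first exact: cder_cst.
  by apply/funext => y; rewrite big_ord0.
rewrite big_ord_recr/= (_ : (fun _ => _) =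
  fun y => \sum_(i < n) f (widen_ord (leqnSn n) i) y + f ord_max y); last first.
  by apply/funext => y; rewrite big_ord_recr.
by apply: cderD (fd ord_max); exact: IH.
Qed.

Lemma picY_cac n z : cac 0 b (picY n z).
Proof.
apply: cac_sum => i; apply: cacM; last exact: cac_cst.
by apply: cac_real; have [] := picard_ac n i.
Qed.

Lemma picW_cac n z : cac 0 b (picW n z).
Proof.
apply: cac_sum => i; apply: cacM; last exact: cac_cst.
by apply: cac_real; have [] := picard_ac n i.
Qed.

Lemma ac_continuous_at (u : R -> R) x : ac 0 b u -> 0 < x < b -> {for x, continuous u}.
Proof.
move=> acu /andP[x0 xb]; apply/cvgrPdist_lt => e e0.
have [d d0 H] := ac_uniform_continuous acu e0.
exists (Num.min d (Num.min x (b - x))) => /=.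
  by rewrite !lt_min d0 x0 subr_gt0.
move=> y /=; rewrite !lt_min distrC => /and3P[yd yx yb].
rewrite distrC; apply: H => //; first by rewrite !ltW.
by move: yx yb; rewrite !ltr_norml => /andP[? ?] /andP[? ?]; apply/andP; split; lra.
Qed.

Lemma picY_cder n z x : 0 < x < b -> cder (picY n.+1 z) x (picW n z x).
Proof.
move=> xb.
have -> : picW n z x = \sum_(j < n.+2) (((picard n).2 j x)%:C * z ^+ j).
  by rewrite big_ord_recr /= (picard_gt x (ltnSn n)).2 mul0r addr0.
apply: cder_sum => j.
have acj := (picard_ac n j).2.
rewrite -[(_ * _ : R[i])]addr0 -[X in _ + X](mulr0 ((picard n.+1).1 j x)%:C).
apply: cderM; last exact: cder_cst.
apply: cder_real; apply: (rder_int0_continuous _ xb); first exact: integrable_ac.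
exact: ac_continuous_at.
Qed.

Lemma ae_forall_lt (P : nat -> R -> Prop) n :
  (forall j, {ae mu, forall x, P j x}) -> {ae mu, forall x, forall j, (j < n)%N -> P j x}.
Proof.
move=> H; elim: n => [|n IH]; first by apply: (aeW mu) => x j.
apply: ae_mono2 IH (H n) => x h1 h2 j; rewrite ltnS leq_eqVlt => /orP[/eqP ->//|].
exact: h1.
Qed.

Lemma picW_cder n z :
  {ae mu, forall x, 0 < x < b -> cder (picW n.+1 z) x (((q x)%:C - z) * picY n z x)}.
Proof.
pose h j t := q t * (picard n).1 j t - (if j is j'.+1 then (picard n).1 j' t else 0).
have ih j : mu.-integrable `[0, b] (EFin \o h j).
  apply: integrableD_EFin; first by apply: integrable_mul_ac => //; have [] := picard_ac n j.
  apply: integrable_ac; apply: acN; case: j => [|j]; last by have [] := picard_ac n j.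
  exact: ac_cst.
have := ae_forall_lt n.+2 (fun j => int0_rder (ih j)).
apply: ae_mono => x H xb.
have -> : ((q x)%:C - z) * picY n z x = \sum_(j < n.+2) (h j x)%:C * z ^+ j.
  have -> : picY n z x = \sum_(j < n.+2) ((picard n).1 j x)%:C * z ^+ j.
    by rewrite big_ord_recr /= (picard_gt x (ltnSn n)).1 mul0r addr0.
  under [RHS]eq_bigr => j _ do rewrite rmorphB rmorphM/= mulrBl -mulrA.
  rewrite sumrB -mulr_sumr mulrBl; congr (_ - _).
  (* Multiplication by z shifts the coefficients by one: the new term of index 0 vanishes, and so
     does the top coefficient on the left. *)
  rewrite [in RHS]big_ord_recl /= mul0r add0r big_ord_recr /=.
  rewrite (picard_gt x (ltnSn n)).1 mul0r addr0 mulr_sumr.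
  by apply: eq_bigr => j _; rewrite exprS mulrCA.
apply: cder_sum => j.
rewrite -[(_ * _ : R[i])]addr0 -[X in _ + X](mulr0 ((picard n.+1).2 j x)%:C).
apply: cderM; last exact: cder_cst.
by apply: cder_real; apply: H.
Qed.

Lemma picY_0 n z : picY n.+1 z 0 = 0.
Proof. by rewrite /picY big1// => j _; rewrite /= int0_0 mul0r. Qed.

Lemma picW_0 n z : picW n.+1 z 0 = 0.
Proof. by rewrite /picW big1// => j _; rewrite /= int0_0 mul0r. Qed.

Lemma pic0 z x : picY 0 z x = alpha%:C /\ picW 0 z x = beta%:C.
Proof. by rewrite /picY /picW !big_ord_recl !big_ord0 /= !expr0 !mulr1 !addr0. Qed.

(** One majorant for both components of the system: 1 dominates the coefficient in y' = w, and rho +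
    |q| dominates |q - z| for |z| <= rho. *)
Definition majorant rho x : R := int0 (fun t => 1 + rho + `|q t|) x.

End Picard.

(** * Complex primitives and dominated increments *)

Section ComplexPrimitive.
Context {R : realType}.
Local Notation mu := (@lebesgue_measure R).

Definition int0c (h : R -> R[i]) (x : R) : R[i] :=
  int0 (fun t => Re (h t)) x +i* int0 (fun t => Im (h t)) x.

Definition cintegrable b (h : R -> R[i]) : Prop :=
  mu.-integrable `[0, b] (EFin \o (fun t => Re (h t))) /\
  mu.-integrable `[0, b] (EFin \o (fun t => Im (h t))).

Lemma cac_int0c b h : cintegrable b h -> cac 0 b (int0c h).
Proof. by move=> [hr hi]; split; exact: ac_int0. Qed.

Lemma int0c_cder b h : cintegrable b h ->
  {ae mu, forall x, 0 < x < b -> cder (int0c h) x (h x)}.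
Proof.
by move=> [hr hi]; apply: ae_mono2 (int0_rder hr) (int0_rder hi) => x ? ? xb; split; auto.
Qed.

Lemma int0c_0 (h : R -> R[i]) : int0c h 0 = 0.
Proof. by apply: complex_eqP; rewrite /= int0_0. Qed.

Lemma cintegrable_cac b h : cac 0 b h -> cintegrable b h.
Proof. by move=> [hr hi]; split; exact: integrable_ac. Qed.

Lemma cac_int0c_cder b h x : cac 0 b h -> 0 < x < b -> cder (int0c h) x (h x).
Proof.
move=> hc xb; have [hr hi] := hc; split;
  apply: (rder_int0_continuous _ xb); try exact: integrable_ac; exact: (ac_continuous_at _ xb).
Qed.

Lemma cintegrable_schrodinger b (q : R -> R) z (y : R -> R[i]) :
  mu.-integrable `[0, b] (EFin \o q) -> cac 0 b y ->
  cintegrable b (fun t => ((q t)%:C - z) * y t).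
Proof.
move=> iq yc; have [yr yi] := yc; have [zr zi] := cintegrable_cac (cacZ (- z) yc).
split.
  rewrite (_ : (fun t => _) = fun t => q t * Re (y t) + Re (- z * y t)).
    by apply: integrableD_EFin => //; exact: integrable_mul_ac.
  by apply/funext => t; rewrite !ReIm /=; ring.
rewrite (_ : (fun t => _) = fun t => q t * Im (y t) + Im (- z * y t)).
  by apply: integrableD_EFin => //; exact: integrable_mul_ac.
by apply/funext => t; rewrite !ReIm /=; ring.
Qed.

(** A bound on increments by those of a fixed AC function survives pointwise limits; this is how
    absolute continuity passes from the partial sums to the solution. *)
Lemma ac_dominated b (f G : R -> R) K : 0 <= K -> ac 0 b G ->
  (forall x y, 0 <= x -> x <= y -> y <= b -> `|f y - f x| <= K * (G y - G x)) -> ac 0 b f.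
Proof.
move=> K0 acG fG e e0; have K1 : 0 < K + 1 by rewrite ltr_wpDl.
have eK : 0 < e / (K + 1) by rewrite divr_gt0.
have [d d0 H] := acG _ eK; exists d => // n u v uv tI sd.
have := H n u v uv tI sd; rewrite ltr_pdivlMr// => h; apply: le_lt_trans h.
rewrite mulr_suml; apply: ler_sum => i _; have /and3P[h1 h2 h3] := uv i.
apply: (le_trans (fG _ _ h1 h2 h3)); rewrite mulrC.
apply: (@le_trans _ _ (`|G (v i) - G (u i)| * K)); first by rewrite ler_wpM2r// ler_norm.
by rewrite ler_wpM2l// lerDl ler01.
Qed.

Lemma cac_dominated b (f : R -> R[i]) G K : 0 <= K -> ac 0 b G ->
  (forall x y, 0 <= x -> x <= y -> y <= b -> normc (f y - f x) <= K * (G y - G x)) ->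
  cac 0 b f.
Proof.
move=> K0 acG fG; split; apply: (ac_dominated K0 acG) => x y x0 xy yb;
  apply: le_trans (fG x y x0 xy yb).
  by rewrite -ReB Re_le_normc.
by rewrite -ImB Im_le_normc.
Qed.

End ComplexPrimitive.

(** * Convergence of the Picard series *)

Section PicardConvergence.
Context {R : realType}.
Local Notation mu := (@lebesgue_measure R).
Variables (b : R) (q : R -> R).
Hypotheses (b0 : 0 < b) (iq : mu.-integrable `[0, b] (EFin \o q)).
Variables (alpha beta : R).
Local Notation picY := (picY q alpha beta).
Local Notation picW := (picW q alpha beta).
Implicit Types (rho x y t : R) (z : R[i]).

Let m rho t := 1 + rho + `|q t|.

Lemma integrable_m rho : mu.-integrable `[0, b] (EFin \o m rho).
Proof.
apply: integrableD_EFin; last exact: (integrable_norm iq).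
apply: integrable_ac.
exact: ac_cst.
Qed.

Lemma integrableZ_m K rho : mu.-integrable `[0, b] (EFin \o (fun t => K * m rho t)).
Proof.
rewrite (_ : (fun t => _) = fun t => m rho t * K); last by apply/funext => t; rewrite mulrC.
apply: integrable_mul_ac; first exact: integrable_m.
exact: ac_cst.
Qed.

Lemma m_ge1 rho t : 0 <= rho -> 1 <= m rho t.
Proof. by move=> r0; rewrite /m -addrA lerDl addr_ge0. Qed.

Lemma majorant_ac rho : ac 0 b (majorant q rho).
Proof. exact: ac_int0 (integrable_m rho). Qed.

Lemma majorant_mono rho x y : 0 <= rho -> 0 <= x -> x <= y -> y <= b ->
  majorant q rho x <= majorant q rho y.
Proof.
move=> r0 x0 xy yb; rewrite -subr_ge0 /majorant (int0B (integrable_m rho))//.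
by apply: Rintegral_ge0 => t _; rewrite (le_trans ler01)// m_ge1.
Qed.

Lemma majorant_ge0 rho x : 0 <= rho -> 0 <= x <= b -> 0 <= majorant q rho x.
Proof.
by move=> r0 /andP[x0 xb]; rewrite -(int0_0 (m rho)); exact: majorant_mono.
Qed.

Lemma ac_exprn (f : R -> R) n : ac 0 b f -> ac 0 b (fun x => f x ^+ n).
Proof.
move=> fc; elim: n => [|n IH].
  exact: ac_cst.
by apply: ac_ext (acM fc IH) => x _; rewrite exprS.
Qed.

Lemma rder_exprn (f : R -> R) n x d : rder f x d ->
  rder (fun y => f y ^+ n.+1) x (n.+1%:R * f x ^+ n * d).
Proof.
move=> fd; elim: n => [|n IH].
  by apply: rder_ext fd; [apply/funext => y; rewrite expr1|rewrite expr0 mulr1 mul1r].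
apply: rder_ext (rderM fd IH).
  by apply/funext => y; rewrite -exprS.
by rewrite -[n.+2%:R]natr1 exprS; ring.
Qed.

(** With M the majorant, M^(n+1) / (n+1)! has derivative M' M^n / n!. This holds only a.e., so the
    integration goes through [ac_FTC]. *)
Lemma int0_majorant_pow rho K n x : 0 <= rho -> 0 <= x <= b ->
  mu.-integrable `[0, b] (EFin \o (fun t => m rho t * (K * exp_coeff (majorant q rho t) n))) /\
  int0 (fun t => m rho t * (K * exp_coeff (majorant q rho t) n)) x =
    K * exp_coeff (majorant q rho x) n.+1.
Proof.
move=> r0 /andP[x0 xb]; set h := (fun t => _).
have accoef k : ac 0 b (fun t => K * exp_coeff (majorant q rho t) k).
  apply: ac_ext (acM (ac_exprn k (majorant_ac rho)) _) => [t _|]; last first.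
    exact: (ac_cst _ _ (K / k`!%:R)).
  by rewrite /exp_coeff /= mulrCA.
have ih : mu.-integrable `[0, b] (EFin \o h) by exact: integrable_mul_ac (integrable_m rho) _.
split => //.
have FT : {ae mu, forall t, 0 < t < x ->
    rder (fun t => K * exp_coeff (majorant q rho t) n.+1) t (h t)}.
  apply: ae_mono (int0_rder (integrable_m rho)) => t Ht /andP[t0 tx].
  have {}Ht : rder (int0 (m rho)) t (m rho t) by apply: Ht; rewrite t0 (lt_le_trans tx).
  apply: rder_ext (rderM (rder_exprn Ht) (rder_cst (K / n.+1`!%:R) t)).
    by apply/funext => y; rewrite /exp_coeff /= mulrCA.
  rewrite mulr0 addr0 /h /exp_coeff /= /majorant -/(m rho) factS natrM.
  field; rewrite !pnatr_eq0 -lt0n fact_gt0/=.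
  by [].
have := ac_FTC (lexx 0) x0 xb (accoef n.+1) ih FT.
by rewrite int0_0 subr0 /exp_coeff /= /majorant int0_0 expr0n mul0r mulr0 subr0.
Qed.

(** Each integration raises the power of the majorant and, by [int0_majorant_pow], produces the
    factorial that makes the series converge for every z. *)
Lemma picard_bound rho z n x : normc z <= rho -> 0 <= x <= b ->
  normc (picY n z x) <= (`|alpha| + `|beta|) * exp_coeff (majorant q rho x) n /\
  normc (picW n z x) <= (`|alpha| + `|beta|) * exp_coeff (majorant q rho x) n.
Proof.
move=> zr; have r0 : 0 <= rho by exact: le_trans (normc_ge0 z) zr.
elim: n x => [|n IH] x xb.
  have [-> ->] := pic0 q alpha beta z x.
  rewrite !normc_real /exp_coeff /= expr0 fact0 divr1 mulr1.
  by rewrite lerDl lerDr.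
set K := `|alpha| + `|beta|.
have [ih intE] := int0_majorant_pow K n r0 xb.
have /andP[x0 xb'] := xb.
have mcoef t : 0 <= t <= b -> 0 <= K * exp_coeff (majorant q rho t) n.
  by move=> tb; rewrite mulr_ge0 ?addr_ge0// exp_coeff_ge0// majorant_ge0.
rewrite -intE; split.
  have := cac_increment_le (lexx 0) x0 xb' (picY_cac iq alpha beta n.+1 z) ih.
  rewrite picY_0 subr0 int0_0 subr0; apply; apply: (aeW mu) => t /andP[t0 tx].
  have tb : 0 < t < b by rewrite t0 (lt_le_trans tx).
  exists (picW n z t); last exact: (picY_cder iq).
  have tb' : 0 <= t <= b by rewrite !ltW//; case/andP: tb.
  apply: (le_trans (IH t tb').2); rewrite -[leLHS]mul1r.
  by rewrite ler_wpM2r ?mcoef// m_ge1.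
have := cac_increment_le (lexx 0) x0 xb' (picW_cac iq alpha beta n.+1 z) ih.
rewrite picW_0 subr0 int0_0 subr0; apply.
apply: ae_mono (picW_cder iq alpha beta n z) => t H /andP[t0 tx].
have tb : 0 < t < b by rewrite t0 (lt_le_trans tx).
have tb' : 0 <= t <= b by rewrite !ltW//; case/andP: tb.
exists (((q t)%:C - z) * picY n z t); last exact: H.
rewrite normcM; apply: ler_pM; rewrite ?normc_ge0//; last exact: (IH t tb').1.
apply: (le_trans (normcD _ _)); rewrite normcN normc_real addrC.
by apply: lerD => //; apply: (le_trans zr); rewrite lerDr ler01.
Qed.

Let C := `|alpha| + `|beta|.
Let C0 : 0 <= C. Proof. by rewrite addr_ge0. Qed.
Let Mb rho := majorant q rho b.

Lemma picard_bound_b rho z n x : normc z <= rho -> 0 <= x <= b ->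
  normc (picY n z x) <= C * exp_coeff (Mb rho) n /\
  normc (picW n z x) <= C * exp_coeff (Mb rho) n.
Proof.
move=> zr xb; have r0 : 0 <= rho by exact: le_trans (normc_ge0 z) zr.
have le_coef : exp_coeff (majorant q rho x) n <= exp_coeff (Mb rho) n.
  have m0 : 0 <= majorant q rho x by exact: majorant_ge0.
  have m1 : majorant q rho x <= Mb rho.
    by case/andP: xb => x0 xb; exact: majorant_mono.
  rewrite /exp_coeff /= ler_wpM2r ?invr_ge0//.
  by apply: lerXn2r => //; rewrite nnegrE// (le_trans m0).
have [h1 h2] := picard_bound n zr xb.
by split; [apply: (le_trans h1)|apply: (le_trans h2)]; rewrite ler_wpM2l.
Qed.

Lemma Mb_ge0 rho : 0 <= rho -> 0 <= Mb rho.
Proof. by move=> r0; apply: majorant_ge0 => //; rewrite lexx ltW. Qed.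

Definition solY z x := csum (fun n => picY n z x).
Definition solW z x := csum (fun n => picW n z x).

Let SY N z x := \sum_(0 <= n < N) picY n z x.
Let SW N z x := \sum_(0 <= n < N) picW n z x.

Lemma sol_tail rho z x N : normc z <= rho -> 0 <= x <= b ->
  normc (solY z x - SY N z x) <= 2 * C * exp_tail (Mb rho) N /\
  normc (solW z x - SW N z x) <= 2 * C * exp_tail (Mb rho) N.
Proof.
move=> zr xb; have r0 : 0 <= rho by exact: le_trans (normc_ge0 z) zr.
by split; apply: csum_tail; rewrite ?Mb_ge0// => n; have [] := picard_bound_b n zr xb.
Qed.

Lemma partial_cac N z : cac 0 b (SY N z) /\ cac 0 b (SW N z).
Proof.
elim: N => [|N [IH1 IH2]].
  by split; apply: cac_ext (cac_cst 0 b 0) => x _; rewrite /SY /SW big_geq.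
split.
  by apply: cac_ext (cacD IH1 (picY_cac iq alpha beta N z)) => x _; rewrite /SY big_nat_recr.
by apply: cac_ext (cacD IH2 (picW_cac iq alpha beta N z)) => x _; rewrite /SW big_nat_recr.
Qed.

(** The index drops by one because the zeroth Picard term is constant. *)
Lemma SY_cder N z x : 0 < x < b -> cder (SY N.+1 z) x (SW N z x).
Proof.
move=> xb; elim: N => [|N IH].
  rewrite /SW big_geq// (_ : SY 1 z = fun=> alpha%:C); first exact: cder_cst.
  by apply/funext => t; rewrite /SY big_nat1 (pic0 q alpha beta z t).1.
rewrite /SW big_nat_recr//= (_ : SY N.+2 z = fun t => SY N.+1 z t + picY N.+1 z t).
  by apply: cderD => //; exact: (picY_cder iq).
by apply/funext => t; rewrite /SY big_nat_recr.
Qed.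

Lemma SW_cder N z :
  {ae mu, forall x, 0 < x < b -> cder (SW N.+1 z) x (((q x)%:C - z) * SY N z x)}.
Proof.
elim: N => [|N IH].
  apply: (aeW mu) => x _.
  rewrite /SY big_geq// mulr0 (_ : SW 1 z = fun=> beta%:C); first exact: cder_cst.
  by apply/funext => t; rewrite /SW big_nat1 (pic0 q alpha beta z t).2.
apply: ae_mono2 IH (picW_cder iq alpha beta N z) => x h1 h2 xb.
rewrite /SY big_nat_recr//= mulrDr.
rewrite (_ : SW N.+2 z = fun t => SW N.+1 z t + picW N.+1 z t).
  by apply: cderD; auto.
by apply/funext => t; rewrite /SW big_nat_recr.
Qed.

Lemma int0Z (K : R) (h : R -> R) x : mu.-integrable `[0, b] (EFin \o h) -> x <= b ->
  int0 (fun t => K * h t) x = K * int0 h x.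
Proof.
move=> ih xb; rewrite /int0; apply: RintegralZl => //.
exact: integrable_itvS ih.
Qed.

Lemma le_of_exp_tail M K (u v : R) : 0 <= M -> 0 <= K ->
  (forall N, u <= v + K * exp_tail M N) -> u <= v.
Proof.
move=> M0 K0 H; apply/ler_addgt0Pr => e e0.
have K1 : 0 < K + 1 by rewrite ltr_wpDl.
have [N HN] := exp_tail_small M0 (divr_gt0 e0 K1).
apply: (le_trans (H N)); rewrite lerD2l.
have := HN N (leqnn N); rewrite ler_pdivlMr// mulrC; apply: le_trans.
by rewrite ler_wpM2r ?exp_tail_ge0// lerDl ler01.
Qed.

(** The constant [B] is independent of [N], so the estimate passes to the limit. *)
Lemma partial_lipschitz z x y N : 0 <= x -> x <= y -> y <= b ->
  let rho := normc z in let B := C * expR (Mb rho) in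
  normc (SY N.+1 z y - SY N.+1 z x) <= B * (majorant q rho y - majorant q rho x) /\
  normc (SW N.+1 z y - SW N.+1 z x) <= B * (majorant q rho y - majorant q rho x).
Proof.
move=> x0 xy yb rho B.
have r0 : 0 <= rho by exact: normc_ge0.
have B0 : 0 <= B by rewrite mulr_ge0 ?expR_ge0.
have ih : mu.-integrable `[0, b] (EFin \o (fun t => B * m rho t)).
  exact: integrableZ_m.
have intE t : t <= b -> int0 (fun t => B * m rho t) t = B * majorant q rho t.
  by move=> tb; rewrite int0Z//; exact: integrable_m.
have bdS t : 0 <= t <= b -> normc (SY N z t) <= B /\ normc (SW N z t) <= B.
  move=> tb; split; apply: normc_partial_sum; rewrite ?Mb_ge0// => n.
    by have [] := picard_bound_b n (lexx rho) tb.
  by have [] := picard_bound_b n (lexx rho) tb.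
have xb : x <= b by exact: le_trans xy yb.
rewrite mulrBr -!intE//; split.
  apply: (cac_increment_le x0 xy yb (partial_cac N.+1 z).1 ih).
  apply: (aeW mu) => t /andP[xt ty].
  have tb : 0 < t < b by rewrite (le_lt_trans x0) ?(lt_le_trans ty).
  exists (SW N z t); last exact: SY_cder.
  have /andP[t0 tb'] := tb.
  have tbW : 0 <= t <= b by rewrite !ltW.
  have [_ h] := bdS t tbW.
  by apply: (le_trans h); rewrite ler_peMr// m_ge1.
apply: (cac_increment_le x0 xy yb (partial_cac N.+1 z).2 ih).
apply: ae_mono (SW_cder N z) => t H /andP[xt ty].
have tb : 0 < t < b by rewrite (le_lt_trans x0) ?(lt_le_trans ty).
exists (((q t)%:C - z) * SY N z t); last exact: H.
have /andP[t0 tb'] := tb.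
have tbW : 0 <= t <= b by rewrite !ltW.
have [h _] := bdS t tbW.
rewrite normcM mulrC; apply: ler_pM; rewrite ?normc_ge0//.
apply: (le_trans (normcD _ _)); rewrite normcN normc_real addrC.
by apply: lerD => //; rewrite lerDr ler01.
Qed.

Lemma sol_lipschitz z x y : 0 <= x -> x <= y -> y <= b ->
  let rho := normc z in let B := C * expR (Mb rho) in
  normc (solY z y - solY z x) <= B * (majorant q rho y - majorant q rho x) /\
  normc (solW z y - solW z x) <= B * (majorant q rho y - majorant q rho x).
Proof.
move=> x0 xy yb rho B.
have r0 : 0 <= rho by exact: normc_ge0.
have xb : 0 <= x <= b by rewrite x0 (le_trans xy).
have yb' : 0 <= y <= b by rewrite (le_trans x0).
(* Twice the tail constant [2 * C], for the errors at [x] and at [y]. *)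
have C4 : 0 <= 4 * C by rewrite mulr_ge0.
have tri (f S : R -> R[i]) e : normc (f x - S x) <= e -> normc (f y - S y) <= e ->
    normc (f y - f x) <= normc (S y - S x) + 2 * e.
  move=> h1 h2; have -> : f y - f x = (S y - S x) + ((f y - S y) - (f x - S x)) by ring.
  apply: (le_trans (normcD _ _)); rewrite lerD2l mulr_natl mulr2n.
  apply: (le_trans (normcD _ _)); rewrite normcN; exact: lerD.
split; apply: (le_of_exp_tail (Mb_ge0 r0) C4) => N;
  have [p1 p2] := partial_lipschitz z N x0 xy yb;
  have [h1 h2] := sol_tail N.+1 (lexx rho) xb;
  have [h3 h4] := sol_tail N.+1 (lexx rho) yb';
  have tl : exp_tail (Mb rho) N.+1 <= exp_tail (Mb rho) N
    by rewrite lerD2l lerN2 series_exp_le ?Mb_ge0.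
  apply: (le_trans (tri (solY z) (SY N.+1 z) _ h1 h3)); apply: lerD => //.
  rewrite mulrA mulrA -natrM; apply: ler_wpM2l => //.
apply: (le_trans (tri (solW z) (SW N.+1 z) _ h2 h4)); apply: lerD => //.
by rewrite mulrA mulrA -natrM; apply: ler_wpM2l => //.
Qed.

Lemma sol_cac z : cac 0 b (solY z) /\ cac 0 b (solW z).
Proof.
have B0 : 0 <= C * expR (Mb (normc z)) by rewrite mulr_ge0 ?expR_ge0.
by split; apply: (cac_dominated B0 (majorant_ac (normc z))) => x y x0 xy yb;
  have [] := sol_lipschitz z x0 xy yb.
Qed.

Lemma sol_0 z : solY z 0 = alpha%:C /\ solW z 0 = beta%:C.
Proof.
have b00 : 0 <= (0 : R) <= b by rewrite lexx ltW.
have C2 : 0 <= 2 * C by rewrite mulr_ge0.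
have SY0 N : SY N.+1 z 0 = alpha%:C.
  rewrite /SY big_nat_recl// (pic0 q alpha beta z 0).1 big1 ?addr0// => n _.
  by rewrite picY_0.
have SW0 N : SW N.+1 z 0 = beta%:C.
  rewrite /SW big_nat_recl// (pic0 q alpha beta z 0).2 big1 ?addr0// => n _.
  by rewrite picW_0.
have tl N : exp_tail (Mb (normc z)) N.+1 <= exp_tail (Mb (normc z)) N.
  by rewrite lerD2l lerN2 series_exp_le ?Mb_ge0 ?normc_ge0.
split; apply/eqP; rewrite -subr_eq0 -normc_eq0 eq_le normc_ge0 andbT;
  apply: (le_of_exp_tail (Mb_ge0 (normc_ge0 z)) C2) => N; rewrite add0r;
  have [h1 h2] := sol_tail N.+1 (lexx (normc z)) b00.
  by rewrite SY0 in h1; apply: (le_trans h1); rewrite ler_wpM2l.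
by rewrite SW0 in h2; apply: (le_trans h2); rewrite ler_wpM2l.
Qed.

(** The limit is identified through the integrated equation: a partial sum minus the primitive of
    [solW] has a derivative bounded by the tail, hence stays within [e * x] of [alpha]. *)
Lemma solY_primitive z x : 0 <= x <= b -> solY z x = alpha%:C + int0c (solW z) x.
Proof.
move=> xb; have /andP[x0 xb'] := xb; have [Yc Wc] := sol_cac z.
have r0 := normc_ge0 z.
have K0 : 0 <= 2 * C * (1 + b) by rewrite !mulr_ge0 ?addr_ge0// ltW.
apply/eqP; rewrite -subr_eq0 -normc_eq0 eq_le normc_ge0 andbT.
apply: (le_of_exp_tail (Mb_ge0 r0) K0) => N; rewrite add0r.
have [h1 _] := sol_tail N.+1 (lexx (normc z)) xb.
set e := 2 * C * exp_tail (Mb (normc z)) N.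
have e0 : 0 <= e by rewrite !mulr_ge0 ?exp_tail_ge0 ?Mb_ge0.
have tl : 2 * C * exp_tail (Mb (normc z)) N.+1 <= e.
  by rewrite ler_wpM2l ?mulr_ge0// lerD2l lerN2 series_exp_le ?Mb_ge0.
pose f t := SY N.+1 z t - int0c (solW z) t.
have fc : cac 0 b f by apply: cacB; [exact: (partial_cac _ _).1|exact/cac_int0c/cintegrable_cac].
have ie : mu.-integrable `[0, b] (EFin \o (fun=> e)).
  exact/integrable_ac/ac_cst.
have h2 : normc (f x - f 0) <= int0 (fun=> e) x - int0 (fun=> e) 0.
  apply: (cac_increment_le (lexx 0) x0 xb' fc ie); apply: (aeW mu) => t /andP[t0 tx].
  have tb : 0 < t < b by rewrite t0 (lt_le_trans tx).
  exists (SW N z t - solW z t).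
    have tbW : 0 <= t <= b by case/andP: tb => /ltW -> /ltW.
    by rewrite normcB; have [_] := sol_tail N (lexx (normc z)) tbW.
  by apply: cderB; [exact: SY_cder|exact: (cac_int0c_cder Wc tb)].
have f0 : f 0 = alpha%:C.
  rewrite /f int0c_0 subr0 /SY big_nat_recl// (pic0 q alpha beta z 0).1 big1 ?addr0// => n _.
  by rewrite picY_0.
have ix : int0 (fun=> e) x = e * x.
  rewrite /int0 Rintegral_cst//= lebesgue_measure_itv/= lte_fin.
  have [x0'|x0'] := ltP 0 x; first by rewrite -EFinB subr0.
  by have -> : x = 0 by apply/eqP; rewrite eq_le x0'.
rewrite f0 int0_0 subr0 ix in h2.
have -> : solY z x - (alpha%:C + int0c (solW z) x) = (solY z x - SY N.+1 z x) + (f x - alpha%:C).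
  by rewrite /f; ring.
apply: (le_trans (normcD _ _)).
have -> : 2 * C * (1 + b) * exp_tail (Mb (normc z)) N = e + e * b by rewrite /e; ring.
by apply: lerD; [exact: le_trans tl|apply: (le_trans h2); exact: ler_wpM2l].
Qed.

(** Same scheme as for [solY]; the error in the derivative now carries the weight [m], so that [Mb]
    replaces [b] in the bound. *)
Lemma solW_primitive z x : 0 <= x <= b ->
  solW z x = beta%:C + int0c (fun t => ((q t)%:C - z) * solY z t) x.
Proof.
move=> xb; have /andP[x0 xb'] := xb; have [Yc Wc] := sol_cac z.
have r0 := normc_ge0 z.
have K0 : 0 <= 2 * C * (1 + Mb (normc z)) by rewrite !mulr_ge0 ?addr_ge0 ?Mb_ge0.
apply/eqP; rewrite -subr_eq0 -normc_eq0 eq_le normc_ge0 andbT.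
apply: (le_of_exp_tail (Mb_ge0 r0) K0) => N; rewrite add0r.
have [_ h1] := sol_tail N.+1 (lexx (normc z)) xb.
set e := 2 * C * exp_tail (Mb (normc z)) N.
have e0 : 0 <= e by rewrite !mulr_ge0 ?exp_tail_ge0 ?Mb_ge0.
have tl : 2 * C * exp_tail (Mb (normc z)) N.+1 <= e.
  by rewrite ler_wpM2l ?mulr_ge0// lerD2l lerN2 series_exp_le ?Mb_ge0.
have ig := cintegrable_schrodinger z iq Yc.
pose f t := SW N.+1 z t - int0c (fun t => ((q t)%:C - z) * solY z t) t.
have fc : cac 0 b f by apply: cacB; [exact: (partial_cac _ _).2|exact: cac_int0c].
have ie : mu.-integrable `[0, b] (EFin \o (fun t => e * m (normc z) t)).
  exact: integrableZ_m.
have h2 : normc (f x - f 0) <= int0 (fun t => e * m (normc z) t) x - int0 (fun t => e * m (normc z) t) 0.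
  apply: (cac_increment_le (lexx 0) x0 xb' fc ie).
  apply: ae_mono2 (SW_cder N z) (int0c_cder ig) => t H1 H2 /andP[t0 tx].
  have tb : 0 < t < b by rewrite t0 (lt_le_trans tx).
  exists (((q t)%:C - z) * SY N z t - ((q t)%:C - z) * solY z t); last first.
    by apply: cderB; [exact: H1|exact: H2].
  rewrite -mulrBr normcM mulrC [normc (SY _ _ _ - _)]normcB; apply: ler_pM; rewrite ?normc_ge0//.
    have tbW : 0 <= t <= b by case/andP: tb => /ltW -> /ltW.
    by have [h _] := sol_tail N (lexx (normc z)) tbW.
  apply: (le_trans (normcD _ _)); rewrite normcN normc_real addrC.
  by apply: lerD => //; rewrite lerDr ler01.
have f0 : f 0 = beta%:C.
  rewrite /f int0c_0 subr0 /SW big_nat_recl// (pic0 q alpha beta z 0).2 big1 ?addr0// => n _.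
  by rewrite picW_0.
rewrite f0 int0_0 subr0 int0Z// in h2; last exact: integrable_m.
rewrite -[beta%:C + _]/(beta%:C + int0c (fun t => ((q t)%:C - z) * solY z t) x).
set I := int0c _ x.
have -> : solW z x - (beta%:C + I) = (solW z x - SW N.+1 z x) + (f x - beta%:C).
  by rewrite /f -/I; ring.
apply: (le_trans (normcD _ _)).
have -> : 2 * C * (1 + Mb (normc z)) * exp_tail (Mb (normc z)) N = e + e * Mb (normc z).
  by rewrite /e; ring.
apply: lerD; [exact: le_trans tl|apply: (le_trans h2); apply: ler_wpM2l => //].
by apply: majorant_mono.
Qed.

Lemma sol_sol2 z : sol2 q z b (solY z) (solW z).
Proof.
have [Yc Wc] := sol_cac z; split => //.
  move=> x xb; have /andP[x0 xb'] := xb.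
  have H : cder (fun t => alpha%:C + int0c (solW z) t) x (solW z x).
    rewrite -[solW z x]add0r; apply: cderD; first exact: cder_cst.
    exact: (cac_int0c_cder Wc xb).
  apply: (cder_local (r := b - x) _ (ltW x0) _ H); first by rewrite subr_gt0.
  move=> y y0 yx; rewrite solY_primitive// y0/=.
  by move: yx; rewrite ltr_norml => /andP[_ ?]; lra.
apply: ae_mono (int0c_cder (cintegrable_schrodinger z iq Yc)) => x Hx xb.
have /andP[x0 xb'] := xb.
have H : cder (fun t => beta%:C + int0c (fun t => ((q t)%:C - z) * solY z t) t) x
    (((q x)%:C - z) * solY z x).
  rewrite -[X in cder _ _ X]add0r; apply: cderD; first exact: cder_cst.
  exact: Hx.
apply: (cder_local (r := b - x) _ (ltW x0) _ H); first by rewrite subr_gt0.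
move=> y y0 yx; rewrite solW_primitive// y0/=.
by move: yx; rewrite ltr_norml => /andP[_ ?]; lra.
Qed.

Lemma picY_conj n z x : picY n z^* x = (picY n z x)^*.
Proof.
rewrite /picY rmorph_sum; apply: eq_bigr => j _.
rewrite rmorphM rmorphXn; congr (_ * _).
by apply: complex_eqP; rewrite /= ?oppr0.
Qed.

(** Real initial data and a real potential give real Picard coefficients, so the partial sums
    commute with conjugation. *)
Lemma solY_conj z x : 0 <= x <= b -> solY z^* x = (solY z x)^*.
Proof.
move=> xb; have C4 : 0 <= 4 * C by rewrite mulr_ge0.
apply/eqP; rewrite -subr_eq0 -normc_eq0 eq_le normc_ge0 andbT.
apply: (le_of_exp_tail (Mb_ge0 (normc_ge0 z)) C4) => N; rewrite add0r.
have zJ : normc z^* <= normc z by rewrite normcJ.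
have [h1 _] := sol_tail N zJ xb; have [h2 _] := sol_tail N (lexx (normc z)) xb.
have SJ : SY N z^* x = (SY N z x)^*.
  by rewrite /SY rmorph_sum; apply: eq_bigr => j _; exact: picY_conj.
have -> : solY z^* x - (solY z x)^* = (solY z^* x - SY N z^* x) - (solY z x - SY N z x)^*.
  by rewrite SJ rmorphB/=; ring.
apply: (le_trans (normcD _ _)); rewrite normcN normcJ.
have -> : 4 * C * exp_tail (Mb (normc z)) N = 2 * C * exp_tail (Mb (normc z)) N + 2 * C * exp_tail (Mb (normc z)) N.
  by ring.
apply: lerD; last exact: h2.
exact: h1.
Qed.

(** The partial sums are polynomials in z, with a tail uniform on disks. The radius in [poly_approx]
    may be negative, whence the absolute value [r]. *)
Lemma solY_poly_approx x : 0 <= x <= b -> poly_approx (fun z => solY z x).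
Proof.
move=> xb rho e e0; pose r := `|rho|.
have r0 : 0 <= r by rewrite normr_ge0.
have C1 : 0 < 2 * C + 1 by rewrite ltr_wpDl// mulr_ge0.
have [N HN] := exp_tail_small (Mb_ge0 r0) (divr_gt0 e0 C1).
exists (\sum_(0 <= n < N) \sum_(j < n.+1) (((picard q alpha beta n).1 j x)%:C)%:P * 'X^j).
move=> z zr; have zr' : normc z <= r by rewrite (le_trans zr) ?ler_norm.
have [h _] := sol_tail N zr' xb.
have -> : (\sum_(0 <= n < N) \sum_(j < n.+1)
    (((picard q alpha beta n).1 j x)%:C)%:P * 'X^j).[z] = SY N z x.
  rewrite horner_sum; apply: eq_bigr => n _; rewrite horner_sum; apply: eq_bigr => j _.
  by rewrite !hornerE.
apply: (le_trans h); have := HN N (leqnn N); rewrite ler_pdivlMr// mulrC; apply: le_trans.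
by rewrite ler_wpM2r ?exp_tail_ge0 ?Mb_ge0// lerDl ler01.
Qed.

End PicardConvergence.

(** * Energy and asymptotics of solutions *)

Section SolutionPairs.
Context {R : realType}.
Local Notation mu := (@lebesgue_measure R).
Implicit Types (q : R -> R) (z k : R[i]) (y w : R -> R[i]) (b x t : R).

Lemma wronskian_constant q z b y1 w1 y2 w2 x : sol2 q z b y1 w1 -> sol2 q z b y2 w2 ->
  0 <= x <= b -> y1 x * w2 x - w1 x * y2 x = y1 0 * w2 0 - w1 0 * y2 0.
Proof.
move=> [y1c w1c dy1 dw1] [y2c w2c dy2 dw2] /andP[x0 xb].
apply: (cac_constant (f := fun t => y1 t * w2 t - w1 t * y2 t) (lexx 0) x0 xb).
  by apply: cacB; exact: cacM.
apply: ae_mono2 dw1 dw2 => t h1 h2 /andP[t0 tx].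
have tb : 0 < t < b by rewrite t0 (lt_le_trans tx).
have := cderB (cderM (dy1 t tb) (h2 tb)) (cderM (h1 tb) (dy2 t tb)).
by congr (cder _ _ _); ring.
Qed.

Lemma sol2Z q z b y w (c : R[i]) : sol2 q z b y w ->
  sol2 q z b (fun x => c * y x) (fun x => c * w x).
Proof.
move=> [yc wc dy dw]; split; try exact: cacZ.
- by move=> x xb; apply: cderZ; exact: dy.
- apply: ae_mono dw => x H xb; have := cderZ c (H xb).
  by congr (cder _ _ _); ring.
Qed.

(* When w = y', the derivative of the energy is - Im z |y|^2. *)
Definition energy y w x : R := Im (w x * (y x)^*).

Lemma energy_ac q z b y w : sol2 q z b y w -> ac 0 b (energy y w).
Proof. by move=> [yc wc _ _]; have [] := cacM wc (cacJ yc). Qed.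

Lemma energy_rder q z b y w : sol2 q z b y w ->
  {ae mu, forall x, 0 < x < b -> rder (energy y w) x (- (Im z * normc (y x) ^+ 2))}.
Proof.
move=> [yc wc dy dw]; apply: ae_mono dw => x H xb.
have [_] := cderM (H xb) (cderJ (dy x xb)).
apply: rder_ext => //; rewrite normc_sqr !ReIm /=; ring.
Qed.

Lemma energy_le q z b y w x x' : 0 <= Im z -> sol2 q z b y w ->
  0 <= x -> x <= x' -> x' <= b -> energy y w x' <= energy y w x.
Proof.
move=> z0 s x0 xx xb; apply: (ac_nonincreasing (f := energy y w) x0 xx).
  by apply: acS (energy_ac s).
apply: ae_mono (energy_rder s) => t H /andP[xt tx].
exists (- (Im z * normc (y t) ^+ 2)); first by rewrite oppr_le0 mulr_ge0 ?sqr_ge0.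
by apply: H; rewrite (le_lt_trans x0) ?(lt_le_trans tx).
Qed.

Lemma ac_normc b (f : R -> R[i]) : cac 0 b f -> ac 0 b (fun x => normc (f x)).
Proof.
move=> /cacP fc e e0; have [d d0 H] := fc e e0; exists d => // n u v uv tI sd.
apply: le_lt_trans (H n u v uv tI sd); apply: ler_sum => i _.
rewrite ler_norml; apply/andP; split.
  rewrite lerNl opprB lerBlDl; have := normcD (f (u i) - f (v i)) (f (v i)).
  by rewrite subrK addrC [normc (f (v i) - _)]normcB.
rewrite lerBlDl; have := normcD (f (v i) - f (u i)) (f (u i)).
by rewrite subrK addrC.
Qed.

(** Near [c] the modulus of [y] stays above half its value there, so the energy drops by a definite
    amount on [u, v]; elsewhere it does not increase. *)
Lemma energy_lt q z b y w x x' c : 0 < Im z -> sol2 q z b y w ->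
  0 <= x -> x < x' -> x' <= b -> x <= c <= x' -> y c != 0 -> energy y w x' < energy y w x.
Proof.
move=> z0 s x0 xx xb /andP[xc cx] yc0; have [yc wc _ _] := s.
have n0 : 0 < normc (y c) by rewrite normc_gt0.
have n2 : 0 < normc (y c) / 2 by rewrite divr_gt0.
have [d d0 Hd] := ac_uniform_continuous (ac_normc yc) n2.
pose u := Num.max x (c - d / 2); pose v := Num.min x' (c + d / 2).
have uv : u < v.
  rewrite /u /v gt_max !lt_min xx.
  have h1 : c - d / 2 < c by rewrite ltrBlDr ltrDl divr_gt0.
  have h2 : c < c + d / 2 by rewrite ltrDl divr_gt0.
  by rewrite (le_lt_trans xc h2) (lt_le_trans h1 cx) (lt_trans h1 h2).
have xu : x <= u by rewrite le_max lexx.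
have vx : v <= x' by rewrite ge_min lexx.
have big t : u < t < v -> (normc (y c) / 2) ^+ 2 <= normc (y t) ^+ 2.
  rewrite gt_max lt_min => /andP[/andP[t1 t2] /andP[t3 t4]].
  have h : `|normc (y t) - normc (y c)| < normc (y c) / 2.
    apply: Hd.
    - by rewrite (le_trans x0 xc) (le_trans cx).
    - by rewrite (le_trans x0 (ltW t1)) (le_trans (ltW t3)).
    - rewrite ltr_distl; clear -t2 t4 d0; apply/andP; split; lra.
  rewrite ler_pXn2r ?nnegrE ?normc_ge0 ?(ltW n2)//.
  by move: h; rewrite ltr_norml; clear; move: (normc _) (normc _) => p r; lra.
pose K := Im z * (normc (y c) / 2) ^+ 2.
have K0 : 0 < K by rewrite mulr_gt0// exprn_gt0.
have u0 : 0 <= u by rewrite (le_trans x0).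
have vb : v <= b by rewrite (le_trans vx).
have : energy y w v + K * v <= energy y w u + K * u.
  apply: (ac_nonincreasing (f := fun t => energy y w t + K * t) u0 (ltW uv)).
    by apply: acD; [apply: acS (energy_ac s)|exact: ac_affine].
  apply: ae_mono (energy_rder s) => t H tuv; have /andP[ut tv] := tuv.
  exists (- (Im z * normc (y t) ^+ 2) + K).
    by rewrite addrC subr_le0 ler_wpM2l ?big// ltW.
  apply: rderD; first by apply: H; rewrite (le_lt_trans u0) ?(lt_le_trans tv).
  by apply: rder_ext (rderM (rder_cst K t) (rder_id t)); rewrite ?mul0r ?add0r ?mulr1.
have : K * u < K * v by rewrite ltr_pM2l.
have := energy_le (ltW z0) s x0 xu (le_trans (ltW uv) vb).
have := energy_le (ltW z0) s (le_trans u0 (ltW uv)) vx xb.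
by clear; lra.
Qed.

(** As the Wronskian is 1, Im (y1 y2) = - e1 |y2|^2 + e2 |y1|^2 with e1, e2 the energies. Opposite
    signs exclude cancellation, so |e1| |y2|^2 <= |y1 y2|. With [phi] as [y1] and a Weyl solution as
    [y2], this bounds the latter pointwise. *)
Lemma green_bound q z b y1 w1 y2 w2 x : sol2 q z b y1 w1 -> sol2 q z b y2 w2 ->
  0 <= x <= b -> w1 0 * y2 0 - y1 0 * w2 0 = 1 -> energy y1 w1 x <= 0 -> 0 <= energy y2 w2 x ->
  `|energy y1 w1 x| * normc (y2 x) <= normc (y1 x).
Proof.
move=> s1 s2 xb W1 e1 e2.
have W : w1 x * y2 x - y1 x * w2 x = 1.
  by rewrite -W1 -opprB (wronskian_constant s1 s2 xb) opprB.
have [->|y20] := eqVneq (y2 x) 0.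
  by rewrite ComplexField.Normc.normc0 mulr0 normc_ge0.
have n0 : 0 < normc (y2 x) by rewrite normc_gt0.
rewrite -(ler_pM2r n0) -mulrA -expr2 -normcM.
apply: le_trans (Im_le_normc _).
have -> : Im (y1 x * y2 x) = - (energy y1 w1 x * normc (y2 x) ^+ 2 - energy y2 w2 x * normc (y1 x) ^+ 2).
  have -> : Im (y1 x * y2 x) = - Im ((y1 x * y2 x)^* * (w1 x * y2 x - y1 x * w2 x)).
    by rewrite W mulr1 ImJ opprK.
  by rewrite /energy !normc_sqr !ReIm; ring.
rewrite normrN ler0_norm// ler0_norm.
  by rewrite opprB mulNr lerDr mulr_ge0 ?sqr_ge0.
rewrite subr_le0; apply: (@le_trans _ _ 0).
  by rewrite mulr_le0_ge0 ?sqr_ge0.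
by rewrite mulr_ge0 ?sqr_ge0.
Qed.

End SolutionPairs.

(** * Asymptotics for large spectral parameter *)

Section Asymptotics.
Context {R : realType}.
Local Notation mu := (@lebesgue_measure R).
Implicit Types (q : R -> R) (z k c : R[i]) (y w : R -> R[i]) (b x t : R).

Lemma der_rder (f : R -> R) x d : 0 < x -> der f x d -> rder f x d.
Proof.
move=> x0 [fd fE]; apply: (derivable_rder x0 fd).
by rewrite derive1E.
Qed.

Lemma ac_of_der b (f f1 : R -> R) K : (forall x, der f x (f1 x)) ->
  (forall x, 0 <= x <= b -> `|f1 x| <= K) -> ac 0 b f.
Proof.
move=> fd f1K; apply: (ac_lipschitz (K := K)) => x y x0 xy yb.
move: xy; rewrite le_eqVlt => /orP[/eqP ->|xy].
  by rewrite !subrr normr0 mulr0.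
have [||t] := @MVT R f f1 x y xy.
- by move=> t _; exact: fd.
- by apply: derivable_within_continuous => t _; apply: ex_derive; exact: fd.
rewrite in_itv/= => /andP[xt ty] ->.
rewrite normrM [X in _ * X]gtr0_norm ?subr_gt0// ler_wpM2r ?subr_ge0 ?(ltW xy)//.
by apply: f1K; rewrite (le_trans x0 (ltW xt)) (le_trans (ltW ty)).
Qed.

Definition ex c x : R[i] := expc (c * x%:C).

Lemma normc_ex c x : normc (ex c x) = expR (Re c * x).
Proof. by rewrite /ex normc_expc !ReIm /= mulr0 subr0. Qed.

Lemma exN c x : ex (- c) x * ex c x = 1.
Proof.
rewrite /ex -expcD mulNr addNr /expc /= expR0 cos0 sin0 mulr1 mulr0.
by apply: complex_eqP.
Qed.

Lemma ex_0 c : ex c 0 = 1.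
Proof. by rewrite /ex mulr0 /expc /= expR0 cos0 sin0 mulr1 mulr0; apply: complex_eqP. Qed.

Lemma ex_der c x : der (fun t => Re (ex c t)) x (Re (c * ex c x)) /\
  der (fun t => Im (ex c t)) x (Im (c * ex c x)).
Proof.
have lin a : der (fun t : R => a * t) x a.
  by apply: der_eq (derM (is_derive_cst a x 1) (is_derive_id x 1)) _; rewrite mul0r add0r mulr1.
have L (a a' : R) : (fun t : R => a * t - a' * 0) = (fun t => a * t).
  by apply/funext => t; rewrite mulr0 subr0.
have E a : der (fun t : R => expR (a * t)) x (expR (a * x) * a).
  by apply: der_comp (lin a); exact: is_derive_expR.
have C a : der (fun t : R => cos (a * t)) x (- sin (a * x) * a).
  by apply: der_comp (lin a); exact: is_derive_cos.
have S a : der (fun t : R => sin (a * t)) x (cos (a * x) * a).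
  by apply: der_comp (lin a); exact: is_derive_sin.
have exE t : ex c t = (expR (Re c * t) * cos (Im c * t)) +i* (expR (Re c * t) * sin (Im c * t)).
  by rewrite /ex /expc !ReIm /= !mulr0 subr0 add0r.
split.
  apply: der_ext (derM (E (Re c)) (C (Im c))).
    by apply/funext => t; rewrite exE.
  by rewrite exE !ReIm /=; ring.
apply: der_ext (derM (E (Re c)) (S (Im c))).
  by apply/funext => t; rewrite exE.
by rewrite exE !ReIm /=; ring.
Qed.

Lemma ex_cder c x : 0 < x -> cder (ex c) x (c * ex c x).
Proof. by move=> x0; have [h1 h2] := ex_der c x; split; exact: der_rder. Qed.

Lemma ex_cac b c : cac 0 b (ex c).
Proof.
have bd x : 0 <= x <= b -> normc (c * ex c x) <= normc c * expR (`|Re c| * b).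
  move=> /andP[x0 xb]; rewrite normcM normc_ex ler_wpM2l ?normc_ge0// ler_expR.
  apply: (@le_trans _ _ (`|Re c| * x)); first by rewrite ler_wpM2r// ler_norm.
  by rewrite ler_wpM2l.
split.
  apply: (ac_of_der (fun x => (ex_der c x).1)) => x xb.
  by apply: (le_trans (Re_le_normc _)); exact: bd.
apply: (ac_of_der (fun x => (ex_der c x).2)) => x xb.
by apply: (le_trans (Im_le_normc _)); exact: bd.
Qed.

#[local] Opaque ex expc.

Local Notation ii := (0 +i* 1 : R[i]).

Lemma mulii : ii * ii = -1.
Proof. by apply: complex_eqP; rewrite !ReIm /=; ring. Qed.

Lemma normc_ii : normc ii = 1.
Proof. by rewrite /= expr0n expr1n add0r sqrtr1. Qed.

Lemma normc_sqr_mul_real (A d : R[i]) (r : R) :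
  normc (A * A * (r%:C * d)) = normc A * normc A * (`|r| * normc d).
Proof. by rewrite [LHS]normcM [normc (A * A)]normcM [normc (_ * d)]normcM normc_real. Qed.

Section Estimate.
Variables (q : R -> R) (z k : R[i]) (b : R) (y w : R -> R[i]).
Hypotheses (b0 : 0 < b) (iq : mu.-integrable `[0, b] (EFin \o q)).
Hypotheses (zk : z = k ^+ 2) (k_up : 0 <= Im k) (s : sol2 q z b y w).

Let Q := int0 (fun t => `|q t|) b.
Let N := normc (w 0) + normc k * normc (y 0).
Let E x := ex (ii * k) x.
(** Variation of constants for z = k^2: [V] and [U'] would be constant if q were 0, and their
    derivatives contain y only through q y. The prime in [U'] does not denote a derivative. *)
Let V x := E x * (w x - ii * k * y x).
Let U' x := ex (- (ii * k)) x * (w x + ii * k * y x).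

Let normE x : normc (E x) = expR (- (Im k * x)).
Proof. by rewrite /E normc_ex !ReIm /= mul0r mul1r sub0r mulNr. Qed.

Let normE' x : normc (ex (- (ii * k)) x) = expR (Im k * x).
Proof. by rewrite normc_ex !ReIm /= mul0r mul1r sub0r opprK. Qed.

Let V_cder : {ae mu, forall x, 0 < x < b -> cder V x (E x * ((q x)%:C * y x))}.
Proof.
have [yc wc dy dw] := s; apply: ae_mono dw => x H xb; have /andP[x0 _] := xb.
have := cderM (ex_cder (ii * k) x0) (cderB (H xb) (cderZ (ii * k) (dy x xb))).
congr (cder _ _ _); rewrite zk /E.
have -> : ii * k * ex (ii * k) x * (w x - ii * k * y x) = ex (ii * k) x * (ii * k * w x - (ii * ii) * k ^+ 2 * y x) by ring.
by rewrite mulii; ring.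
Qed.

Let U_cder : {ae mu, forall x, 0 < x < b -> cder U' x (ex (- (ii * k)) x * ((q x)%:C * y x))}.
Proof.
have [yc wc dy dw] := s; apply: ae_mono dw => x H xb; have /andP[x0 _] := xb.
have := cderM (ex_cder (- (ii * k)) x0) (cderD (H xb) (cderZ (ii * k) (dy x xb))).
congr (cder _ _ _); rewrite zk.
have -> : - (ii * k) * ex (- (ii * k)) x * (w x + ii * k * y x) =
  ex (- (ii * k)) x * (- (ii * k * w x) - (ii * ii) * k ^+ 2 * y x) by ring.
by rewrite mulii; ring.
Qed.

Let iabs : mu.-integrable `[0, b] (EFin \o (fun t => `|q t|)).
Proof. exact: (integrable_norm iq). Qed.

Let iabsZ K : mu.-integrable `[0, b] (EFin \o (fun t => K * `|q t|)).
Proof.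
rewrite (_ : (fun t => _) = fun t => `|q t| * K); last by apply/funext => t; rewrite mulrC.
apply: integrable_mul_ac => //.
exact: ac_cst.
Qed.

Let intQ K x : 0 <= K -> 0 <= x <= b -> int0 (fun t => K * `|q t|) x - int0 (fun t => K * `|q t|) 0 <= K * Q.
Proof.
move=> K0 /andP[x0 xb]; rewrite int0_0 subr0 (int0Z _ iabs)// ler_wpM2l//.
rewrite -subr_ge0 /Q (int0B iabs)//.
by apply: Rintegral_ge0.
Qed.

Let V_cac : cac 0 b V.
Proof.
have [yc wc _ _] := s.
by apply: cacM; [exact: ex_cac|apply: cacB => //; exact: cacZ].
Qed.

Let U_cac : cac 0 b U'.
Proof.
have [yc wc _ _] := s.
by apply: cacM; [exact: ex_cac|apply: cacD => //; exact: cacZ].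
Qed.

Let V_bound S x : 0 <= S -> (forall t, 0 <= t <= b -> normc (E t * y t) <= S) -> 0 <= x <= b ->
  normc (V x - V 0) <= S * Q.
Proof.
move=> S0 HS xb; have /andP[x0 xb'] := xb.
apply: le_trans (intQ S0 xb).
apply: (cac_increment_le (lexx 0) x0 xb' V_cac (iabsZ S)).
apply: ae_mono V_cder => t H /andP[t0 tx].
have tb : 0 < t < b by rewrite t0 (lt_le_trans tx).
exists (E t * ((q t)%:C * y t)); last exact: H.
rewrite mulrCA normcM normc_real mulrC ler_wpM2r//; apply: HS.
by case/andP: tb => /ltW -> /ltW.
Qed.

Let U_bound S x : 0 <= S -> (forall t, 0 <= t <= b -> normc (E t * y t) <= S) -> 0 <= x <= b ->
  normc (U' x - U' 0) <= expR (2 * Im k * x) * S * Q.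
Proof.
move=> S0 HS xb; have /andP[x0 xb'] := xb.
have K0 : 0 <= expR (2 * Im k * x) * S by rewrite mulr_ge0 ?expR_ge0.
apply: le_trans (intQ K0 xb).
apply: (cac_increment_le (lexx 0) x0 (lexx x)); first exact: cacS U_cac.
  by apply: integrable_itvS (iabsZ _).
apply: ae_mono U_cder => t H /andP[t0 tx].
have tb : 0 < t < b by rewrite t0 (lt_le_trans tx).
exists (ex (- (ii * k)) t * ((q t)%:C * y t)); last exact: H.
(* The bounded quantity [E t * y t] is made to appear; the two exponentials that remain account for
   the factor e^(2 Im k x). *)
have -> : ex (- (ii * k)) t * ((q t)%:C * y t) =
  ex (- (ii * k)) t * ex (- (ii * k)) t * ((q t)%:C * (E t * y t)).
  have := exN (ii * k) t; rewrite /E.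
  move: (ex (- (ii * k)) t) (ex (ii * k) t) ((q t)%:C) (y t) => A B c d AB.
  have -> : A * A * (c * (B * d)) = A * B * (A * (c * d)) by ring.
  by rewrite AB mul1r.
rewrite normc_sqr_mul_real normE' -expRD.
rewrite [leRHS](_ : _ = expR (2 * Im k * x) * (`|q t| * S)); last by ring.
have HSt : normc (E t * y t) <= S.
  by apply: HS; case/andP: tb => /ltW -> /ltW.
apply: ler_pM; rewrite ?expR_ge0 ?mulr_ge0 ?normc_ge0//.
  by rewrite ler_expR -mulrDl -mulr2n mulr_natl ler_wpM2l ?mulr_ge0 ?mulrn_wge0// ltW.
by rewrite ler_wpM2l.
Qed.

Let V0 : V 0 = w 0 - ii * k * y 0.
Proof. by rewrite /V /E ex_0 mul1r. Qed.

Let U0 : U' 0 = w 0 + ii * k * y 0.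
Proof. by rewrite /U' ex_0 mul1r. Qed.

Let V0N : normc (V 0) <= N.
Proof.
rewrite V0; apply: (le_trans (normcD _ _)).
by rewrite normcN !normcM normc_ii mul1r.
Qed.

Let U0N : normc (U' 0) <= N.
Proof.
by rewrite U0; apply: (le_trans (normcD _ _)); rewrite !normcM normc_ii mul1r.
Qed.

Let EU x : E x * (w x + ii * k * y x) = E x * E x * U' x.
Proof.
have := exN (ii * k) x; rewrite /U' /E.
move: (ex (- (ii * k)) x) (ex (ii * k) x) (w x + _) => A B c AB.
by rewrite -mulrA [B * (A * c)]mulrA [B * A]mulrC AB mul1r.
Qed.

Let Ubd S x : 0 <= S -> (forall t, 0 <= t <= b -> normc (E t * y t) <= S) -> 0 <= x <= b ->
  normc (E x * (w x + ii * k * y x)) <= expR (- (2 * Im k * x)) * N + S * Q.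
Proof.
move=> S0 HS xb; rewrite EU [normc (_ * U' x)]normcM [normc (E x * E x)]normcM normE -expRD.
have -> : expR (- (Im k * x) + - (Im k * x)) = expR (- (2 * Im k * x)).
  by congr expR; ring.
have h : normc (U' x) <= N + expR (2 * Im k * x) * S * Q.
  have -> : U' x = U' 0 + (U' x - U' 0) by ring.
  by apply: (le_trans (normcD _ _)); apply: lerD => //; exact: U_bound.
apply: (le_trans (ler_wpM2l (expR_ge0 _) h)).
by rewrite mulrDr lerD2l !mulrA -expRD addNr expR0 mul1r.
Qed.

Hypotheses (k0 : 0 < normc k) (kQ : 2 * Q <= normc k).

(** Absorption: at a maximum point [c] of |E y|, with value S, the difference of the two
    variation-of-constants expressions gives 2 |k| S <= 2 (N + S Q). Since 2 Q <= |k|, the term in S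
    on the right is at most half of the left side. *)
Lemma sol_growth x : 0 <= x <= b -> normc (E x * y x) <= 2 * N / normc k.
Proof.
have [yc wc _ _] := s.
have Eyc : cac 0 b (fun t => E t * y t) by apply: cacM => //; exact: ex_cac.
have [c cb cmax] := @EVT_max R (fun t => normc (E t * y t)) 0 b (ltW b0)
  (ac_continuous (ac_normc Eyc)).
set S := normc (E c * y c) in cmax.
have HS t : 0 <= t <= b -> normc (E t * y t) <= S.
  by move=> tb; apply: cmax; rewrite in_itv.
have S0 : 0 <= S by exact: normc_ge0.
have {}cb : 0 <= c <= b by rewrite in_itv/= in cb.
have h1 : normc (V c) <= N + S * Q.
  have -> : V c = V 0 + (V c - V 0) by ring.
  by apply: (le_trans (normcD _ _)); apply: lerD => //; exact: V_bound.
have h2 : normc (E c * (w c + ii * k * y c)) <= N + S * Q.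
  apply: (le_trans (Ubd S0 HS cb)); rewrite lerD2r.
  rewrite -[leRHS]mul1r ler_wpM2r ?addr_ge0 ?mulr_ge0 ?normc_ge0//.
  rewrite -[leRHS]expR0 ler_expR oppr_le0 !mulr_ge0//; by case/andP: cb.
have h3 : 2 * normc k * S <= 2 * (N + S * Q).
  have -> : 2 * normc k * S = normc (E c * (w c + ii * k * y c) - V c).
    have -> : E c * (w c + ii * k * y c) - V c = 2%:R%:C * (ii * k * (E c * y c)).
      by rewrite /V; apply: complex_eqP; rewrite !ReIm /=; ring.
    by rewrite normcM normc_real [normc (ii * k * _)]normcM [normc (ii * k)]normcM normc_ii
      mul1r ger0_norm// mulrA.
  apply: (le_trans (normcD _ _)); rewrite normcN [leRHS]mulr_natl mulr2n.
  exact: lerD h2 h1.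
move=> xb; apply: (le_trans (HS x xb)); rewrite ler_pdivlMr//.
have h4 : S * (2 * Q) <= S * normc k by rewrite ler_wpM2l.
have e1 : 2 * (N + S * Q) = 2 * N + S * (2 * Q) by ring.
rewrite e1 in h3; have e2 : 2 * normc k * S = 2 * (S * normc k) by ring.
rewrite e2 in h3; move: (S * normc k) (S * (2 * Q)) h3 h4 => u v h3 h4.
by lra.
Qed.

Let S1 := 2 * N / normc k.
Let S10 : 0 <= S1.
Proof. by rewrite divr_ge0 ?mulr_ge0 ?addr_ge0 ?mulr_ge0 ?normc_ge0. Qed.

Lemma sol_asymptotic_V x : 0 <= x <= b ->
  normc (E x * (w x - ii * k * y x) - (w 0 - ii * k * y 0)) <= 2 * N / normc k * Q.
Proof. by move=> xb; rewrite -V0; apply: V_bound => // t; exact: sol_growth. Qed.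

Lemma sol_asymptotic_U x : 0 <= x <= b ->
  normc (E x * (w x + ii * k * y x)) <= expR (- (2 * Im k * x)) * N + 2 * N / normc k * Q.
Proof. by move=> xb; apply: Ubd => // t; exact: sol_growth. Qed.

End Estimate.

End Asymptotics.

(** * Weyl solutions *)

Section HalfLineL2.
Context {R : realType}.
Local Notation mu := (@lebesgue_measure R).
Local Notation half_line := (`[0%R, +oo[%classic : set R).
Implicit Types (q : R -> R) (z : R[i]) (g h psi : R -> R[i]) (b x t : R).

Lemma ae_half_line_bounded (P : R -> Prop) :
  (forall b, 0 < b -> {ae mu, forall x, 0 < x < b -> P x}) ->
  {ae mu, forall x, 0 < x -> P x}.
Proof.
move=> H.
have neg n : mu.-negligible [set x | ~ (0 < x < n.+1%:R -> P x)] by apply: H.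
have := negligible_bigcup neg; apply: negligibleS => x /not_implyP[x0 nP].
exists (Num.truncn x) => // HP; apply: nP; apply: HP.
by rewrite x0 truncnS_gt.
Qed.

Lemma ae_half_line_pos (P : R -> Prop) : {ae mu, forall x, 0 < x -> P x} -> ae_half_line P.
Proof.
move=> HP; have n0 : mu.-negligible [set (0 : R)].
  by exists [set 0]; split => //; exact: lebesgue_measure_set1.
have := negligibleU HP n0; apply: negligibleS => x /= /not_implyP[x0 nP].
move: x0; rewrite le_eqVlt => /orP[/eqP <-|x0]; first by right.
by left => /(_ x0).
Qed.

Lemma half_line_continuous (u : R -> R) : (forall b, 0 < b -> ac 0 b u) ->
  {within half_line, continuous u}.
Proof.
move=> acu; apply/subspace_continuousP => x; rewrite /= in_itv/= andbT => x0.
apply/cvgrPdist_lt => e e0.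
have x1 : 0 < x + 1 by rewrite ltr_wpDl.
have [d d0 H] := ac_uniform_continuous (acu _ x1) e0.
exists (Num.min d 1); first by rewrite /= lt_min d0 ltr01.
move=> y /=; rewrite in_itv/= andbT lt_min => /andP[yd y1] y0; apply: H => //.
  by rewrite y0/=; move: y1; rewrite ltr_norml => /andP[? _]; lra.
by rewrite x0 lerDl ler01.
Qed.

Lemma half_line_measurable (u : R -> R) : (forall b, 0 < b -> ac 0 b u) ->
  measurable_fun half_line u.
Proof.
by move=> acu; apply: measurable_realfun.subspace_continuous_measurable_fun => //;
  exact: half_line_continuous.
Qed.

Lemma measurable_normc_sqr g : measurable_fun half_line (fun x => Re (g x)) ->
  measurable_fun half_line (fun x => Im (g x)) ->
  measurable_fun half_line (fun x => normc (g x) ^+ 2).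
Proof.
move=> mr mi; rewrite (_ : (fun x => _) = fun x => Re (g x) ^+ 2 + Im (g x) ^+ 2); last first.
  by apply/funext => x; rewrite normc_sqr.
by apply: measurable_funD; apply: measurable_funX.
Qed.

Definition hac g := forall b, 0 < b -> cac 0 b g.

Lemma hac_normc_sqr g : hac g -> measurable_fun half_line (fun x => normc (g x) ^+ 2).
Proof.
by move=> gc; apply: measurable_normc_sqr; apply: half_line_measurable => b b0;
  have [] := gc b b0.
Qed.

(** An AC function is continuous, hence Borel, and can replace the representative that [L2]
    provides. *)
Lemma hac_L2 g : hac g -> L2 g -> borel_L2 g.
Proof.
move=> gc [h [hr hi hfin] gh]; split.
- by apply: half_line_measurable => b b0; have [] := gc b b0.
- by apply: half_line_measurable => b b0; have [] := gc b b0.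
- suff -> : (\int[mu]_(x in half_line) (normc (g x) ^+ 2)%:E =
    \int[mu]_(x in half_line) (normc (h x) ^+ 2)%:E)%E by [].
  apply: ge0_ae_eq_integral => //.
  + by apply/measurable_EFinP; exact: hac_normc_sqr.
  + by apply/measurable_EFinP; exact: measurable_normc_sqr.
  + by move=> x _; rewrite lee_fin sqr_ge0.
  + by move=> x _; rewrite lee_fin sqr_ge0.
  + move: gh; apply: ae_mono => x H; rewrite /= in_itv/= andbT => x0.
    by rewrite H.
Qed.

(** On [0, 1] continuity gives integrability; 1 is the point beyond which the cut-off introduced
    below is inactive. *)
Lemma borel_L2_tail g psi (c : R) : hac g -> 0 <= c -> borel_L2 psi ->
  (forall x, 1 < x -> normc (g x) ^+ 2 <= c * normc (psi x) ^+ 2) -> borel_L2 g.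
Proof.
move=> gc c0 [pr pi' pfin] gpsi; split.
- by apply: half_line_measurable => b b0; have [] := gc b b0.
- by apply: half_line_measurable => b b0; have [] := gc b b0.
have mg := hac_normc_sqr gc.
have split_itv : half_line = `[0%R, 1%R]%classic `|` `]1%R, +oo[%classic.
  by rewrite -itv_bndbnd_setU// bnd_simp.
have mgE : measurable_fun half_line (fun x => (normc (g x) ^+ 2)%:E) by exact/measurable_EFinP.
rewrite split_itv ge0_integral_setU//=; last 3 first.
- by rewrite -split_itv.
- by move=> x _; rewrite lee_fin sqr_ge0.
- apply/disj_setPS => x [] /=; rewrite !in_itv/= andbT => /andP[_ x1] x1'.
  by have := lt_le_trans x1' x1; rewrite ltxx.
apply: lte_add_pinfty.
  have ac1 : ac 0 1 (fun x => normc (g x) ^+ 2).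
    by apply: ac_exprn; apply: ac_normc; exact: gc.
  have /integrableP[_] := integrable_ac ac1; apply: le_lt_trans.
  apply: ge0_le_integral => //.
  - by move=> x _; rewrite lee_fin sqr_ge0.
  - by apply/measurable_EFinP; apply: measurable_funS mg => // x /=; rewrite !in_itv/= => /andP[-> _].
  - apply/measurable_EFinP; apply: measurableT_comp => //.
    by apply: measurable_funS mg => // x /=; rewrite !in_itv/= => /andP[-> _].
  - by move=> x _ /=; rewrite lee_fin ler_norm.
apply: (@le_lt_trans _ _ (\int[mu]_(x in half_line) (c%:E * (normc (psi x) ^+ 2)%:E))%E).
  apply: (@le_trans _ _ (\int[mu]_(x in `]1%R, +oo[) (c%:E * (normc (psi x) ^+ 2)%:E))%E).
    apply: ge0_le_integral => //.
    - by move=> x _; rewrite lee_fin sqr_ge0.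
    - apply/measurable_EFinP; apply: measurable_funS mg => // x /=.
      by rewrite !in_itv/= !andbT => /ltW; exact: le_trans.
    - apply: measurable_funeM; apply/measurable_EFinP.
      apply: measurable_funS (measurable_normc_sqr pr pi') => // x /=.
      by rewrite !in_itv/= !andbT => /ltW; exact: le_trans.
    - by move=> x; rewrite /= in_itv/= andbT => x1; rewrite -EFinM lee_fin gpsi.
  apply: ge0_subset_integral => //.
  - by apply: measurable_funeM; apply/measurable_EFinP; exact: measurable_normc_sqr.
  - by move=> x _; rewrite mule_ge0// lee_fin ?sqr_ge0.
  - by move=> x /=; rewrite !in_itv/= !andbT => /ltW; exact: le_trans.
rewrite ge0_integralZl//; last 2 first.
- by apply/measurable_EFinP; exact: measurable_normc_sqr.
- by move=> x _; rewrite lee_fin sqr_ge0.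
by rewrite lte_mul_pinfty// lee_fin.
Qed.

Lemma borel_L2_integrable g : borel_L2 g ->
  mu.-integrable half_line (EFin \o (fun x => normc (g x) ^+ 2)).
Proof.
move=> [mr mi fin]; apply/integrableP; split.
  by apply/measurable_EFinP; exact: measurable_normc_sqr.
apply: le_lt_trans fin; apply: ge0_le_integral => //.
- by apply/measurable_EFinP/measurableT_comp => //; exact: measurable_normc_sqr.
- by apply/measurable_EFinP; exact: measurable_normc_sqr.
- by move=> x _; rewrite /= lee_fin ger0_norm// sqr_ge0.
Qed.

Lemma borel_L2_pairing_integrable g h : borel_L2 g -> borel_L2 h ->
  mu.-integrable half_line (EFin \o (fun x => Im (h x * (g x)^*))).
Proof.
move=> gL hL; have [gr gi _] := gL; have [hr hi _] := hL.
have igh : mu.-integrable half_line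
    (EFin \o (fun x => normc (g x) ^+ 2 + normc (h x) ^+ 2)).
  have := integrableD _ (borel_L2_integrable gL) (borel_L2_integrable hL).
  by apply; exact: measurable_itv.
apply: le_integrable igh => //.
  apply/measurable_EFinP.
  rewrite (_ : (fun x => _) = fun x => Im (h x) * Re (g x) - Re (h x) * Im (g x)); last first.
    by apply/funext => x; rewrite !ReIm; ring.
  by apply: measurable_funB; exact: measurable_funM.
move=> x _; rewrite /= lee_fin; apply: (le_trans (Im_le_normc _)).
rewrite normcM normcJ ger0_norm ?addr_ge0 ?sqr_ge0//.
have := sqr_ge0 (normc (g x) - normc (h x)); have := sqr_ge0 (normc (g x)).
have := sqr_ge0 (normc (h x)); have := mulr_ge0 (normc_ge0 (h x)) (normc_ge0 (g x)).
rewrite sqrrB; have -> : normc (g x) * normc (h x) *+ 2 = 2 * (normc (h x) * normc (g x)) by ring.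
by move: (_ * _) (normc (g x) ^+ 2) (normc (h x) ^+ 2) => u v w; clear; lra.
Qed.

End HalfLineL2.

(** * A cut-off near the origin *)

Section Cutoff.
Context {R : realType}.
Implicit Types (x y b : R).

(** Its cube has two continuous derivatives on the half-line, just enough for the cut-off Weyl
    solution to stay in [AC1]. *)
Definition ramp x : R := Num.max 0 (1 - x).

Lemma ramp_ge0 x : 0 <= ramp x. Proof. by rewrite le_max lexx. Qed.

Lemma ramp_lt x : x <= 1 -> ramp x = 1 - x.
Proof. by move=> x1; rewrite /ramp max_r// subr_ge0. Qed.

Lemma ramp_gt x : 1 <= x -> ramp x = 0.
Proof. by move=> x1; rewrite /ramp max_l// subr_le0. Qed.

Lemma ramp_ac b : ac 0 b ramp.
Proof.
apply: (ac_lipschitz (K := 1)) => x y _ xy _; rewrite mul1r.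
have [y1|/ltW y1] := leP y 1.
  by rewrite !ramp_lt ?(le_trans xy)// ler_norml; lra.
rewrite (ramp_gt y1); have [x1|/ltW x1] := leP x 1.
  by rewrite ramp_lt// ler_norml; lra.
by rewrite ramp_gt// subrr normr0 subr_ge0.
Qed.

Lemma rder_ramp_pow n x : 0 <= x ->
  rder (fun y => ramp y ^+ n.+2) x (- (n.+2%:R * ramp x ^+ n.+1)).
Proof.
move=> x0; have [x1|x1|x1] := ltgtP x 1.
- have H : rder (fun y => (1 - y) ^+ n.+2) x (n.+2%:R * (1 - x) ^+ n.+1 * (0 - 1)).
    by apply: rder_exprn; apply: rderB; [exact: rder_cst|exact: rder_id].
  rewrite ramp_lt ?(ltW x1)//.
  have -> : - (n.+2%:R * (1 - x) ^+ n.+1) = n.+2%:R * (1 - x) ^+ n.+1 * (0 - 1) by ring.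
  apply: (rder_local (r := 1 - x) _ _ H x0); first by rewrite subr_gt0.
  move=> y y0 yx; rewrite ramp_lt//.
  by move: yx; rewrite ltr_norml => /andP[_ ?]; lra.
- rewrite ramp_gt ?(ltW x1)// expr0n mulr0 oppr0.
  apply: (rder_local (r := x - 1) _ _ (rder_cst 0 x) x0); first by rewrite subr_gt0.
  move=> y y0 yx; rewrite ramp_gt ?expr0n//.
  by move: yx; rewrite ltr_norml => /andP[? _]; lra.
(* At the corner x = 1 the difference quotient is at most |y - 1| for y near 1, as the exponent is
   at least 2. *)
- rewrite x1 ramp_gt// expr0n mulr0 oppr0; apply/rderP => e e0.
  exists (Num.min e 1); first by rewrite lt_min e0 ltr01.
  move=> y y0 y1; rewrite lt_min => /andP[ye yle].
  rewrite (ramp_gt (lexx 1)) expr0n subr0 subr0 normrM normfV ltr_pdivrMr; last first.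
    by rewrite normr_gt0 subr_eq0.
  have d0 : 0 < `|y - 1| by rewrite normr_gt0 subr_eq0.
  have rle : ramp y <= `|y - 1|.
    by rewrite /ramp ge_max normr_ge0/= distrC ler_norm.
  rewrite normrX ger0_norm ?ramp_ge0// exprS.
  apply: (@le_lt_trans _ _ (`|y - 1| * `|y - 1|)).
    apply: ler_pM => //; rewrite ?ramp_ge0 ?exprn_ge0 ?ramp_ge0//.
    apply: le_trans rle; rewrite exprS; apply: ler_piMr; first exact: ramp_ge0.
    apply: exprn_ile1; first exact: ramp_ge0.
    by rewrite (le_trans _ (ltW yle))// /ramp ge_max normr_ge0/= distrC ler_norm.
  by rewrite ltr_pM2r.
Qed.

End Cutoff.

(** * Positivity of the energy of Weyl solutions *)

Section Weyl.
Context {R : realType}.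
Local Notation mu := (@lebesgue_measure R).
Local Notation half_line := (`[0%R, +oo[%classic : set R).
Implicit Types (q : R -> R) (z : R[i]) (b x t : R).

Lemma AC1_cder (g : R -> R[i]) x : AC1 g -> 0 <= x -> cder g x (hl_deriv g x).
Proof. by move=> [H _] x0; exact/hl_derivable_cder/H. Qed.

Lemma AC1_hac (g : R -> R[i]) : AC1 g -> hac g /\ hac (hl_deriv g).
Proof. by move=> [_ H]; split => b b0; have [h1 h2] := H b b0; apply/cacP. Qed.

(** The equation in [solution] speaks of [hl_deriv], which has a value even where no limit exists;
    a.e. differentiability of the AC function [hl_deriv psi] turns it into a statement about a true
    derivative. *)
Lemma solution_cder q z psi : solution q z psi ->
  {ae mu, forall x, 0 < x -> cder (hl_deriv psi) x (((q x)%:C - z) * psi x)}.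
Proof.
move=> [ps eqn]; have [pc dpc] := AC1_hac ps.
apply: ae_half_line_bounded => b b0.
apply: ae_mono2 eqn (cac_ae_cder (lexx 0) (dpc b b0)) => x E H xb.
have [d dd] := H xb; have /andP[x0 _] := xb.
have := E (ltW x0); rewrite (cder_deriv (ltW x0) dd) => /eqP.
by rewrite addrC subr_eq0 => /eqP ->.
Qed.

Lemma solution_sol2 q q0 z psi b : solution q z psi -> 0 < b ->
  {ae mu, forall x, x \in `[0, b] -> q x = q0 x} -> sol2 q0 z b psi (hl_deriv psi).
Proof.
move=> s b0 qq; have [ps _] := s; have [pc dpc] := AC1_hac ps; split; try by auto.
- by move=> x /andP[x0 _]; exact: AC1_cder (ltW x0).
- apply: ae_mono2 qq (solution_cder s) => x E H /andP[x0 xb].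
  by rewrite -E ?in_itv/= ?(ltW x0) ?(ltW xb)//; exact: H.
Qed.

Section WeylEnergy.
Variables (q : R -> R) (f psi : R -> R[i]) (z : R[i]).
Hypotheses (sa : self_adjoint_H q f) (weyl : weyl_solution q f z psi).
Hypothesis z0 : 0 < Im z.

Let dpsi := hl_deriv psi.
(** The Weyl solution need not vanish at 0, but [g] does, and it agrees with [psi] from 1 on, which
    puts it in the domain of H. Its image - g'' + q g is [h], namely z g - chi'' psi - 2 chi'
    psi'. *)
Let chi x : R := 1 - ramp x ^+ 3.
Let g x := (chi x)%:C * psi x.
Let g1 x := (3 * ramp x ^+ 2)%:C * psi x + (chi x)%:C * dpsi x.
Let h x := z * g x + (6 * ramp x)%:C * psi x - (6 * ramp x ^+ 2)%:C * dpsi x.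

Let sol : solution q z psi. Proof. by case: weyl. Qed.
Let psiAC : AC1 psi. Proof. by case: sol. Qed.
Let pc : hac psi. Proof. by have [] := AC1_hac psiAC. Qed.
Let dpc : hac dpsi. Proof. by have [] := AC1_hac psiAC. Qed.

Let chi_rder x : 0 <= x -> rder chi x (3 * ramp x ^+ 2).
Proof.
move=> x0; apply: rder_ext (rderB (rder_cst 1 x) (@rder_ramp_pow R 1 x x0)) => //.
by rewrite sub0r opprK.
Qed.

Let dchi_rder x : 0 <= x -> rder (fun y => 3 * ramp y ^+ 2) x (- (6 * ramp x)).
Proof.
move=> x0; apply: rder_ext (rderM (rder_cst 3 x) (@rder_ramp_pow R 0 x x0)) => //.
by rewrite expr1; ring.
Qed.

Let ramp_pow_ac b n : ac 0 b (fun x => ramp x ^+ n).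
Proof. by apply: ac_exprn; exact: ramp_ac. Qed.

Let chi_cac b : cac 0 b (fun x => (chi x)%:C).
Proof. by apply: cac_real; apply: acD; [exact: ac_cst|exact/acN/ramp_pow_ac]. Qed.

Let g_cac : hac g. Proof. by move=> b b0; apply: cacM; [exact: chi_cac|exact: pc]. Qed.

Let g1_cac : hac g1.
Proof.
move=> b b0; apply: cacD; apply: cacM; [|exact: pc|exact: chi_cac|exact: dpc].
by apply: cac_real; apply: acM; [exact: ac_cst|exact: ramp_pow_ac].
Qed.

Let h_cac : hac h.
Proof.
move=> b b0; apply: cacB; first apply: cacD.
- by apply: cacZ; exact: g_cac.
- apply: cacM; last exact: pc.
  by apply: cac_real; apply: acM; [exact: ac_cst|exact: ramp_ac].
- apply: cacM; last exact: dpc.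
  by apply: cac_real; apply: acM; [exact: ac_cst|exact: ramp_pow_ac].
Qed.

Let g_cder x : 0 <= x -> cder g x (g1 x).
Proof.
by move=> x0; have := cderM (cder_real (chi_rder x0)) (AC1_cder psiAC x0).
Qed.

Let g_deriv x : 0 <= x -> hl_deriv g x = g1 x.
Proof. by move=> x0; exact: cder_deriv (g_cder x0). Qed.

Let g1_cder : {ae mu, forall x, 0 < x -> cder g1 x ((q x)%:C * g x - h x)}.
Proof.
apply: ae_mono (solution_cder sol) => x H x0.
have := cderD (cderM (cder_real (dchi_rder (ltW x0))) (AC1_cder psiAC (ltW x0)))
  (cderM (cder_real (chi_rder (ltW x0))) (H x0)).
congr (cder _ _ _); rewrite -/dpsi /h /g.
have -> : (- (6 * ramp x))%:C = - (6 * ramp x)%:C :> R[i].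
  by apply: complex_eqP; rewrite /= ?oppr0.
have -> : (6 * ramp x ^+ 2)%:C = (3 * ramp x ^+ 2)%:C + (3 * ramp x ^+ 2)%:C :> R[i].
  by apply: complex_eqP; rewrite /= ?addr0//; ring.
by ring.
Qed.

Let g_AC1 : AC1 g.
Proof.
split; first by move=> x x0; exact: cder_hl_derivable (g_cder x0).
move=> b b0; split; apply/cacP; first exact: g_cac.
apply: cac_ext (g1_cac b0) => x /andP[x0 _]; exact/esym/g_deriv.
Qed.

Let gE x : 1 <= x -> g x = psi x.
Proof. by move=> x1; rewrite /g /chi ramp_gt// expr0n subr0 mul1r. Qed.

Let g1E x : 1 <= x -> g1 x = dpsi x.
Proof. by move=> x1; rewrite /g1 /chi ramp_gt// !expr0n mulr0 subr0 mul0r add0r mul1r. Qed.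

Let hE x : 1 <= x -> h x = z * psi x.
Proof.
by move=> x1; rewrite /h gE// ramp_gt// expr0n !mulr0 !mul0r addr0 subr0.
Qed.

Let psiL2 : borel_L2 psi.
Proof. by case: weyl => _ _ p _; exact: hac_L2. Qed.

Let gL2 : borel_L2 g.
Proof.
apply: (borel_L2_tail g_cac ler01 psiL2) => x /ltW x1.
by rewrite gE// mul1r.
Qed.

Let hL2 : borel_L2 h.
Proof.
apply: (borel_L2_tail h_cac (sqr_ge0 (normc z)) psiL2) => x /ltW x1.
by rewrite hE// normcM exprMn.
Qed.

Let exprE : ae_half_line (fun x => h x = schrodinger_expr q g x).
Proof.
apply: ae_half_line_pos; apply: ae_mono g1_cder => x H x0.
rewrite /schrodinger_expr.
have -> : hl_deriv (hl_deriv g) x = (q x)%:C * g x - h x.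
  apply: cder_deriv (ltW x0) _.
  apply: (cder_local x0 (ltW x0) _ (H x0)) => y y0 _.
  exact/esym/g_deriv.
by ring.
Qed.

Let graph : graph_H q f g h.
Proof.
split => //; split.
- by exists g => //; exact: (aeW mu).
- exact: g_AC1.
- by rewrite /g /chi ramp_lt// subr0 expr1n subrr mul0r.
- move=> lc; case: weyl => _ _ _ /(_ lc); apply: cvg_trans; apply: near_eq_cvg.
  near=> x; have x1 : 1 < x by near: x; exact: nbhs_pinfty_gt.
  have x0 : 0 <= x by rewrite (le_trans _ (ltW x1)).
  by rewrite /wronskian (g_deriv x0) (g1E (ltW x1)) (gE (ltW x1)).
- exists h => //; apply: ae_mono exprE => x H x0; exact/esym/H.
Unshelve. all: by end_near.
Qed.

Let pairing x : R := Im (h x * (g x)^*).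

(* Symmetry of H, applied to g and itself. *)
Let pairing_integral : \int[mu]_(x in half_line) pairing x = 0.
Proof.
have [_ H] := sa.
have [_ /(_ _)] := H g h gL2 hL2.
move=> [|_ _ sym].
  by exists g, h; split => //; exact: (aeW mu).
have /(congr1 (fun c : R[i] => Im c)) := sym g h graph.
rewrite /L2_inner /= => E.
have ip : mu.-integrable half_line (EFin \o pairing) by exact: borel_L2_pairing_integrable.
have : \int[mu]_(x in half_line) Im (g x * (h x)^*) = - \int[mu]_(x in half_line) pairing x.
  have := @RintegralZl _ _ R mu half_line pairing (-1) (measurable_itv _) ip.
  rewrite mulN1r => <-; apply: eq_Rintegral => x _.
  by rewrite /pairing !ReIm; ring.
rewrite -E -/pairing => /eqP; rewrite -subr_eq0 opprK -mulr2n mulrn_eq0/=.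
by move/eqP.
Qed.

(** The derivative of the energy of [g] is integrated from 0, where [g] vanishes; from 1 on the
    energies of [g] and [psi] coincide. *)
Let energy_g x : 1 <= x -> energy psi dpsi x = - int0 pairing x.
Proof.
move=> x1; have x0 : 0 < x by rewrite (lt_le_trans ltr01).
have gc := g_cac x0; have g1c := g1_cac x0.
have ip : mu.-integrable `[0, x] (EFin \o (fun t => - pairing t)).
  by apply: integrable_ac; apply: acN; have [] := cacM (h_cac x0) (cacJ gc).
have ip' : mu.-integrable `[0, x] (EFin \o pairing).
  by apply: integrable_ac; have [] := cacM (h_cac x0) (cacJ gc).
have FT : {ae mu, forall t, 0 < t < x -> rder (energy g g1) t (- pairing t)}.
  apply: ae_mono g1_cder => t H /andP[t0 _].
  have [_] := cderM (H t0) (cderJ (g_cder (ltW t0))).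
  by apply: rder_ext => //; rewrite /pairing !ReIm /=; ring.
have acE : ac 0 x (energy g g1) by have [] := cacM g1c (cacJ gc).
have := ac_FTC (lexx 0) (ltW x0) (lexx x) acE ip FT.
have -> : energy g g1 0 = 0.
  have g0 : g 0 = 0 by rewrite /g /chi ramp_lt// subr0 expr1n subrr mul0r.
  by rewrite /energy g0 ImM ImJ ReJ /= oppr0 !mulr0 addr0.
have -> : energy g g1 x = energy psi dpsi x by rewrite /energy gE// g1E.
rewrite int0_0 !subr0 => ->.
rewrite -mulN1r -(int0Z (-1) ip')//; congr (int0 _ x).
by apply/funext => t; rewrite mulN1r.
Qed.

(** The pairing integrates to 0 over the half-line, so for x >= 1 the energy is its integral over
    ]x, +oo[, where it equals Im z |psi|^2. Below 1 the energy is at least its value at 1, being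
    nonincreasing. The condition at infinity enters through the membership of [g] in the domain. *)
Lemma weyl_energy_ge0 x : 0 <= x -> 0 <= energy psi dpsi x.
Proof.
have large X : 1 <= X -> 0 <= energy psi dpsi X.
  move=> X1; rewrite energy_g// oppr_ge0.
  have ip : mu.-integrable half_line (EFin \o pairing) by exact: borel_L2_pairing_integrable.
  have := @Rintegral_itvB R pairing (BLeft 0) +oo%O X ip.
  rewrite pairing_integral !bnd_simp (le_trans ler01 X1) => /(_ isT isT).
  rewrite sub0r => E; rewrite -oppr_ge0 /int0 E.
  apply: Rintegral_ge0 => t; rewrite /= in_itv/= andbT => Xt.
  have t1 : 1 <= t by rewrite (le_trans X1) ?ltW.
  rewrite /pairing hE// gE// -mulrA mulcJ ImM /= mulr0 add0r.
  by rewrite mulr_ge0 ?sqr_ge0// ltW.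
move=> x0; have [x1|x1] := leP 1 x; first exact: large.
apply: le_trans (large 1 (lexx 1)) _.
apply: (ac_nonincreasing (f := energy psi dpsi) x0 (ltW x1)).
  apply: (@acS _ 0 1) => //.
  by have [] := cacM (dpc ltr01) (cacJ (pc ltr01)).
apply: ae_mono (solution_cder sol) => t H /andP[xt _].
have t0 : 0 < t by exact: le_lt_trans xt.
exists (- (Im z * normc (psi t) ^+ 2)); first by rewrite oppr_le0 mulr_ge0 ?sqr_ge0// ltW.
have [_] := cderM (H t0) (cderJ (AC1_cder psiAC (ltW t0))).
by apply: rder_ext => //; rewrite normc_sqr !ReIm /=; ring.
Qed.

(** If psi vanished at 0, its energy would start at 0, fall strictly because psi is nonzero
    somewhere, and become negative. *)
Lemma weyl_neq0 : L1_loc q -> psi 0 != 0.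
Proof.
move=> qL; have [_ [c c0 pc0] _ _] := weyl.
have b0 : 0 < c + 1 by rewrite ltr_wpDl.
have [q0 _ qq] := qL _ b0.
have s := solution_sol2 sol b0 qq.
apply: contraTneq pc0 => p0; rewrite negbK; apply: contraT => pcn.
have : energy psi dpsi (c + 1) < energy psi dpsi 0.
  apply: (energy_lt z0 s (lexx 0) b0 (lexx _) _ pcn).
  by rewrite c0 lerDl ler01.
rewrite [X in _ < X -> _](_ : _ = 0); last first.
  by rewrite /energy p0 ImM ImJ ReJ /= oppr0 !mulr0 addr0.
move=> h0.
by have := lt_le_trans h0 (weyl_energy_ge0 (ltW b0)); rewrite ltxx.
Qed.

End WeylEnergy.

End Weyl.

(** * Local uniqueness *)

Section PolyApprox.
Context {R : realType}.
Implicit Types (F G : R[i] -> R[i]).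

Lemma horner_bounded (p : {poly R[i]}) (rho : R) : exists2 K, 0 <= K &
  forall z, normc z <= rho -> normc p.[z] <= K.
Proof.
elim/poly_ind: p => [|p c [K K0 HK]].
  by exists 0 => // z _; rewrite horner0 ComplexField.Normc.normc0.
exists (K * `|rho| + normc c); first by rewrite addr_ge0 ?mulr_ge0 ?normc_ge0.
move=> z zr; rewrite hornerMXaddC; apply: (le_trans (normcD _ _)); rewrite lerD2r normcM.
by apply: ler_pM; rewrite ?normc_ge0 ?HK// (le_trans zr)// ler_norm.
Qed.

Lemma poly_approxB F G : poly_approx F -> poly_approx G -> poly_approx (fun z => F z - G z).
Proof.
move=> aF aG rho e e0; have e2 : 0 < e / 2 by rewrite divr_gt0.
have [p Hp] := aF rho _ e2; have [r Hr] := aG rho _ e2.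
exists (p - r) => z zr; rewrite hornerD hornerN [e]splitr.
have -> : F z - G z - (p.[z] - r.[z]) = (F z - p.[z]) - (G z - r.[z]) by ring.
by apply: (le_trans (normcD _ _)); rewrite normcN; apply: lerD; [exact: Hp|exact: Hr].
Qed.

(** A first approximant [p1] only serves to bound F on the disk; [r] is chosen for that bound, and
    then [p] for the bound of [r]. *)
Lemma poly_approxM F G : poly_approx F -> poly_approx G -> poly_approx (fun z => F z * G z).
Proof.
move=> aF aG rho e e0; have e2 : 0 < e / 2 by rewrite divr_gt0.
have [p1 Hp1] := aF rho _ ltr01; have [K K0 HK] := horner_bounded p1 rho.
have K2 : 0 < K + 1 by rewrite ltr_wpDl.
have [r Hr] := aG rho _ (divr_gt0 e2 K2).
have [L L0 HL] := horner_bounded r rho.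
have L1 : 0 < L + 1 by rewrite ltr_wpDl.
have [p Hp] := aF rho _ (divr_gt0 e2 L1).
exists (p * r) => z zr; rewrite hornerM.
have -> : F z * G z - p.[z] * r.[z] = F z * (G z - r.[z]) + (F z - p.[z]) * r.[z] by ring.
apply: (le_trans (normcD _ _)); rewrite !normcM [e]splitr; apply: lerD.
  have FK : normc (F z) <= K + 1.
    have -> : F z = p1.[z] + (F z - p1.[z]) by ring.
    by apply: (le_trans (normcD _ _)); apply: lerD; [exact: HK|exact: Hp1].
  apply: (le_trans (ler_pM (normc_ge0 _) (normc_ge0 _) FK (Hr z zr))).
  by rewrite mulrC divfK// gt_eqF.
apply: (le_trans (ler_pM (normc_ge0 _) (normc_ge0 _) (Hp z zr) (HL z zr))).
by rewrite mulrAC ler_pdivrMr// ler_pM2l ?divr_gt0// lerDl ler01.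
Qed.

End PolyApprox.

(** * The square root in polar form *)

Section SquareRoot.
Context {R : realType}.
Implicit Types (z k : R[i]) (s t : R).

Lemma sqrt_up_sqr z : sqrt_up z ^+ 2 = z.
Proof. by rewrite /sqrt_up; case: ifP => _; rewrite ?sqrrN sqr_sqrtc. Qed.

Lemma Im_sqrt_up z : 0 <= Im (sqrt_up z).
Proof.
by rewrite /sqrt_up; case: ifP => // /negbT; rewrite -ltNge ImN oppr_ge0 => /ltW.
Qed.

Lemma normc_sqrt_up s t : normc (sqrt_up (expc (s +i* t))) = expR (s / 2).
Proof.
apply/eqP; rewrite -(eqrXn2 (n := 2)) ?normc_ge0 ?expR_ge0//.
by rewrite -normcX sqrt_up_sqr normc_expc -expRM_natr /= divfK.
Qed.

Lemma sqrt_up_unique z k : k ^+ 2 = z -> 0 < Im k -> sqrt_up z = k.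
Proof.
move=> kz k0; have : (sqrt_up z - k) * (sqrt_up z + k) = 0.
  by rewrite -subr_sqr sqrt_up_sqr kz subrr.
move/eqP; rewrite mulf_eq0 subr_eq0 addr_eq0 => /orP[/eqP //|/eqP E].
by have := Im_sqrt_up z; rewrite E ImN oppr_ge0 leNgt k0.
Qed.

Lemma sqrt_up_expc s t : 0 < t < pi -> sqrt_up (expc (s +i* t)) = expc ((s / 2) +i* (t / 2)).
Proof.
move=> /andP[t0 tpi]; apply: sqrt_up_unique.
  rewrite expr2 -expcD; congr expc.
  by apply: complex_eqP; rewrite !ReIm /= -splitr.
rewrite /expc /= mulr_gt0 ?expR_gt0// sin_gt0_pi// divr_gt0//=.
by rewrite (lt_trans _ tpi)// ltr_pdivrMr// ltr_pMr// ltr1n.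
Qed.

End SquareRoot.

(** * Dirichlet and Neumann solutions *)

Section FundamentalSystem.
Context {R : realType}.
Local Notation mu := (@lebesgue_measure R).
Variables (b : R) (q : R -> R).
Hypotheses (b0 : 0 < b) (iq : mu.-integrable `[0, b] (EFin \o q)).
Implicit Types (z k : R[i]) (x : R).
Local Notation ii := (0 +i* 1 : R[i]).

Definition phi z x := solY q 0 1 z x.
Definition dphi z x := solW q 0 1 z x.
Definition theta z x := solY q 1 0 z x.
Definition dtheta z x := solW q 1 0 z x.

Lemma phi_sol2 z : sol2 q z b (phi z) (dphi z).
Proof. exact: sol_sol2. Qed.

Lemma theta_sol2 z : sol2 q z b (theta z) (dtheta z).
Proof. exact: sol_sol2. Qed.

Lemma phi_0 z : phi z 0 = 0 /\ dphi z 0 = 1.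
Proof. exact: sol_0 b0 iq 0 1 z. Qed.

Lemma theta_0 z : theta z 0 = 1 /\ dtheta z 0 = 0.
Proof. exact: sol_0 b0 iq 1 0 z. Qed.

Lemma wronskian_theta_phi z x : 0 <= x <= b ->
  theta z x * dphi z x - dtheta z x * phi z x = 1.
Proof.
move=> xb; rewrite (wronskian_constant (theta_sol2 z) (phi_sol2 z) xb).
by have [-> ->] := phi_0 z; have [-> ->] := theta_0 z; rewrite mulr1 mulr0 subr0.
Qed.

Lemma solution_decomposition z y w x : sol2 q z b y w -> 0 <= x <= b ->
  y x = y 0 * theta z x + w 0 * phi z x.
Proof.
move=> s xb; have := wronskian_theta_phi z xb.
have := wronskian_constant s (phi_sol2 z) xb.
have := wronskian_constant (theta_sol2 z) s xb.
have [-> ->] := phi_0 z; have [-> ->] := theta_0 z.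
rewrite mulr1 !mulr0 mul1r mul0r !subr0 => h1 h2 h3.
by rewrite -h1 -h2 -[LHS]mulr1 -h3; ring.
Qed.

Let Q := int0 (fun t => `|q t|) b.

(** [sol_growth] with N = 1 for [phi] and N = |k| for [theta], whence the extra factor 1 / |k| for
    [phi]. *)
Lemma phi_theta_growth z k x : z = k ^+ 2 -> 0 <= Im k -> 0 < normc k -> 2 * Q <= normc k ->
  0 <= x <= b ->
  normc (phi z x) <= 2 / normc k * expR (Im k * x) /\
  normc (theta z x) <= 2 * expR (Im k * x).
Proof.
move=> zk k_up k0 kQ xb.
have nE : normc (ex (ii * k) x) = expR (- (Im k * x)).
  by rewrite normc_ex !ReIm /= mul0r mul1r sub0r mulNr.
have conv (u : R[i]) (B : R) : normc (ex (ii * k) x * u) <= B -> normc u <= B * expR (Im k * x).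
  by rewrite normcM nE expRN mulrC ler_pdivrMr ?expR_gt0.
have [p0 dp0] := phi_0 z; have [t0 dt0] := theta_0 z; split; apply: conv.
  have := sol_growth b0 iq zk k_up (phi_sol2 z) k0 kQ xb.
  by rewrite p0 dp0 ComplexField.Normc.normc0 ComplexField.Normc.normc1 mulr0 addr0 mulr1.
have := sol_growth b0 iq zk k_up (theta_sol2 z) k0 kQ xb.
rewrite t0 dt0 ComplexField.Normc.normc0 ComplexField.Normc.normc1 mulr1 add0r.
by rewrite mulfK// gt_eqF.
Qed.

Lemma quadratic_energy (k E W P : R[i]) :
  Re (k * ((E * W + E * W) * (ii * k * (E * P) + ii * k * (E * P))^*)) =
  4 * normc k ^+ 2 * (normc E ^+ 2 * Im (W * P^*)).
Proof.
case: k E W P => [k1 k2] [e1 e2] [w1 w2] [p1 p2]; rewrite !normc_sqr /=.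
ring.
Qed.

(* With U = E (phi' + i k phi) and V = E (phi' - i k phi), E = e^(i k x), one has
   4 |k|^2 |E|^2 phi' conj phi = i k (U + V) conj (U - V), where U is close to 0
   and V to 1. *)
Lemma phi_energy_le z k x (c0 : R) : z = k ^+ 2 -> 0 <= Im k -> 0 < normc k ->
  0 <= x <= b -> 0 < c0 -> c0 <= 1 -> c0 * normc k <= Re k ->
  expR (- (2 * Im k * x)) <= c0 / 32 -> 64 * Q <= c0 * normc k ->
  energy (phi z) (dphi z) x <= - (c0 / (8 * normc k) * expR (2 * (Im k * x))).
Proof.
move=> zk k_up k0 xb c00 c01 kRe small Qk.
have Q0 : 0 <= Q by apply: Rintegral_ge0.
have kQ : 2 * Q <= normc k.
  have : c0 * normc k <= normc k by rewrite ler_piMl ?normc_ge0.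
  by move: (c0 * normc k) Qk => u; move: (normc k) => n; lra.
have [p0 dp0] := phi_0 z.
have hU := sol_asymptotic_U b0 iq zk k_up (phi_sol2 z) k0 kQ xb.
have hV := sol_asymptotic_V b0 iq zk k_up (phi_sol2 z) k0 kQ xb.
rewrite p0 dp0 ComplexField.Normc.normc0 ComplexField.Normc.normc1 mulr0 addr0 !mulr1 in hU.
rewrite p0 dp0 ComplexField.Normc.normc0 ComplexField.Normc.normc1 !mulr0 addr0 subr0 mulr1 in hV.
have nE : normc (ex (ii * k) x) = expR (- (Im k * x)).
  by rewrite normc_ex !ReIm /= mul0r mul1r sub0r mulNr.
have Qs : 2 / normc k * Q <= c0 / 32.
  rewrite mulrAC ler_pdivrMr// mulrAC ler_pdivlMr//.
  by move: (c0 * normc k) Qk => u; lra.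
move: nE hU hV; set E := ex _ x; set W := dphi z x; set P := phi z x => nE hU hV.
set U := E * (W + _) in hU; set V := E * (W - _) in hV.
pose r := V - 1.
rewrite -/Q in hU hV; move: (2 / normc k * Q) Qs hU hV => Qk' Qs hU hV.
have Us : normc U <= c0 / 16 by apply: (le_trans hU); lra.
have rs : normc r <= c0 / 16 by apply: (le_trans hV); lra.
(* With V = 1 + r the product (U + V) conj (U - V) is -1 + err. The constants 32 and 64 of the
   hypotheses keep |err| below c0 / 2, so that - Re k <= - c0 |k| prevails. *)
pose err := (U - r)^* - (U + r) + (U + r) * (U - r)^*.
have pr : normc (U + r) <= c0 / 8 by apply: (le_trans (normcD _ _)); lra.
have mr : normc (U - r)^* <= c0 / 8.
  by rewrite normcJ; apply: (le_trans (normcD _ _)); rewrite normcN; lra.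
have errs : normc err <= c0 / 2.
  apply: (le_trans (normcD _ _)); rewrite normcM.
  have h1 : normc ((U - r)^* - (U + r)) <= c0 / 8 + c0 / 8.
    by apply: (le_trans (normcD _ _)); rewrite normcN; exact: lerD.
  have h2 : normc (U + r) * normc (U - r)^* <= c0 / 8 * 1.
    apply: ler_pM; rewrite ?normc_ge0//; apply: (le_trans mr); lra.
  by lra.
have key : 4 * normc k ^+ 2 * (normc E ^+ 2 * Im (W * P^*)) = - Re k + Re (k * err).
  have UP : U + V = E * W + E * W by rewrite /U /V; ring.
  have UM : U - V = ii * k * (E * P) + ii * k * (E * P) by rewrite /U /V; ring.
  have EQ : (U + V) * (U - V)^* = -1 + err.
    have -> : V = 1 + r by rewrite /r; ring.
    by rewrite /err !rmorphB !rmorphD rmorph1 /=; ring.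
  have : Re (k * ((U + V) * (U - V)^*)) = - Re k + Re (k * err).
    by rewrite EQ mulrDr mulrN1 ReD ReN.
  by move=> <-; rewrite UP UM quadratic_energy.
have E2 : normc E ^+ 2 = (expR (2 * (Im k * x)))^-1.
  by rewrite nE -expRM_natr -expRN; congr expR; ring.
have Rk : Re (k * err) <= normc k * (c0 / 2).
  apply: (le_trans (ler_norm _)); apply: (le_trans (Re_le_normc _)).
  by rewrite normcM ler_wpM2l ?normc_ge0.
have main : 4 * normc k ^+ 2 * (normc E ^+ 2 * Im (W * P^*)) <= - (c0 * normc k / 2).
  rewrite key; move: kRe Rk; have -> : normc k * (c0 / 2) = c0 * normc k / 2 by ring.
  by move: (Re _) (Re _) (c0 * normc k) => u v w; lra.
rewrite -[energy _ _ _]/(Im (W * P^*)) -lerN2 opprK.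
move: main; rewrite E2; move: (expR (2 * (Im k * x))) (expR_gt0 (2 * (Im k * x))) => X X0.
rewrite -lerN2 opprK => main.
have k8 : 0 < 4 * normc k ^+ 2 by rewrite mulr_gt0// exprn_gt0.
have : c0 * normc k / 2 / (4 * normc k ^+ 2) * X <= - Im (W * P^*).
  rewrite -ler_pdivlMr// ler_pdivrMr//.
  by have -> : - Im (W * P^*) / X * (4 * normc k ^+ 2) = - (4 * normc k ^+ 2 * (X^-1 * Im (W * P^*))) by ring.
apply: le_trans.
have -> : c0 * normc k / 2 / (4 * normc k ^+ 2) = c0 / (8 * normc k).
  by field; rewrite gt_eqF.
by [].
Qed.

(** If [phi] vanished at [x] as it does at 0, its energy would be 0 at both ends, so by strict
    decrease [phi] would vanish in between, together with its derivative, against the Wronskian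
    being 1. *)
Lemma phi_neq0 z x : 0 < Im z -> 0 < x <= b -> phi z x != 0.
Proof.
move=> z0 /andP[x0 xb]; apply/negP => /eqP px.
have [p0 dp0] := phi_0 z.
have [yc wc dy dw] := phi_sol2 z.
have allz c : 0 <= c <= x -> phi z c = 0.
  move=> cx; apply/eqP; apply: contraT => pcn.
  have := energy_lt z0 (phi_sol2 z) (lexx 0) x0 xb cx pcn.
  by rewrite /energy px p0 rmorph0 !mulr0 ltxx.
pose t := x / 2; have t0 : 0 < t by rewrite divr_gt0.
have tx : t < x by rewrite ltr_pdivrMr// ltr_pMr// ltr1n.
have tb : 0 < t < b by rewrite t0 (lt_le_trans tx).
have h : cder (fun=> 0 : R[i]) t (dphi z t).
  apply: (cder_local (r := t) t0 (ltW t0) _ (dy t tb)) => y y0 yt.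
  by rewrite allz// y0/=; move: yt; rewrite ltr_norml /t => /andP[_ ?]; lra.
have tb' : 0 <= t <= b by case/andP: tb => /ltW -> /ltW.
have := wronskian_theta_phi z tb'.
rewrite allz ?(ltW t0) ?(ltW tx)// -(cder_deriv (ltW t0) h) (cder_deriv (ltW t0) (cder_cst 0 t)).
by rewrite !mulr0 subrr => /eqP; rewrite eq_sym oner_eq0.
Qed.

End FundamentalSystem.

(** * Growth and decay of the function F *)

Section Uniqueness.
Context {R : realType}.
Local Notation mu := (@lebesgue_measure R).
Implicit Types (q p : R -> R) (z k : R[i]) (y w : R -> R[i]) (b x s : R).

(** Division by [psi 0], which [weyl_neq0] permits, turns the value of [m] into the initial slope;
    the energy is multiplied by the positive number |psi 0|^(-2). *)
Lemma normalized_weyl_solution q p f (m : R[i] -> R[i]) z b : self_adjoint_H q f ->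
  is_m_function q f m -> L1_loc q -> 0 < Im z -> 0 < b ->
  {ae mu, forall x, x \in `[0, b] -> q x = p x} ->
  exists y w, [/\ sol2 p z b y w, y 0 = 1, w 0 = m z & forall x, 0 <= x -> 0 <= energy y w x].
Proof.
move=> sa mE qL z0 b0 qp; have [psi weyl mz] := mE z (lt0r_neq0 z0).
have p0 := weyl_neq0 sa weyl z0 qL; have [sol _ _ _] := weyl.
exists (fun x => (psi 0)^-1 * psi x), (fun x => (psi 0)^-1 * hl_deriv psi x); split.
- by apply: sol2Z; exact: solution_sol2 sol b0 qp.
- by rewrite mulVf.
- by rewrite mz mulrC.
- move=> x x0; rewrite /energy rmorphM /= mulrACA mulcJ ImM /= mul0r addr0.
  by rewrite mulr_ge0 ?sqr_ge0//; exact: weyl_energy_ge0 sa weyl z0 x x0.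
Qed.

(** With X = e^(Im k x), the energy of [phi] is at most - c0 X^2 / (8 |k|) and |phi| <= 2 X / |k|;
    [green_bound] divides the second by the first, which gives 16 / (c0 X). *)
Lemma energy_ge0_bound b p z k x (c0 : R) y w : 0 < b -> mu.-integrable `[0, b] (EFin \o p) ->
  z = k ^+ 2 -> 0 <= Im k -> 0 < normc k -> 0 <= x <= b -> 0 < c0 -> c0 <= 1 ->
  c0 * normc k <= Re k -> expR (- (2 * Im k * x)) <= c0 / 32 ->
  64 * int0 (fun t => `|p t|) b <= c0 * normc k ->
  sol2 p z b y w -> y 0 = 1 -> 0 <= energy y w x ->
  normc (y x) <= 16 / c0 * expR (- (Im k * x)).
Proof.
move=> b0 ip zk k_up k0 xb c00 c01 kRe small pk s y0 yge.
have Q0 : 0 <= int0 (fun t => `|p t|) b by apply: Rintegral_ge0.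
have kQ : 2 * int0 (fun t => `|p t|) b <= normc k.
  have : c0 * normc k <= normc k by rewrite ler_piMl ?normc_ge0.
  by move: (c0 * normc k) pk => u; move: (normc k) (int0 _ _) Q0 => n Q; lra.
have [phi_le _] := phi_theta_growth b0 ip zk k_up k0 kQ xb.
have en := phi_energy_le b0 ip zk k_up k0 xb c00 c01 kRe small pk.
have [p0 dp0] := phi_0 b0 ip z.
have X2 : expR (2 * (Im k * x)) = expR (Im k * x) ^+ 2 by rewrite -expRM_natl.
have W : dphi p z 0 * y 0 - phi p z 0 * w 0 = 1 by rewrite p0 dp0 y0 mul0r subr0 mulr1.
rewrite expRN; move: (expR (Im k * x)) (expR_gt0 (Im k * x)) X2 phi_le => X X0 X2 phi_le.
rewrite X2 in en.
have e8 : 0 < c0 / (8 * normc k) * X ^+ 2 by rewrite !mulr_gt0 ?invr_gt0 ?mulr_gt0.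
have en0 : energy (phi p z) (dphi p z) x <= 0 by apply: (le_trans en); rewrite oppr_le0 ltW.
have G := le_trans (green_bound (phi_sol2 b0 ip z) s xb W en0 yge) phi_le.
have : c0 / (8 * normc k) * X ^+ 2 * normc (y x) <= 2 / normc k * X.
  by apply: le_trans G; rewrite ler_wpM2r ?normc_ge0// ler0_norm// lerNr.
rewrite -ler_pdivlMl// => H; apply: (le_trans H).
rewrite le_eqVlt; apply/orP; left; apply/eqP; field.
by rewrite !gt_eqF.
Qed.

(** The entire function F of the overview, at fixed [x]. *)
Definition cross p1 p2 x z := phi p1 z x * theta p2 z x - phi p2 z x * theta p1 z x.

Section Cross.
Variables (b x : R) (p1 p2 : R -> R).
Hypotheses (b0 : 0 < b) (ip1 : mu.-integrable `[0, b] (EFin \o p1))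
  (ip2 : mu.-integrable `[0, b] (EFin \o p2)) (x0 : 0 < x) (xb : x <= b).

Let xb' : 0 <= x <= b. Proof. by rewrite ltW. Qed.

Let Q1 := int0 (fun t => `|p1 t|) b.
Let Q2 := int0 (fun t => `|p2 t|) b.

Let Q10 : 0 <= Q1. Proof. exact: Rintegral_ge0. Qed.
Let Q20 : 0 <= Q2. Proof. exact: Rintegral_ge0. Qed.

Lemma cross_poly_approx : poly_approx (cross p1 p2 x).
Proof.
exact (poly_approxB
  (poly_approxM (solY_poly_approx b0 ip1 0 1 xb') (solY_poly_approx b0 ip2 1 0 xb'))
  (poly_approxM (solY_poly_approx b0 ip2 0 1 xb') (solY_poly_approx b0 ip1 1 0 xb'))).
Qed.

Lemma normc_crossJ z : normc (cross p1 p2 x z^*) = normc (cross p1 p2 x z).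
Proof.
rewrite /cross /phi /theta (solY_conj b0 ip1 0 1 z xb') (solY_conj b0 ip1 1 0 z xb').
rewrite (solY_conj b0 ip2 0 1 z xb') (solY_conj b0 ip2 1 0 z xb').
move: (solY _ _ _ _ _) (solY _ _ _ _ _) (solY _ _ _ _ _) (solY _ _ _ _ _) => u v w t.
by rewrite -[RHS]normcJ rmorphB !rmorphM.
Qed.

Lemma cross_growth s t : 2 * (Q1 + Q2) <= expR (s / 2) -> 0 <= s ->
  normc (cross p1 p2 x (expc (s +i* t))) <= 8 * expR (2 * x * expR (s / 2)).
Proof.
move=> Qs s0; set z := expc _.
have zk : z = sqrt_up z ^+ 2 by rewrite sqrt_up_sqr.
have k_up := Im_sqrt_up z.
have nk : normc (sqrt_up z) = expR (s / 2) by exact: normc_sqrt_up.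
have k1 : 1 <= normc (sqrt_up z) by rewrite nk -[leLHS]expR0 ler_expR divr_ge0.
have Ik : Im (sqrt_up z) <= expR (s / 2).
  by rewrite -nk; apply: (le_trans (ler_norm _)); exact: Im_le_normc.
have k0 : 0 < normc (sqrt_up z) by exact: lt_le_trans ltr01 k1.
have [|h1 h2] := phi_theta_growth b0 ip1 zk k_up k0 _ xb'.
  by rewrite nk; apply: le_trans Qs; rewrite ler_pM2l// lerDl.
have [|h3 h4] := phi_theta_growth b0 ip2 zk k_up k0 _ xb'.
  by rewrite nk; apply: le_trans Qs; rewrite ler_pM2l// lerDr.
pose X := expR (x * expR (s / 2)).
have kX : expR (Im (sqrt_up z) * x) <= X by rewrite ler_expR mulrC ler_wpM2l// ltW.
have B u : u <= 2 / normc (sqrt_up z) * expR (Im (sqrt_up z) * x) -> u <= 2 * X.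
  move=> H; apply: (le_trans H); apply: ler_pM kX; rewrite ?divr_ge0 ?expR_ge0 ?normc_ge0//.
  by rewrite ler_pdivrMr// ler_pMr.
have C u : u <= 2 * expR (Im (sqrt_up z) * x) -> u <= 2 * X.
  by move=> H; apply: (le_trans H); rewrite ler_pM2l.
have -> : expR (2 * x * expR (s / 2)) = X ^+ 2 by rewrite -expRM_natl mulrA.
have prod u v : 0 <= u -> 0 <= v -> u <= 2 * X -> v <= 2 * X -> u * v <= 4 * X ^+ 2.
  move=> u0 v0 uX vX; apply: (le_trans (ler_pM u0 v0 uX vX)).
  by rewrite le_eqVlt; apply/orP; left; apply/eqP; ring.
rewrite /cross; apply: (le_trans (normcD _ _)); rewrite normcN.
have -> : 8 * X ^+ 2 = 4 * X ^+ 2 + 4 * X ^+ 2 by ring.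
apply: lerD; rewrite normcM.
  exact: (prod _ _ (normc_ge0 _) (normc_ge0 _) (B _ h1) (C _ h4)).
exact: (prod _ _ (normc_ge0 _) (normc_ge0 _) (B _ h3) (C _ h2)).
Qed.

(* For the Weyl solutions y_j = theta_j + m_j phi_j one has
   cross = phi1 y2 - phi2 y1 + (m1 - m2) phi1 phi2. *)
Lemma cross_ray_bound q1 q2 f1 f2 (m1 m2 : R[i] -> R[i]) (th K s : R) :
  self_adjoint_H q1 f1 -> self_adjoint_H q2 f2 ->
  is_m_function q1 f1 m1 -> is_m_function q2 f2 m2 -> L1_loc q1 -> L1_loc q2 ->
  {ae mu, forall x, x \in `[0, b] -> q1 x = p1 x} ->
  {ae mu, forall x, x \in `[0, b] -> q2 x = p2 x} ->
  0 < th < pi -> 0 <= s ->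
  16 / (cos (th / 2) * sin (th / 2) * x) <= expR (s / 2) ->
  64 * (Q1 + Q2) <= cos (th / 2) * expR (s / 2) ->
  normc (m1 (expc (s +i* th)) - m2 (expc (s +i* th))) <=
    K * expR (- (2 * Im (sqrt_up (expc (s +i* th))) * b)) ->
  normc (cross p1 p2 x (expc (s +i* th))) <=
    (64 / cos (th / 2) + 4 * `|K|) * expR (- (s / 2)).
Proof.
move=> sa1 sa2 mE1 mE2 qL1 qL2 qp1 qp2 th0 s0 hs hQ.
have [c00 c10] : 0 < cos (th / 2) /\ 0 < sin (th / 2).
  case/andP: th0 => t0 tpi; split.
    by rewrite cos_gt0_pihalf// ltr_pM2r ?invr_gt0// tpi andbT (lt_trans _ (divr_gt0 t0 _))// oppr_lt0 divr_gt0// pi_gt0.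
  by rewrite sin_gt0_pi// divr_gt0//= (lt_trans _ tpi)// ltr_pdivrMr// ltr_pMr// ltr1n.
have z0 : 0 < Im (expc (s +i* th)) by rewrite /expc /= mulr_gt0 ?expR_gt0// sin_gt0_pi.
have := sqrt_up_expc s th0.
have zk := esym (sqrt_up_sqr (expc (s +i* th))); have nk := normc_sqrt_up s th.
move: z0 zk nk; set z := expc (s +i* th); set k := sqrt_up z => z0 zk nk kE.
have Rk : Re k = cos (th / 2) * normc k by rewrite nk kE [RHS]mulrC.
have Ik : Im k = sin (th / 2) * normc k by rewrite nk kE [RHS]mulrC.
have k1 : 1 <= normc k by rewrite nk -[leLHS]expR0 ler_expR divr_ge0.
have k0 : 0 < normc k by exact: lt_le_trans ltr01 k1.
have k_up : 0 <= Im k by rewrite Ik mulr_ge0// ltW.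
rewrite -nk in hs hQ; rewrite (expRN (s / 2)) -nk => mK.
move: (cos _) (sin _) c00 c10 (cos_le1 (th / 2)) hs hQ Rk Ik => c0 c1 c00 c10 c01 hs hQ Rk Ik.
(* The lower bound on |k| gives 2 Im k x = 2 c1 |k| x >= 32 / c0; then e^u >= u. *)
have small : expR (- (2 * Im k * x)) <= c0 / 32.
  have u0 : 0 < 32 / c0 by rewrite divr_gt0.
  rewrite expRN -[leRHS]invf_div lef_pV2 ?posrE ?expR_gt0//.
  apply: le_trans (expR_ge1Dx _); apply: (@le_trans _ _ (2 * Im k * x)); last by rewrite lerDr.
  move: hs; rewrite ler_pdivrMr ?mulr_gt0// => hs.
  rewrite ler_pdivrMr// Ik.
  have -> : 2 * (c1 * normc k) * x * c0 = 2 * (normc k * (c0 * c1 * x)) by ring.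
  by move: hs; move: (normc k * _) => u; lra.
have hQ1 : 64 * Q1 <= c0 * normc k by apply: le_trans hQ; rewrite ler_pM2l// lerDl.
have hQ2 : 64 * Q2 <= c0 * normc k by apply: le_trans hQ; rewrite ler_pM2l// lerDr.
have kRe : c0 * normc k <= Re k by rewrite Rk.
have phiB p (ip : mu.-integrable `[0, b] (EFin \o p)) :
    64 * int0 (fun t => `|p t|) b <= c0 * normc k ->
    normc (phi p z x) <= 2 / normc k * expR (Im k * x).
  move=> pk; apply: (phi_theta_growth b0 ip zk k_up k0 _ xb').1.
  have Q0 : 0 <= int0 (fun t => `|p t|) b by apply: Rintegral_ge0.
  have : c0 * normc k <= normc k by rewrite ler_piMl ?normc_ge0.
  by move: (c0 * normc k) pk => u; move: (normc k) (int0 _ _) Q0 => n Q; lra.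
have ph1 := phiB _ ip1 hQ1; have ph2 := phiB _ ip2 hQ2.
have [y1 [w1 [s1 y10 w10 e1]]] := normalized_weyl_solution sa1 mE1 qL1 z0 b0 qp1.
have [y2 [w2 [s2 y20 w20 e2]]] := normalized_weyl_solution sa2 mE2 qL2 z0 b0 qp2.
have yb1 := energy_ge0_bound b0 ip1 zk k_up k0 xb' c00 c01 kRe small hQ1 s1 y10 (e1 x (ltW x0)).
have yb2 := energy_ge0_bound b0 ip2 zk k_up k0 xb' c00 c01 kRe small hQ2 s2 y20 (e2 x (ltW x0)).
have d1 := solution_decomposition b0 ip1 s1 xb'.
have d2 := solution_decomposition b0 ip2 s2 xb'.
rewrite y10 w10 mul1r in d1; rewrite y20 w20 mul1r in d2.
have -> : cross p1 p2 x z = phi p1 z x * y2 x - phi p2 z x * y1 x +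
    (m1 z - m2 z) * (phi p1 z x * phi p2 z x).
  rewrite d1 d2 /cross.
  by move: (theta p1 z x) (theta p2 z x) (phi p1 z x) (phi p2 z x) (m1 z) (m2 z) => *; ring.
have PY (u v : R[i]) : normc u <= 2 / normc k * expR (Im k * x) ->
    normc v <= 16 / c0 * expR (- (Im k * x)) -> normc (u * v) <= 32 / c0 / normc k.
  move=> Hu Hv; rewrite normcM.
  apply: (le_trans (ler_pM (normc_ge0 _) (normc_ge0 _) Hu Hv)).
  rewrite expRN le_eqVlt; apply/orP; left; apply/eqP; field.
  by rewrite !gt_eqF ?expR_gt0.
have PP : normc (phi p1 z x * phi p2 z x) <= 4 / normc k * expR (2 * Im k * x).
  rewrite normcM; apply: (le_trans (ler_pM (normc_ge0 _) (normc_ge0 _) ph1 ph2)).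
  have -> : 2 * Im k * x = Im k * x + Im k * x by ring.
  rewrite expRD; move: (expR _) (expR_gt0 (Im k * x)) => X X0.
  have -> : 2 / normc k * X * (2 / normc k * X) = 4 / normc k * (X * X) * (normc k)^-1.
    by field; rewrite gt_eqF.
  have P0 : 0 <= 4 / normc k * (X * X) by rewrite ltW// !mulr_gt0 ?invr_gt0.
  by rewrite ler_piMr// invf_le1.
have mP : normc ((m1 z - m2 z) * (phi p1 z x * phi p2 z x)) <= 4 * `|K| / normc k.
  rewrite normcM; apply: (le_trans (ler_pM (normc_ge0 _) (normc_ge0 _) mK PP)).
  have -> : K * expR (- (2 * Im k * b)) * (4 / normc k * expR (2 * Im k * x)) =
      4 / normc k * (K * (expR (2 * Im k * x - 2 * Im k * b))).
    by rewrite expRD; ring.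
  have -> : 4 * `|K| / normc k = 4 / normc k * (`|K| * 1) by ring.
  rewrite ler_wpM2l ?divr_ge0 ?normc_ge0//.
  apply: (@le_trans _ _ (`|K| * expR (2 * Im k * x - 2 * Im k * b))).
    by rewrite ler_wpM2r ?expR_ge0// ler_norm.
  (* As x <= b, the decay of m1 - m2 at rate 2 Im k b absorbs the growth of phi1 phi2. *)
  by rewrite ler_wpM2l// -[leRHS]expR0 ler_expR subr_le0 ler_wpM2l ?mulr_ge0.
apply: (le_trans (normcD _ _)); rewrite [leRHS]mulrDl; apply: lerD; last exact: mP.
have -> : 64 / c0 / normc k = 32 / c0 / normc k + 32 / c0 / normc k.
  by field; rewrite !gt_eqF.
apply: (le_trans (normcD _ _)); rewrite normcN; apply: lerD; exact: PY.
Qed.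

End Cross.
End Uniqueness.

(** * Equality of the potentials *)

Section LocalUniqueness.
Context {R : realType}.
Local Notation mu := (@lebesgue_measure R).

Lemma cross_eq0 (b : R) (p1 p2 q1 q2 : R -> R) (f1 f2 : R -> R[i])
    (m1 m2 : R[i] -> R[i]) (eps K x : R) :
  0 < b -> mu.-integrable `[0, b] (EFin \o p1) -> mu.-integrable `[0, b] (EFin \o p2) ->
  self_adjoint_H q1 f1 -> self_adjoint_H q2 f2 ->
  is_m_function q1 f1 m1 -> is_m_function q2 f2 m2 -> L1_loc q1 -> L1_loc q2 ->
  {ae mu, forall x, x \in `[0, b] -> q1 x = p1 x} ->
  {ae mu, forall x, x \in `[0, b] -> q2 x = p2 x} ->
  0 < eps -> eps < pi / 2 ->
  (\forall r \near +oo, normc (m1 (ray (pi - eps) r) - m2 (ray (pi - eps) r)) <=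
    K * expR (- (2 * Im (sqrt_up (ray (pi - eps) r)) * b))) ->
  0 < x <= b -> forall z, cross p1 p2 x z = 0.
Proof.
move=> b0 ip1 ip2 sa1 sa2 mE1 mE2 qL1 qL2 qp1 qp2 e0 epi [M [_ HM]] /andP[x0 xb].
pose th := pi - eps; pose Q := int0 (fun t => `|p1 t|) b + int0 (fun t => `|p2 t|) b.
have Q0 : 0 <= Q by rewrite addr_ge0//; exact: Rintegral_ge0.
have th0 : 0 < th < pi by rewrite /th; lra.
have c0 : 0 < cos (th / 2) by rewrite cos_gt0_pihalf//; case/andP: th0; lra.
have c1 : 0 < sin (th / 2) by rewrite sin_gt0_pi//; case/andP: th0; lra.
pose L1 := 16 / (cos (th / 2) * sin (th / 2) * x); pose L2 := 64 * Q / cos (th / 2).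
have L10 : 0 <= L1 by rewrite divr_ge0// !mulr_ge0// ltW.
have L20 : 0 <= L2 by rewrite divr_ge0 ?mulr_ge0// ltW.
have Q2 : 64 * Q <= L2.
  by rewrite ler_pdivlMr// ler_piMr ?cos_le1// mulr_ge0.
(* Since e^u >= 1 + u, every s >= s0 has e^(s/2) above [L1] and [L2], and e^s above [M]. *)
pose s0 := 2 * (L1 + L2) + `|M|.
have large s : s0 <= s -> [/\ 0 <= s, L1 <= expR (s / 2), L2 <= expR (s / 2) & M < expR s].
  rewrite /s0 => hs; have := expR_ge1Dx (s / 2); have := expR_ge1Dx s.
  have := ler_norm M; have := normr_ge0 M.
  move: `|M| (expR s) (expR (s / 2)) hs L10 L20 => m X Y hs *.
  by split; lra.
have s00 : 0 <= s0 by rewrite addr_ge0// mulr_ge0// addr_ge0.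
have x20 : 0 <= 2 * x by rewrite mulr_ge0// ltW.
apply: (entire_eq0 (cross_poly_approx b0 ip1 ip2 x0 xb) (normc_crossJ b0 ip1 ip2 x0 xb)
  e0 epi (ltr0Sn R 7) x20 s00) => [s t /large[sge0 _ sL _]|s /large[sge0 h1 h2 hM]].
  apply: (cross_growth b0 ip1 ip2 x0 xb t _ sge0).
  by apply: le_trans sL; apply: le_trans Q2; rewrite ler_wpM2r// ler_nat.
apply: (cross_ray_bound b0 ip1 ip2 x0 xb sa1 sa2 mE1 mE2 qL1 qL2 qp1 qp2 th0 sge0 h1).
  by rewrite [leRHS]mulrC -ler_pdivrMr.
(* [expc (s +i* th)] is [ray th (expR s)] by computation, so the hypothesis is used with r = e^s. *)
exact: HM.
Qed.

(** Comparing squares avoids deciding between phi1 = phi2 and phi1 = - phi2. The equality of squares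
    and its first derivative hold on all of ]0, b[; one more differentiation, possible a.e., brings
    in the potentials. *)
Lemma cross_eq0_potential (b : R) (p1 p2 : R -> R) :
  0 < b -> mu.-integrable `[0, b] (EFin \o p1) -> mu.-integrable `[0, b] (EFin \o p2) ->
  (forall x, 0 < x <= b -> cross p1 p2 x (0 +i* 1) = 0) ->
  {ae mu, forall x, 0 < x < b -> p1 x = p2 x}.
Proof.
move=> b0 ip1 ip2 cr0; set z := 0 +i* 1 in cr0.
have z0 : 0 < Im z by rewrite ltr01.
have [_ _ dphi1 ddphi1] := phi_sol2 b0 ip1 z; have [_ _ dphi2 ddphi2] := phi_sol2 b0 ip2 z.
have [_ _ dtheta1 _] := theta_sol2 b0 ip1 z; have [_ _ dtheta2 _] := theta_sol2 b0 ip2 z.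
have vanish (g : R -> R[i]) x d : 0 < x < b -> (forall y, 0 < y < b -> g y = 0) ->
    cder g x d -> d = 0.
  move=> /andP[x0 xb] g0 gd; rewrite -(cder_deriv (ltW x0) gd).
  apply: cder_deriv (ltW x0) _.
  have r0 : 0 < Num.min x (b - x) by rewrite lt_min x0 subr_gt0.
  apply: (cder_local r0 (ltW x0) _ (cder_cst 0 x)) => y _.
  rewrite lt_min !ltr_norml => /andP[/andP[h1 _] /andP[_ h2]].
  by rewrite g0//; apply/andP; split; lra.
have cr y : 0 < y < b -> cross p1 p2 y z = 0.
  by case/andP=> y0 yb; apply: cr0; rewrite y0 ltW.
have sq x : 0 < x < b -> phi p1 z x * phi p1 z x - phi p2 z x * phi p2 z x = 0.
  move=> xb; have xb' : 0 <= x <= b by case/andP: xb => /ltW -> /ltW.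
  have A := cr x xb.
  have B := vanish _ x _ xb cr
    (cderB (cderM (dphi1 x xb) (dtheta2 x xb)) (cderM (dphi2 x xb) (dtheta1 x xb))).
  have W1 := wronskian_theta_phi b0 ip1 z xb'; have W2 := wronskian_theta_phi b0 ip2 z xb'.
  move: A B W1 W2; rewrite /cross.
  move: (phi p1 z x) (phi p2 z x) (dphi p1 z x) (dphi p2 z x) => u1 u2 v1 v2.
  move: (theta p1 z x) (theta p2 z x) (dtheta p1 z x) (dtheta p2 z x) => t1 t2 s1 s2 A B W1 W2.
  (* Each square is multiplied by the Wronskian of the other potential, which is 1; the result is a
     combination of F and its derivative. *)
  have -> : u1 * u1 - u2 * u2 = u1 * u1 * (t2 * v2 - s2 * u2) - u2 * u2 * (t1 * v1 - s1 * u1).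
    by rewrite W1 W2 !mulr1.
  have -> : u1 * u1 * (t2 * v2 - s2 * u2) - u2 * u2 * (t1 * v1 - s1 * u1) =
      (u1 * v2 + u2 * v1) * (u1 * t2 - u2 * t1) -
      u1 * u2 * (v1 * t2 + u1 * s2 - (v2 * t1 + u2 * s1)) by ring.
  by rewrite A B !mulr0 subr0.
have dsq x : 0 < x < b -> phi p1 z x * dphi p1 z x - phi p2 z x * dphi p2 z x = 0.
  move=> xb; have := vanish _ x _ xb sq
    (cderB (cderM (dphi1 x xb) (dphi1 x xb)) (cderM (dphi2 x xb) (dphi2 x xb))).
  move: (phi p1 z x) (phi p2 z x) (dphi p1 z x) (dphi p2 z x) => u1 u2 v1 v2 E.
  apply/eqP; have := mulrn_eq0 (u1 * v1 - u2 * v2) 2; rewrite /= => <-.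
  by rewrite mulr2n -[eqbRHS]E; apply/eqP; ring.
apply: ae_mono2 ddphi1 ddphi2 => x h1 h2 xb.
have V := vanish _ x _ xb dsq
  (cderB (cderM (dphi1 x xb) (h1 xb)) (cderM (dphi2 x xb) (h2 xb))).
have xb' : 0 < x <= b by case/andP: xb => -> /ltW.
have := phi_neq0 b0 ip1 z0 xb'; have T := dsq x xb; have S := sq x xb.
move: S T V.
move: (phi p1 z x) (phi p2 z x) (dphi p1 z x) (dphi p2 z x) => u1 u2 v1 v2 S T V u0.
(* [S] is phi1^2 = phi2^2, [T] is half its derivative, and [V] is the derivative of [T]. The fourth
   power allows phi2 to be eliminated in favour of phi1, which does not vanish. *)
have : ((p1 x)%:C - (p2 x)%:C) * u1 ^+ 4 = 0.
  have -> : ((p1 x)%:C - (p2 x)%:C) * u1 ^+ 4 =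
      u1 ^+ 2 * (v1 * v1 + u1 * (((p1 x)%:C - z) * u1) - (v2 * v2 + u2 * (((p2 x)%:C - z) * u2)))
      - (u1 * v1 - u2 * v2) * (u1 * v1 + u2 * v2)
      + (u1 * u1 - u2 * u2) * (v2 ^+ 2 - ((p2 x)%:C - z) * u1 ^+ 2) by ring.
  by rewrite S T V !mulr0 !mul0r subr0 addr0.
move/eqP; rewrite mulf_eq0 expf_eq0 /= (negbTE u0) orbF subr_eq0.
by move=> /eqP [].
Qed.

End LocalUniqueness.

Theorem theorem1p1 (R : realType) (q1 q2 : R -> R) (f1 f2 : R -> R[i])
    (m1 m2 : R[i] -> R[i]) (a eps : R)
    (q1_L1 : L1_loc q1) (q2_L1 : L1_loc q2)
    (f1_bc : bc_function q1 f1) (f2_bc : bc_function q2 f2)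
    (H1_sa : self_adjoint_H q1 f1) (H2_sa : self_adjoint_H q2 f2)
    (m1_H1 : is_m_function q1 f1 m1) (m2_H2 : is_m_function q2 f2 m2)
    (a_gt0 : 0 < a) (eps_gt0 : 0 < eps) (eps_lt : eps < pi / 2)
    (m1_m2 : exists K : R, \forall r \near +oo,
      let z := ray (pi - eps) r in
      normc (m1 z - m2 z) <= K * expR (- (2 * complex.Im (sqrt_up z) * a))) :
  {ae (@lebesgue_measure R), forall x, x \in `[0, a] -> q1 x = q2 x}.
Proof.
have [p1 ip1 qp1] := q1_L1 _ a_gt0; have [p2 ip2 qp2] := q2_L1 _ a_gt0.
have [K HK] := m1_m2.
have cr x : 0 < x <= a -> cross p1 p2 x (0 +i* 1)%C = 0.
  move=> xa; exact: (cross_eq0 a_gt0 ip1 ip2 H1_sa H2_sa m1_H1 m2_H2 q1_L1 q2_L1 qp1 qp2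
    eps_gt0 eps_lt HK xa).
have E := cross_eq0_potential a_gt0 ip1 ip2 cr.
(* [E] concerns the open interval; the two endpoints form a null set. *)
have ends : {ae (@lebesgue_measure R), forall x, x != 0 /\ x != a}.
  have null c : (@lebesgue_measure R).-negligible [set c].
    by exists [set c]; split => //; exact: lebesgue_measure_set1.
  have := negligibleU (null 0) (null a); apply: negligibleS => x /= /not_andP[].
    by move=> /negP; rewrite negbK => /eqP; left.
  by move=> /negP; rewrite negbK => /eqP; right.
apply: ae_mono2 (ae_mono2 (S := fun x => x \in `[0, a] -> q1 x = p1 x /\ q2 x = p2 x) _ qp1 qp2)
  (ae_mono2 (S := fun x => x \in `[0, a] -> p1 x = p2 x) _ E ends).
- by move=> x h1 h2 xa; have [-> ->] := h1 xa; exact: h2.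
- by move=> x h1 h2 xa; rewrite h1// h2.
- move=> x h [x0 xa]; rewrite in_itv/= => /andP[h0 ha]; apply: h.
  by rewrite !lt_neqAle h0 ha xa eq_sym x0.
Qed.
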